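(* Let $Q$ be the type $A_n$ quiver $1\leftarrow 2\leftarrow\cdots\leftarrow n-1\leftarrow n$ and $m$ a vertex. For every $M\in\mathcal C_{Q,m}$, $\rho_{Q,m}(M)=HG(M)$, where $\rho_{Q,m}(M)$ and $M$ are regarded respectively as a reverse plane partition and a multiset of rim hooks of the rectangular Young diagram with $n+1-m$ rows and $m$ columns, as described in the context.
   Context: $\Bbbk$ algebraically closed. Indecomposable representations of $Q$ are the interval modules with support $[a,b]$, $1\le a\le b\le n$; $\mathcal C_{Q,m}$ consists of direct sums of those with $a\le m\le b$. $\mathsf P_{Q,m}$: these intervals, with $x\le y$ iff there is a path from $x$ to $y$ in the full subquiver of the Auslander–Reiten quiver on them; $\pi(x)$: vertex $i$ with $P_i$ in the $\tau$-orbit of $x$. $\operatorname{GenJF}(M)^i$: Jordan type at vertex $i$ of a generic nilpotent endomorphism of $M$; $\rho_{Q,m}(M):\mathsf P_{Q,m}\to\mathbb N$ lists on each chain $\pi^{-1}(i)$ the parts of $\operatorname{GenJF}(M)^i$ padded with zeros, decreasing going up. Let $\lambda$ be the Young diagram with $n+1-m$ rows of length $m$ (English notation); a reverse plane partition of $\lambda$ is a filling by nonnegative integers weakly increasing along rows and down columns. The element with support $[a,b]$ corresponds to the cell in row $n+1-b$ and column $m+1-a$; this turns $\rho_{Q,m}(M)$ into a reverse plane partition of $\lambda$. The southeast border of $\lambda$ consists of $n$ cells, read from southwest to northeast (bottom row left to right, then the last column upward); the indecomposable with support $[a,b]$ is identified with the rim hook consisting of the border cells in positions $a,a+1,\dots,b$.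 Thus $M$ is a multiset of rim hooks of $\lambda$ (with multiplicities), and $HG(M)$ denotes the reverse plane partition of $\lambda$ assigned to this multiset by the Hillman–Grassl correspondence (the classical bijection between multisets of rim hooks of $\lambda$ and reverse plane partitions of $\lambda$). *)

(* Defs.v *)
From HB Require Import structures.
From mathcomp Require Import all_boot all_order all_algebra.
From mathcomp Require Import mpoly.
Set Implicit Arguments. Unset Strict Implicit. Unset Printing Implicit Defensive.
Import GRing.Theory.
Local Open Scope ring_scope.

(* A module M in C_{Q,m} is given (up to iso) by the multiset of its     *)
(* interval summands, a list s of pairs (a,b) = support [a,b].           *)

Definition in_int (x : nat * nat) (i : nat) : bool := (x.1 <= i <= x.2)%N.

(* indices (positions in s) of the summands whose support contains i;
   they index the standard basis of M_i *)
Definition idxn (s : seq (nat * nat)) (i : nat) : seq nat :=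
  [seq j <- iota 0 (size s) | in_int (nth (0, 0) s j) i].

Definition dimv (s : seq (nat * nat)) (i : nat) : nat := size (idxn s i).

(* the map M_{i+1} -> M_i attached to the arrow i+1 -> i, acting on row
   vectors (v |-> v *m arrow_mx s i): identity on each summand containing
   both i and i+1, zero otherwise *)
Definition arrow_mx (k : fieldType) (s : seq (nat * nat)) (i : nat) :
    'M[k]_(dimv s i.+1, dimv s i) :=
  \matrix_(p, q) ((nth 0 (idxn s i.+1) p == nth 0 (idxn s i) q)%:R).

(* a family of linear maps f_i : M_i -> M_i (for all vertices; only
   1 <= i <= n matter) *)
Definition famT (k : fieldType) (s : seq (nat * nat)) :=
  forall i : nat, 'M[k]_(dimv s i).

Definition is_end (k : fieldType) (n : nat) (s : seq (nat * nat))
    (f : famT k s) : Prop :=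
  forall i, (1 <= i < n)%N -> f i.+1 *m arrow_mx k s i = arrow_mx k s i *m f i.

Definition is_nend (k : fieldType) (n : nat) (s : seq (nat * nat))
    (f : famT k s) : Prop :=
  is_end n f /\ forall i, (1 <= i <= n)%N -> exists N : nat, f i ^+ N = 0.

(* coordinate j = (i, p, q) encoded as j = i * D^2 + p * D + q, D = size s *)
Definition nvars (n : nat) (s : seq (nat * nat)) : nat :=
  (n.+1 * (size s * size s))%N.

Definition entry (k : fieldType) (d : nat) (A : 'M[k]_d) (p q : nat) : k :=
  match (insub p : option 'I_d), (insub q : option 'I_d) with
  | Some p', Some q' => A p' q'
  | _, _ => 0
  end.

Definition coord (k : fieldType) (n : nat) (s : seq (nat * nat))
    (f : famT k s) (j : 'I_(nvars n s)) : k :=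
  let D := size s in
  entry (f (j %/ (D * D))%N) ((j %% (D * D)) %/ D)%N (j %% D)%N.

(* "P holds for a generic nilpotent endomorphism of M": P holds on a
   dense open subset of the variety NEnd(M) (Zariski topology), i.e. on
   some basic open subset {f in NEnd(M) | g(f) <> 0} which is dense in
   NEnd(M) (every polynomial vanishing on it vanishes on NEnd(M)).  *)
Definition generically (k : fieldType) (n : nat) (s : seq (nat * nat))
    (P : famT k s -> Prop) : Prop :=
  exists g : {mpoly k[nvars n s]},
    (forall h : {mpoly k[nvars n s]},
        (forall f : famT k s, is_nend n f ->
           g.@[(@coord k n s f)] != 0 -> h.@[(@coord k n s f)] = 0) ->
        forall f : famT k s, is_nend n f -> h.@[(@coord k n s f)] = 0) /\
    (forall f : famT k s, is_nend n f -> g.@[(@coord k n s f)] != 0 -> P f).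

Definition is_partition (lam : seq nat) : bool :=
  sorted geq lam && all (fun x => 0 < x)%N lam.

Definition psums (lam : seq nat) : seq nat :=
  [seq sumn (take j lam) | j <- iota 1 (size lam)].

(* the nilpotent Jordan matrix with blocks of sizes lam (in order) *)
Definition jmx (k : fieldType) (d : nat) (lam : seq nat) : 'M[k]_d :=
  \matrix_(p, q) ((((q : nat) == p.+1) && (p.+1 \notin psums lam))%:R).

Definition jtype (k : fieldType) (d : nat) (A : 'M[k]_d) (lam : seq nat) : Prop :=
  [/\ is_partition lam, sumn lam = d &
      exists2 P : 'M[k]_d, P \in unitmx & A = invmx P *m jmx k d lam *m P].

Definition gen_jf (k : fieldType) (n : nat) (s : seq (nat * nat)) (i : nat)
    (lam : seq nat) : Prop :=
  @generically k n s (fun f : famT k s => jtype (f i) lam).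

Definition inP (n m : nat) (x : nat * nat) : bool :=
  (1 <= x.1 <= m)%N && (m <= x.2 <= n)%N.

(* arrows of the AR quiver of 1 <- 2 <- ... <- n between intervals:
   [a,b] -> [a,b+1] and [a,b] -> [a+1,b] *)
Definition ar_arrow (x y : nat * nat) : bool :=
  (y == (x.1, x.2.+1)) || (y == (x.1.+1, x.2)).

Definition ptype (n : nat) := ('I_n.+1 * 'I_n.+1)%type.
Definition pval (n : nat) (x : ptype n) : nat * nat := (val x.1, val x.2).
Definition toP (n : nat) (x : nat * nat) : ptype n := (inord x.1, inord x.2).

Definition subarrow (n m : nat) : rel (ptype n) :=
  fun x y => [&& inP n m (pval x), inP n m (pval y) & ar_arrow (pval x) (pval y)].

Definition leP (n m : nat) (x y : ptype n) : bool := connect (@subarrow n m) x y.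

(* AR translation tau [a,b] = [a-1,b-1]; projective P_i has support [1,i];
   pi(x) = the i such that P_i lies in the tau-orbit of x, obtained by
   applying tau (a-1) times to x = [a,b], giving [1, b-a+1]. *)
Definition tau (x : nat * nat) : nat * nat := (x.1.-1, x.2.-1).
Definition proj_supp (i : nat) : nat * nat := (1%N, i).
Definition ar_pi (x : nat * nat) : nat := (iter x.1.-1 tau x).2.

Definition chain_rank (n m : nat) (x : nat * nat) : nat :=
  #|[pred y : ptype n | [&& inP n m (pval y), ar_pi (pval y) == ar_pi x,
                           y != toP n x & @leP n m y (toP n x)]]|.

(* rho_{Q,m}(M)(x), given lam i = GenJF(M)^i: on each chain pi^{-1}(i) the
   parts of lam i (padded with zeros), decreasing going up *)
Definition rhoP (n m : nat) (lam : nat -> seq nat) (x : nat * nat) : nat :=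
  nth 0%N (lam (ar_pi x)) (chain_rank n m x).

(* rho as a filling of the (n+1-m) x m rectangle: [a,b] <-> cell
   (row n+1-b, column m+1-a), i.e. cell (r,c) <-> [m+1-c, n+1-r] *)
Definition rho_cell (n m : nat) (lam : nat -> seq nat) (r c : nat) : nat :=
  rhoP n m lam (m.+1 - c, n.+1 - r)%N.

(* Hillman-Grassl correspondence on the R x C rectangle (rows 1..R,       *)
(* columns 1..C, English notation).  Fillings are nat -> nat -> nat.      *)

Definition rpp_b (R C : nat) (pp : nat -> nat -> nat) : bool :=
  all (fun r => all (fun c =>
        ((c < C) ==> (pp r c <= pp r c.+1)) &&
        ((r < R) ==> (pp r c <= pp r.+1 c)))%N (iota 1 C)) (iota 1 R).

Definition total (R C : nat) (pp : nat -> nat -> nat) : nat :=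
  sumn [seq sumn [seq pp r c | c <- iota 1 C] | r <- iota 1 R].

Fixpoint hg_path (fuel : nat) (C : nat) (pp : nat -> nat -> nat)
    (i j : nat) : seq (nat * nat) :=
  match fuel with
  | 0 => [:: (i, j)]
  | fuel'.+1 =>
      (i, j) ::
      (if (1 < i)%N && (pp i.-1 j == pp i j) then hg_path fuel' C pp i.-1 j
       else if (j < C)%N then hg_path fuel' C pp i j.+1 else [::])
  end.

(* inverse Hillman-Grassl map (Stanley EC2, proof of Thm 7.22.1): repeatedly
   start at the southernmost nonzero entry of the westernmost nonzero column
   j0, follow the path to the end of some row i0, subtract 1 along the path,
   and record the hook of cell (i0,j0).  Hook of (i0,j0) <-> rim hook from
   bottom-row column j0 to last-column row i0 <-> border positions
   j0 .. n+1-i0, recorded as the interval (j0, n+1-i0). *)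
Fixpoint hginv (fuel : nat) (n R C : nat) (pp : nat -> nat -> nat)
    : seq (nat * nat) :=
  match fuel with
  | 0 => [::]
  | fuel'.+1 =>
      let colnz c := has (fun r => pp r c != 0%N) (iota 1 R) in
      let cols := [seq c <- iota 1 C | colnz c] in
      if cols is j0 :: _ then
        let i1 := last 0%N [seq r <- iota 1 R | pp r j0 != 0%N] in
        let p := hg_path (R + C) C pp i1 j0 in
        let i0 := (last (i1, j0) p).1 in
        let pp' := fun r c => (pp r c - ((r, c) \in p))%N in
        (j0, n.+1 - i0)%N :: hginv fuel' n R C pp'
      else [::]
  end.

Definition hginv_full (n R C : nat) (pp : nat -> nat -> nat) : seq (nat * nat) :=
  hginv (total R C pp).+1 n R C pp.

Definition ofF (R C K : nat) (F : {ffun 'I_R * 'I_C -> 'I_K}) (r c : nat) : nat :=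
  match (insub r.-1 : option 'I_R), (insub c.-1 : option 'I_C) with
  | Some r', Some c' => val (F (r', c'))
  | _, _ => 0%N
  end.

(* HG(M): the reverse plane partition of the (n+1-m) x m rectangle whose
   image under the inverse Hillman-Grassl map is the multiset of rim hooks M
   (entries of such a filling are at most size M). *)
Definition HG (n m : nat) (M : seq (nat * nat)) : nat -> nat -> nat :=
  let R := (n.+1 - m)%N in
  match [pick F : {ffun 'I_R * 'I_m -> 'I_(size M).+1} |
           rpp_b R m (ofF F) && perm_eq (hginv_full n R m (ofF F)) M] with
  | Some F => ofF F
  | None => fun _ _ => 0%N
  end.

(* Main.v *)
(* All summands contain m, so in the basis of M_m an endomorphism is a matrix
   supported on the order of the intervals by both endpoints, and its
   restriction to M_i is the corner on the summands through i.  Ties being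
   broken lexicographically, the Jordan type of a generic nilpotent one at i is
   the Greene-Kleitman shape of that finite poset.  A Kleitman-style uncrossing
   argument and rank inequalities for generic corners show that deleting the
   minimal summand [a,b] lowers these shapes by one along the path of cells
   that the inverse Hillman-Grassl algorithm follows to remove the hook (a,b).
   By induction the shapes form a reverse plane partition sent to M, and the
   inverse algorithm is injective on reverse plane partitions. *)
Require Import Defs.
From HB Require Import structures.
From mathcomp Require Import all_boot all_order all_algebra.
From mathcomp Require Import mpoly.
From mathcomp Require Import zify.
Set Implicit Arguments. Unset Strict Implicit. Unset Printing Implicit Defensive.
Import GRing.Theory.

(** * Greene-Kleitman shapes of orders of dimension two *)

(** Nilpotent Jordan types are compared through ranks of powers: a partition is determined by the
    sums over its parts of max(part - h, 0). Uncrossing is pure combinatorics. It yields concavity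
    and interlacing, and shows that the row receiving the box of the deleted summand moves by 0 or 1
    from one vertex to the next. It does not decide between the two cases, whereas the
    Hillman-Grassl path does so by an equality test. The missing inequalities, sub- and
    supermodularity of the truncated sums [gk_rank], come from row spaces and from Frobenius' rank
    inequality, applied to one strict matrix that is generic for two corners at once; this is why
    the rank theorem precedes the analysis of the path. Density in NEnd(M) is a separate obstacle,
    since this variety is not a linear space: irreducibility is expressed by polynomial curves
    through any two of its points. Algebraic closure enters as the existence of a non-root for every
    nonzero polynomial in one variable. *)

Section GreeneKleitman.
Variables (T : finType) (al be : T -> nat).
Implicit Types (p q x : T) (A B C D S X Y Z : {set T}) (k n : nat).

Definition plt p q := (al p < al q) && (be p < be q).
(** With [al] and [be] injective, two distinct points are comparable for exactly one of [plt] and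
    [conj_lt], so antichains of one order are chains of the other. *)
Definition conj_lt p q := (al p < al q) && (be q < be p).

Definition antichain X := [forall p in X, forall q in X, ~~ plt p q].

Definition width_le k A :=
  [forall X : {set T}, (X \subset A) && antichain X ==> (#|X| <= k)].

(** By Dilworth's theorem a set of width at most k is a union of k chains, so this is the k-th
    Greene-Kleitman number. Widths are used because they are what uncrossing controls. *)
Definition gk k S := \max_(B : {set T} | (B \subset S) && width_le k B) #|B|.

Definition gk_part S k := gk k.+1 S - gk k S.

Lemma pltE p q : plt p q = (al p < al q) && (be p < be q).
Proof. by []. Qed.

Lemma gk_partE S k : gk_part S k = gk k.+1 S - gk k S.
Proof. by []. Qed.

Lemma plt_irr p : plt p p = false.
Proof. by rewrite /plt ltnn. Qed.

Lemma conj_lt_trans : transitive conj_lt.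
Proof.
by move=> q p r /andP[h1 h2] /andP[h3 h4]; rewrite /conj_lt (ltn_trans h1) // (ltn_trans h4).
Qed.

Lemma antichainP X :
  reflect {in X &, forall p q, plt p q = false} (antichain X).
Proof.
apply: (iffP forall_inP) => [h p q pX qX|h p pX].
  by apply/negbTE; exact: (forall_inP (h p pX)).
by apply/forall_inP => q qX; rewrite h.
Qed.

Lemma width_leP k A :
  reflect (forall X, X \subset A -> antichain X -> #|X| <= k) (width_le k A).
Proof.
apply: (iffP forallP) => [h X XA aX|h X].
  by have := h X; rewrite XA aX.
by apply/implyP => /andP[]; exact: h.
Qed.

Lemma width_leS k l A B : k <= l -> A \subset B -> width_le k B -> width_le l A.
Proof.
move=> kl AB /width_leP h; apply/width_leP => X XA aX.
by rewrite (leq_trans _ kl) // h // (subset_trans XA).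
Qed.

Lemma width_le_card k A : #|A| <= k -> width_le k A.
Proof. by move=> h; apply/width_leP => X /subset_leq_card/leq_trans->. Qed.

Lemma width_le0 k : width_le k set0.
Proof. by apply: width_le_card; rewrite cards0. Qed.

Lemma gk_ge k S B : B \subset S -> width_le k B -> #|B| <= gk k S.
Proof. by move=> BS wB; apply: (@leq_bigmax_cond _ _ (fun B : {set T} => #|B|)); rewrite BS. Qed.

Lemma gk_witness k S : {B : {set T} | [/\ B \subset S, width_le k B & #|B| = gk k S]}.
Proof.
rewrite /gk.
have : (set0 \subset S) && width_le k set0 by rewrite sub0set width_le0.
move=> h; case: (eq_bigmax_cond (fun B : {set T} => #|B|) (A := [pred B : {set T} | (B \subset S) && width_le k B])).
  by apply/card_gt0P; exists set0.
by move=> B /andP[BS wB] e; exists B; split=> //; rewrite -e.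
Qed.

Lemma gk_le_card k S : gk k S <= #|S|.
Proof. by case: (gk_witness k S) => B [BS _ <-]; exact: subset_leq_card. Qed.

Lemma gk_all k S : width_le k S -> gk k S = #|S|.
Proof. by move=> h; apply/eqP; rewrite eqn_leq gk_le_card gk_ge. Qed.

Lemma gkS k l S S' : k <= l -> S \subset S' -> gk k S <= gk l S'.
Proof.
move=> kl SS; case: (gk_witness k S) => B [BS wB <-].
by apply: gk_ge; [exact: subset_trans BS SS | exact: width_leS kl _ wB].
Qed.

Lemma gk0 S : gk 0 S = 0.
Proof.
case: (gk_witness 0 S) => B [_ /width_leP wB <-]; apply/eqP; rewrite -leqn0 leqNgt.
apply/negP => /card_gt0P[p pB].
suff : #|[set p]| <= 0 by rewrite cards1.
apply: wB; first by rewrite sub1set.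
by apply/antichainP => a b /set1P-> /set1P->; rewrite plt_irr.
Qed.

Lemma card_le_inj k C (phi : T -> nat) :
  {in C, forall p, phi p < k} -> {in C &, injective phi} -> #|C| <= k.
Proof.
move=> hk inj; rewrite cardE -(size_map phi) -[k in _ <= k](size_iota 0).
apply: uniq_leq_size.
  by rewrite map_inj_in_uniq ?enum_uniq // => p q; rewrite !mem_enum; exact: inj.
by move=> i /mapP[p]; rewrite mem_enum => /hk h ->; rewrite mem_iota add0n.
Qed.

(** On an antichain inside [C] the map [phi] is injective with values below k. *)
Lemma width_le_height k C (phi : T -> nat) :
  {in C, forall p, phi p < k} ->
  {in C &, forall p q, p != q -> ~~ plt p q -> ~~ plt q p -> phi p != phi q} ->
  width_le k C.
Proof.
move=> hk hinj; apply/width_leP => X XC /antichainP aX.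
have /subsetP XC' := XC.
apply: (card_le_inj (phi := phi)) => [p /XC'|p q pX qX]; first exact: hk.
by apply: contra_eq => npq; apply: hinj; rewrite ?aX ?XC'.
Qed.

Hypotheses (al_inj : injective al) (be_inj : injective be).

Lemma comparable_or p q : p != q -> [|| plt p q, plt q p, conj_lt p q | conj_lt q p].
Proof.
move=> npq; rewrite /plt /conj_lt.
have : al p != al q by rewrite (inj_eq al_inj).
have : be p != be q by rewrite (inj_eq be_inj).
lia.
Qed.

Lemma width_le_conj k C (phi : T -> nat) :
  {in C, forall p, phi p < k} ->
  {in C &, forall p q, conj_lt p q -> phi p < phi q} -> width_le k C.
Proof.
move=> hk hm; apply: (width_le_height (phi := phi)) => // p q pC qC npq h1 h2.
have := comparable_or npq; rewrite (negbTE h1) (negbTE h2) /=.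
by case/orP=> /hm h; [have := h pC qC|have := h qC pC]; rewrite neq_ltn => ->; rewrite ?orbT.
Qed.

Definition mult_card A B Y := #|Y :&: A| + #|Y :&: B|.

Definition conj_height A B p :=
  \max_(Y : {set T} | [&& Y \subset A :|: B, antichain Y
                        & [forall q in Y, conj_lt q p]]) mult_card A B Y.

(* An antichain is a chain for the conjugate order.  The points of A and B are
   redistributed according to the parity of their height, the largest weight
   (counted with multiplicity in A and B) of a conjugate chain below them. *)
Section Uncross.
Variables (A B X Z : {set T}) (a b n : nat).
Local Notation w := (mult_card A B).
Local Notation ht0 := (conj_height A B).

Lemma uncross_wU1 Y p : p \notin Y -> w (p |: Y) = (p \in A) + (p \in B) + w Y.
Proof.
move=> pY; rewrite /mult_card !setIUl.
have E (S : {set T}) : #|([set p] :&: S) :|: (Y :&: S)| = (p \in S) + #|Y :&: S|.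
  case: (boolP (p \in S)) => pS.
    by rewrite (setIidPl _) ?sub1set // cardsU1 inE (negbTE pY).
  have -> : [set p] :&: S = set0 by apply/setP=> z; rewrite !inE; case: eqP => // ->; rewrite (negbTE pS).
  by rewrite set0U.
by rewrite !E; lia.
Qed.

Lemma uncross_ht0P p : exists2 Y : {set T}, [&& Y \subset A :|: B, antichain Y
      & [forall q in Y, conj_lt q p]] & ht0 p = w Y.
Proof.
rewrite /conj_height; case: (eq_bigmax_cond w (A := [pred Y : {set T} | [&& Y \subset A :|: B, antichain Y
                                   & [forall q in Y, conj_lt q p]]])).
  apply/card_gt0P; exists set0; rewrite inE sub0set /=; apply/andP; split.
    by apply/antichainP => ? ?; rewrite inE.
  by apply/forall_inP => ?; rewrite inE.
by move=> Y hY e; exists Y.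
Qed.

Lemma uncross_ext p Y : p \in A :|: B -> 
  [&& Y \subset A :|: B, antichain Y & [forall q in Y, conj_lt q p]] ->
  [/\ p |: Y \subset A :|: B, antichain (p |: Y) & p \notin Y].
Proof.
move=> pAB /and3P[YAB /antichainP aY /forall_inP cY]; split.
- by rewrite subUset sub1set pAB.
- apply/antichainP => u v /setU1P[->|uY] /setU1P[->|vY].
  + exact: plt_irr.
  + by move: (cY v vY); rewrite /conj_lt /plt; lia.
  + by move: (cY u uY); rewrite /conj_lt /plt; lia.
  + exact: aY.
by apply/negP => /cY; rewrite /conj_lt ltnn.
Qed.

Lemma uncross_ht0_mono p q : p \in A :|: B -> conj_lt p q ->
  ht0 p + ((p \in A) + (p \in B)) <= ht0 q.
Proof.
move=> pAB pq; have [Y hY ->] := uncross_ht0P p.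
have [sY aY pY] := uncross_ext pAB hY.
rewrite addnC -uncross_wU1 //; apply: (@leq_bigmax_cond _ _ w).
rewrite sY aY /=; apply/forall_inP => u /setU1P[->//|uY].
by apply: conj_lt_trans pq; case/and3P: hY => _ _ /forall_inP; exact.
Qed.

Hypotheses (wA : width_le a A) (wB : width_le b B) (nE : n = a + b).

Lemma uncross_w_le Y : antichain Y -> w Y <= n.
Proof.
move=> aY; rewrite nE /mult_card leq_add //.
  apply: (width_leP _ _ wA); first exact: subsetIr.
  by apply/antichainP => p q /setIP[pY _] /setIP[qY _]; apply: (antichainP _ aY).
apply: (width_leP _ _ wB); first exact: subsetIr.
by apply/antichainP => p q /setIP[pY _] /setIP[qY _]; apply: (antichainP _ aY).
Qed.

Lemma uncross_ht0_bound p : p \in A :|: B -> ht0 p + ((p \in A) + (p \in B)) <= n.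
Proof.
move=> pAB; have [Y hY ->] := uncross_ht0P p.
have [_ aY pY] := uncross_ext pAB hY.
by have := uncross_w_le aY; rewrite uncross_wU1 // addnC.
Qed.

Hypothesis XZ : [disjoint X & Z].
Hypotheses (XAB : X :&: (A :&: B) = set0) (ZAB : Z :&: (A :&: B) = set0).
Hypothesis Xmin : forall x p, x \in X -> p \in A :|: B -> conj_lt p x = false.
Hypothesis Zmax : forall z p, z \in Z -> p \in A :|: B -> conj_lt z p = false.

(** Overriding the height on [Z] puts all of [Z] in one parity class. The value n.-1 is the largest
    allowed for a point of multiplicity one, and no point of [A :|: B] lies above [Z], so
    monotonicity survives. *)
Let ht p := if p \in Z then n.-1 else ht0 p.

Lemma uncross_ht_bound p : p \in A :|: B -> ht p + ((p \in A) + (p \in B)) <= n.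
Proof.
move=> pAB; have := uncross_ht0_bound pAB; rewrite /ht; case: ifP => // pZ.
have : p \notin A :&: B.
  by apply/negP => pAB'; have := in_set0 p; rewrite -ZAB inE pZ pAB'.
by move: pAB; rewrite !inE; case: (p \in A); case: (p \in B) => //=; lia.
Qed.

Lemma uncross_ht_mono p q : p \in A :|: B -> q \in A :|: B -> conj_lt p q ->
  ht p + ((p \in A) + (p \in B)) <= ht q.
Proof.
move=> pAB qAB pq; rewrite /ht; case: ifP => pZ.
  by move: pq; rewrite Zmax.
case: ifP => qZ; last exact: uncross_ht0_mono.
have qN : (q \in A) && (q \in B) = false.
  by apply/negP => /andP[qA qB]; have := in_set0 q; rewrite -ZAB !inE qZ qA qB.
move: qAB qN (uncross_ht0_mono pAB pq) (uncross_ht0_bound qAB); rewrite inE.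
by clear; case: (q \in A); case: (q \in B) => //= _ _; lia.
Qed.

Lemma uncross_ht_min x : x \in X -> ht x = 0.
Proof.
move=> xX; rewrite /ht; case: ifP => xZ.
  by have /pred0P/(_ x) := XZ; rewrite /= xX xZ.
have [Y /and3P[/subsetP YAB _ /forall_inP cY] ->] := uncross_ht0P x.
have -> : Y = set0.
  by apply/setP => y; rewrite inE; apply/negP => yY; move: (cY y yY); rewrite Xmin // YAB.
by rewrite /mult_card !set0I cards0.
Qed.

Lemma uncross : exists C D, 
  [/\ #|C| + #|D| = #|A| + #|B|, C :|: D \subset A :|: B,
      width_le (uphalf n) C, width_le n./2 D
    & X :&: D = set0 /\ (if odd n then Z :&: D = set0 else Z :&: C = set0)].
Proof.
pose O := [set p in A :|: B | odd (ht p)].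
(* Points of multiplicity two go to both sets: a jump of 2 in height raises both halved heights. A
   jump of 1 raises [uphalf] when it starts from an even height, and [half] when it starts from an
   odd one. *)
pose C := (A :&: B) :|: ((A :|: B) :\: O).
pose D := (A :&: B) :|: O.
have nZ p : p \in A -> p \in B -> p \in Z = false.
  by move=> pA pB; apply/negP => pZ; have := in_set0 p; rewrite -ZAB !inE pZ pA pB.
have nX p : p \in A -> p \in B -> p \in X = false.
  by move=> pA pB; apply/negP => pX; have := in_set0 p; rewrite -XAB !inE pX pA pB.
exists C, D; split.
- have E1 : C :|: D = A :|: B.
    by apply/setP => p; rewrite !inE; case: (p \in A); case: (p \in B); case: (odd _).
  have E2 : C :&: D = A :&: B.
    by apply/setP => p; rewrite !inE; case: (p \in A); case: (p \in B); case: (odd _).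
  by rewrite -cardsUI E1 E2 cardsUI.
- apply/subsetP => p; rewrite !inE; case: (p \in A); case: (p \in B) => //.
- apply: (width_le_conj (phi := fun p => uphalf (ht p))) => p.
    move=> pC; have pAB : p \in A :|: B by move: pC; rewrite !inE; case: (p \in A); case: (p \in B).
    have := uncross_ht_bound pAB.
    by move: pC; rewrite !inE; case: (p \in A); case: (p \in B) => //=; lia.
  move=> q pC qC pq.
  have pAB : p \in A :|: B by move: pC; rewrite !inE; case: (p \in A); case: (p \in B).
  have qAB : q \in A :|: B by move: qC; rewrite !inE; case: (q \in A); case: (q \in B).
  move: (uncross_ht_mono pAB qAB pq) pC; rewrite !inE.
  clear; case: (p \in A); case: (p \in B) => //=; lia.
- apply: (width_le_conj (phi := fun p => (ht p)./2)) => p.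
    move=> pC; have pAB : p \in A :|: B by move: pC; rewrite !inE; case: (p \in A); case: (p \in B).
    have := uncross_ht_bound pAB.
    by move: pC; rewrite !inE; case: (p \in A); case: (p \in B) => //=; lia.
  move=> q pC qC pq.
  have pAB : p \in A :|: B by move: pC; rewrite !inE; case: (p \in A); case: (p \in B).
  have qAB : q \in A :|: B by move: qC; rewrite !inE; case: (q \in A); case: (q \in B).
  move: (uncross_ht_mono pAB qAB pq) pC; rewrite !inE.
  clear; case: (p \in A); case: (p \in B) => //=; lia.
split.
  apply/setP => x; rewrite !inE; apply/negP => /andP[xX].
  rewrite uncross_ht_min // andbF orbF => /andP[xA xB].
  by rewrite nX in xX.
have hZ z : z \in Z -> z \in A :|: B -> odd (ht z) = ~~ odd n.
  move=> zZ zAB; rewrite /ht zZ; have := uncross_ht0_bound zAB.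
  by move: zAB; rewrite inE; case: (z \in A); case: (z \in B) => //=; lia.
have nAB z : z \in Z -> (z \in A) && (z \in B) = false.
  by move=> zZ; apply/negP => /andP[zA zB]; move: zZ; rewrite nZ.
case: ifP => on; apply/setP => z; rewrite !inE; apply/negP => /andP[zZ];
  have := hZ z zZ; rewrite nAB // inE on.
  by move=> h /= /andP[h1]; rewrite h.
by move=> h /= /andP[h1 h2]; move: h1; rewrite h2 h.
Qed.
End Uncross.

(** Dilworth's theorem, from the heights of the uncrossing argument with [B] empty: two points of
    the same colour are [plt]-comparable. *)
Lemma width_le_coloring k A : width_le k A -> exists2 phi : T -> nat,
  {in A, forall p, phi p < k} & {in A &, forall p q, conj_lt p q -> phi p < phi q}.
Proof.
move=> wA; have w0 := width_le0 0.
exists (conj_height A set0) => [p pA|p q pA qA pq].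
  have pA0 : p \in A :|: set0 by rewrite inE pA.
  by have := uncross_ht0_bound wA w0 (esym (addn0 k)) pA0; rewrite inE pA addn0 addn1.
have pA0 : p \in A :|: set0 by rewrite inE pA.
by have := uncross_ht0_mono pA0 pq; rewrite inE pA addn0 addn1.
Qed.

Definition conj_min X S := forall x p, x \in X -> p \in S -> conj_lt p x = false.
Definition conj_max Z S := forall z p, z \in Z -> p \in S -> conj_lt z p = false.

(** [X] has height 0 and thus avoids [D]; the parity of a + b decides which set [Z] avoids. In the
    odd case [D] loses both [X] and [Z], in the even case each of [C] and [D] loses one of them. *)
Lemma gk_uncross_odd S X Z a b : odd (a + b) ->
  [disjoint X & Z] -> [disjoint X & S] -> [disjoint Z & S] ->
  conj_min X (S :|: X :|: Z) -> conj_max Z (S :|: X :|: Z) ->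
  gk a (S :|: X) + gk b (S :|: Z) <= gk (uphalf (a + b)) (S :|: X :|: Z) + gk (a + b)./2 S.
Proof.
move=> oab XZ XS ZS Xm Zm.
case: (gk_witness a (S :|: X)) => A [/subsetP AS wA <-].
case: (gk_witness b (S :|: Z)) => B [/subsetP BS wB <-].
have dXZ x : x \in X -> x \in Z -> False by move=> x1 x2; have /pred0P/(_ x) := XZ; rewrite /= x1 x2.
have dXS x : x \in X -> x \in S -> False by move=> x1 x2; have /pred0P/(_ x) := XS; rewrite /= x1 x2.
have dZS x : x \in Z -> x \in S -> False by move=> x1 x2; have /pred0P/(_ x) := ZS; rewrite /= x1 x2.
have AB p : p \in A :|: B -> p \in S :|: X :|: Z.
  by rewrite !inE => /orP[/AS|/BS]; rewrite !inE => /orP[]->; rewrite ?orbT.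
have [||||C [D [<- /subsetP CD wC wD [XD ZD]]]] := @uncross A B X Z a b _ wA wB erefl XZ.
- apply/setP=> x; rewrite !inE; apply/negP => /and3P[xX _ /BS]; rewrite inE => /orP[/dXS|/dXZ]; exact.
- apply/setP=> x; rewrite !inE; apply/negP => /and3P[xZ /AS]; rewrite inE => /orP[/dZS|/dXZ]; exact.
- by move=> x p xX /AB; exact: Xm.
- by move=> x p xX /AB; exact: Zm.
apply: leq_add; apply: gk_ge => //; apply/subsetP => p pC.
  by apply/AB/CD; rewrite inE pC.
have : p \in S :|: X :|: Z by apply/AB/CD; rewrite inE pC orbT.
rewrite oab in ZD.
rewrite !inE -orbA => /or3P[//|pX|pZ].
  by have := in_set0 p; rewrite -XD inE pX pC.
by have := in_set0 p; rewrite -ZD inE pZ pC.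
Qed.

Lemma gk_uncross_even S X Z a b : ~~ odd (a + b) ->
  [disjoint X & Z] -> [disjoint X & S] -> [disjoint Z & S] ->
  conj_min X (S :|: X :|: Z) -> conj_max Z (S :|: X :|: Z) ->
  gk a (S :|: X :|: Z) + gk b S <= gk (a + b)./2 (S :|: X) + gk (a + b)./2 (S :|: Z).
Proof.
move=> oab XZ XS ZS Xm Zm.
case: (gk_witness a (S :|: X :|: Z)) => A [/subsetP AS wA <-].
case: (gk_witness b S) => B [/subsetP BS wB <-].
have dXS x : x \in X -> x \in S -> False by move=> x1 x2; have /pred0P/(_ x) := XS; rewrite /= x1 x2.
have dZS x : x \in Z -> x \in S -> False by move=> x1 x2; have /pred0P/(_ x) := ZS; rewrite /= x1 x2.
have AB p : p \in A :|: B -> p \in S :|: X :|: Z.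
  by rewrite inE => /orP[/AS//|/BS]; rewrite !inE => ->.
have [||||C [D [<- /subsetP CD wC wD [XD ZD]]]] := @uncross A B X Z a b _ wA wB erefl XZ.
- apply/setP=> x; rewrite !inE; apply/negP => /and3P[xX _ /BS]; exact: dXS.
- apply/setP=> x; rewrite !inE; apply/negP => /and3P[xX _ /BS]; exact: dZS.
- by move=> x p xX /AB; exact: Xm.
- by move=> x p xX /AB; exact: Zm.
have uE : uphalf (a + b) = (a + b)./2 by move: oab; clear; lia.
rewrite uE in wC; rewrite (negbTE oab) in ZD.
apply: leq_add; apply: gk_ge => //; apply/subsetP => p pC.
  have : p \in S :|: X :|: Z by apply/AB/CD; rewrite inE pC.
  rewrite inE => /orP[//|pZ].
  by have := in_set0 p; rewrite -ZD inE pZ pC.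
have : p \in S :|: X :|: Z by apply/AB/CD; rewrite inE pC orbT.
rewrite !inE -orbA => /or3P[->//|pX|->]; last by rewrite orbT.
by have := in_set0 p; rewrite -XD inE pX pC.
Qed.

(** Uncrossing a witness of width k.+2 with one of width k gives two sets of width k.+1. *)
Lemma gk_concave S k : gk k S + gk k.+2 S <= gk k.+1 S + gk k.+1 S.
Proof.
have := @gk_uncross_even S set0 set0 k.+2 k; rewrite !setU0 => h.
have E : (k.+2 + k)./2 = k.+1 by lia.
rewrite E in h; rewrite addnC; apply: h; rewrite ?disjoints_subset ?sub0set //; first by lia.
- by move=> x p; rewrite inE.
- by move=> x p; rewrite inE.
Qed.

Lemma gkE S k : gk k.+1 S = gk k S + gk_part S k.
Proof. by rewrite /gk_part subnKC // gkS. Qed.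

Lemma gk_part_noninc S k l : k <= l -> gk_part S l <= gk_part S k.
Proof.
move=> /subnK <-; elim: (l - k) => [|d IH] //; rewrite addSn; apply: leq_trans IH.
by have := gk_concave S (d + k); have := gkE S (d + k); have := gkE S (d + k).+1; lia.
Qed.

Lemma gk_sum S k : gk k S = \sum_(j < k) gk_part S j.
Proof. by elim: k => [|k IH]; rewrite ?big_ord0 ?gk0 // gkE big_ord_recr IH. Qed.

Lemma gk_part_eq0 S k : width_le k S -> gk_part S k = 0.
Proof.
by move=> w; rewrite /gk_part !gk_all ?subnn //; apply: width_leS w.
Qed.

Section Add.
Variables (S X Z : {set T}).
Hypotheses (XZ : [disjoint X & Z]) (XS : [disjoint X & S]) (ZS : [disjoint Z & S]).
Hypotheses (Xm : conj_min X (S :|: X :|: Z)) (Zm : conj_max Z (S :|: X :|: Z)).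

(** This inequality and [gk_add_r], for a one-point [X], say that the row of the box added by [X]
    moves down by 0 or 1 once [Z] is present ([box_row_le]). *)
Lemma gk_add_sub j :
  gk j (S :|: X :|: Z) + gk j S <= gk j (S :|: X) + gk j (S :|: Z).
Proof.
have E : (j + j)./2 = j by lia.
by have := @gk_uncross_even S X Z j j; rewrite E; apply=> //; lia.
Qed.

Lemma gk_add_l j :
  gk j.+1 (S :|: X) + gk j (S :|: Z) <= gk j.+1 (S :|: X :|: Z) + gk j S.
Proof.
have E : uphalf (j.+1 + j) = j.+1 by lia.
have E2 : (j.+1 + j)./2 = j by lia.
by have := @gk_uncross_odd S X Z j.+1 j; rewrite E E2; apply=> //; lia.
Qed.

Lemma gk_add_r j :
  gk j (S :|: X) + gk j.+1 (S :|: Z) <= gk j.+1 (S :|: X :|: Z) + gk j S.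
Proof.
have E : uphalf (j + j.+1) = j.+1 by lia.
have E2 : (j + j.+1)./2 = j by lia.
by have := @gk_uncross_odd S X Z j j.+1; rewrite E E2; apply=> //; lia.
Qed.
End Add.

Lemma conj_min0 S : conj_min set0 S. Proof. by move=> x p; rewrite inE. Qed.
Lemma conj_max0 S : conj_max set0 S. Proof. by move=> x p; rewrite inE. Qed.

(** Together with [gk_part_interlace]: adding conjugate-maximal points adds a horizontal strip to
    the shape. Both are uncrossings with [X] empty. *)
Lemma gk_part_add S Z k : [disjoint Z & S] -> conj_max Z (S :|: Z) ->
  gk_part S k <= gk_part (S :|: Z) k.
Proof.
move=> ZS Zm.
have := @gk_add_l S set0 Z; rewrite !setU0 => /(_ _ _ ZS (@conj_min0 _) Zm k).
rewrite !disjoints_subset !sub0set => /(_ isT isT).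
by rewrite !gkE; lia.
Qed.

Lemma gk_part_interlace S Z k : [disjoint Z & S] -> conj_max Z (S :|: Z) ->
  gk_part (S :|: Z) k.+1 <= gk_part S k.
Proof.
move=> ZS Zm.
have E : (k.+2 + k)./2 = k.+1 by lia.
have := @gk_uncross_even S set0 Z k.+2 k; rewrite !setU0 E => /(_ _ _ _ ZS (@conj_min0 _) Zm).
rewrite !disjoints_subset !sub0set => /(_ _ isT isT).
have -> : ~~ odd (k.+2 + k) by lia.
by move=> /(_ isT); rewrite !gkE; lia.
Qed.

Lemma gk_add1 S x k : x \notin S -> gk k (S :|: [set x]) <= gk k S + 1.
Proof.
move=> xS; case: (gk_witness k (S :|: [set x])) => B [/subsetP BS wB <-].
rewrite (cardsD1 x) addnC leq_add ?leq_b1 //; apply: gk_ge.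
  by apply/subsetP => p; rewrite !inE => /andP[/negbTE px /BS]; rewrite !inE px orbF.
by apply: width_leS wB => //; exact: subsetDl.
Qed.

Lemma gk_add1_mono S x k l : x \notin S ->
  conj_min [set x] (S :|: [set x]) \/ conj_max [set x] (S :|: [set x]) -> k <= l ->
  gk k (S :|: [set x]) + gk l S <= gk l (S :|: [set x]) + gk k S.
Proof.
move=> xS xm /subnK <-; elim: (l - k) => [|d IH]; first by rewrite add0n.
suff : gk (d + k) (S :|: [set x]) + gk (d + k).+1 S <=
       gk (d + k).+1 (S :|: [set x]) + gk (d + k) S by move: IH; rewrite addSn; lia.
have [dxS d0 dx0] : [/\ [disjoint [set x] & S], [disjoint set0 & S] & [disjoint [set x] & set0]].
  by rewrite !disjoints1 in_set0 xS disjoints_subset sub0set.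
case: xm => xm.
  by have := @gk_add_r S [set x] set0 dx0 dxS d0; rewrite !setU0; apply=> //; exact: conj_max0.
have d0x : [disjoint set0 & [set x]] by rewrite disjoint_sym.
have := @gk_add_l S set0 [set x] d0x d0 dxS; rewrite !setU0.
by move=> /(_ (@conj_min0 _) xm (d + k)); lia.
Qed.

(** Each number [gk] grows by 0 or 1 and this growth is monotone in the index, so it is a step
    function; its jump is the row of the new box. *)
Lemma gk_add1_box S x : x \notin S ->
  conj_min [set x] (S :|: [set x]) \/ conj_max [set x] (S :|: [set x]) ->
  exists k, [/\ k <= #|S|, forall j, gk j (S :|: [set x]) = gk j S + (k < j)
    & forall j, gk_part (S :|: [set x]) j = gk_part S j + (j == k)].
Proof.
move=> xS xm.
pose P j := gk j S < gk j (S :|: [set x]).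
have ex : exists j, P j.
  exists #|S|.+1; rewrite /P gk_all ?width_le_card // gk_all ?width_le_card //.
    by rewrite setUC cardsU1 xS add1n.
  by rewrite setUC cardsU1 xS add1n.
have h j : gk j (S :|: [set x]) = gk j S + P j.
  have := gk_add1 j xS; have := @gkS j j S (S :|: [set x]) (leqnn _) (subsetUl _ _).
  by rewrite /P; lia.
case: (ex_minnP ex) => [[|k]] Pk mk; first by move: Pk; rewrite /P !gk0.
exists k.
have E j : P j = (k < j).
  apply/idP/idP; first exact: mk.
  move=> kj; have := gk_add1_mono xS xm kj; rewrite !h Pk; case: (P j) => //; lia.
split.
- have : P #|S|.+1.
    rewrite /P gk_all ?width_le_card // gk_all ?width_le_card //;
    by rewrite setUC cardsU1 xS add1n.
  by rewrite E ltnS.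
- by move=> j; rewrite h E.
- by move=> j; rewrite /gk_part !h !E; have := @gkS j j.+1 S S (leqnSn _) (subxx _); lia.
Qed.

End GreeneKleitman.

(** * Paths and hooks of the Hillman-Grassl algorithm *)

Section HillmanGrassl.
Variables (n R C : nat).
Hypotheses (R_gt0 : 0 < R) (C_gt0 : 0 < C).
Implicit Types (f g : nat -> nat -> nat) (r c i j k t N : nat) (s : seq (nat * nat)).

Definition in_rect (x : nat * nat) := (1 <= x.1 <= R) && (1 <= x.2 <= C).
Definition eq_rect f g := forall r c, in_rect (r, c) -> f r c = g r c.

Definition climbs f i j := (1 < i) && (f i.-1 j == f i j).

Lemma eq_hg_path N f g i j : eq_rect f g -> in_rect (i, j) ->
  hg_path N C f i j = hg_path N C g i j.
Proof.
move=> fg; elim: N i j => [|N IH] i j ij //=.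
have -> : (1 < i) && (f i.-1 j == f i j) = (1 < i) && (g i.-1 j == g i j).
  case: ltnP => //= i1; rewrite !fg //; by move: ij i1; rewrite /in_rect /=; lia.
case: ifP => [h|_]; first by rewrite IH //; move: ij h; rewrite /in_rect /=; lia.
by case: ifP => // h; rewrite IH //; move: ij h; rewrite /in_rect /=; lia.
Qed.

Definition first_col f := [seq c <- iota 1 C | has (fun r => f r c != 0) (iota 1 R)].
Definition last_row f j := last 0 [seq r <- iota 1 R | f r j != 0].
Definition hg_zigzag f := 
  let j := head 0 (first_col f) in hg_path (R + C) C f (last_row f j) j.
Definition peel f := fun r c => f r c - ((r, c) \in hg_zigzag f).
Definition hook f := 
  let j := head 0 (first_col f) in (j, n.+1 - (last (last_row f j, j) (hg_zigzag f)).1).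

Lemma hginvS N f : hginv N.+1 n R C f =
  if first_col f is [::] then [::] else hook f :: hginv N n R C (peel f).
Proof. by rewrite /= /hook /peel /hg_zigzag /first_col; case: filter. Qed.

Lemma eq_first_col f g : eq_rect f g -> first_col f = first_col g.
Proof.
move=> fg; apply: eq_in_filter => c; rewrite mem_iota => hc.
by apply: eq_in_has => r; rewrite mem_iota => hr; rewrite fg // /in_rect /=; lia.
Qed.

Lemma first_col_head f c0 cs : first_col f = c0 :: cs ->
  [/\ 1 <= c0 <= C, exists2 r, 1 <= r <= R & f r c0 != 0 &
      forall r c, 1 <= r <= R -> 1 <= c < c0 -> f r c = 0].
Proof.
move=> e; have : c0 \in first_col f by rewrite e mem_head.
rewrite mem_filter mem_iota => /andP[/hasP[r]]; rewrite mem_iota => hr nz hc.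
split; first by lia.
  by exists r => //; lia.
move=> r' c hr' hc'; apply/eqP/contraT => nz'.
have cm : c \in first_col f.
  rewrite mem_filter mem_iota; apply/andP; split; last by lia.
  by apply/hasP; exists r' => //; rewrite mem_iota; lia.
have : sorted ltn (first_col f) by apply: sorted_filter; [exact: ltn_trans | exact: iota_ltn_sorted].
rewrite e => /= /(order_path_min ltn_trans) /allP /(_ c).
by move: cm; rewrite e inE; case/predU1P => [ec|ccs /(_ ccs)]; lia.
Qed.

Lemma first_col_nil f : first_col f = [::] -> forall r c, in_rect (r, c) -> f r c = 0.
Proof.
move=> e r c /andP[/= hr hc]; apply/eqP/contraT => nz.
suff : c \in first_col f by rewrite e.
rewrite mem_filter mem_iota; apply/andP; split; last by lia.
by apply/hasP; exists r => //; rewrite mem_iota; lia.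
Qed.

Lemma first_colP f c0 : 1 <= c0 <= C -> (exists2 r, 1 <= r <= R & f r c0 != 0) ->
  (forall r c, 1 <= r <= R -> 1 <= c < c0 -> f r c = 0) ->
  exists cs, first_col f = c0 :: cs.
Proof.
move=> hc [r hr nz] hz; case e : (first_col f) => [|c1 cs].
  by move: nz; rewrite (first_col_nil e) // /in_rect /=; lia.
exists cs; congr cons; have [hc1 [r1 hr1 nz1] hz1] := first_col_head e.
have [h|h|//] := ltngtP c1 c0.
  by move: nz1; rewrite hz //; lia.
by move: nz; rewrite hz1 //; lia.
Qed.

Lemma last_row_full f j : f R j != 0 -> last_row f j = R.
Proof.
move=> nz; rewrite /last_row.
have -> : iota 1 R = rcons (iota 1 R.-1) R.
  by have := iotaD 1 R.-1 1; rewrite addn1 prednK // cats1 add1n prednK.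
by rewrite filter_rcons nz last_rcons.
Qed.

Lemma last_row_mem f j : (exists2 r, 1 <= r <= R & f r j != 0) -> 1 <= last_row f j <= R.
Proof.
move=> [r hr nz]; rewrite /last_row; set s := filter _ _.
have : r \in s by rewrite mem_filter nz mem_iota; lia.
case e : s => [|r0 s'] // _.
have : last 0 (r0 :: s') \in s by rewrite e /= mem_last.
by rewrite mem_filter mem_iota; lia.
Qed.

Lemma eq_last_row f g j : eq_rect f g -> 1 <= j <= C -> last_row f j = last_row g j.
Proof.
move=> fg hj; congr last; apply: eq_in_filter => r; rewrite mem_iota => hr.
by rewrite fg // /in_rect /=; lia.
Qed.

Lemma eq_hg_zigzag f g : eq_rect f g -> first_col f <> [::] -> hg_zigzag f = hg_zigzag g.
Proof.
move=> fg; rewrite /hg_zigzag -(eq_first_col fg); case e : first_col => [|c s] // _.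
have [hc hr _] := first_col_head e.
rewrite -(eq_last_row fg hc); apply: eq_hg_path => //.
by apply/andP; split=> //; exact: last_row_mem.
Qed.

Lemma eq_hook f g : eq_rect f g -> first_col f <> [::] -> hook f = hook g.
Proof.
move=> fg h; have := h; rewrite /hook -(eq_hg_zigzag fg h) -(eq_first_col fg).
case e : first_col => [|c s] //= _; have [hc _ _] := first_col_head e.
by rewrite -(eq_last_row fg hc).
Qed.

Lemma eq_peel f g : eq_rect f g -> first_col f <> [::] -> eq_rect (peel f) (peel g).
Proof. by move=> fg h r c rc; rewrite /peel (eq_hg_zigzag fg h) fg. Qed.

Lemma eq_hginv N f g : eq_rect f g -> hginv N n R C f = hginv N n R C g.
Proof.
elim: N f g => // N IH f g fg; rewrite !hginvS -(eq_first_col fg).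
case e : first_col => [|c s] //.
have ne : first_col f <> [::] by rewrite e.
by rewrite (eq_hook fg ne) (IH _ _ (eq_peel fg ne)).
Qed.

Lemma totalE f : Defs.total R C f = \sum_(1 <= r < R.+1) \sum_(1 <= c < C.+1) f r c.
Proof.
rewrite /Defs.total sumnE big_map /index_iota !subSS !subn0.
by apply: eq_bigr => r _; rewrite sumnE big_map.
Qed.

Lemma total_lt f g r0 c0 : (forall r c, in_rect (r, c) -> f r c <= g r c) ->
  in_rect (r0, c0) -> f r0 c0 < g r0 c0 -> Defs.total R C f < Defs.total R C g.
Proof.
move=> le /andP[/= hr hc] lt; rewrite !totalE.
rewrite (bigD1_seq r0) ?iota_uniq ?mem_index_iota //= [X in _ < X](bigD1_seq r0) ?iota_uniq ?mem_index_iota //=.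
rewrite -addSn leq_add //; last first.
  rewrite big_nat_cond [X in _ <= X]big_nat_cond; apply: leq_sum => r /andP[hr' _].
  rewrite big_nat [X in _ <= X]big_nat; apply: leq_sum => c hc'; apply: le.
  by rewrite /in_rect /=; lia.
rewrite (bigD1_seq c0) ?iota_uniq ?mem_index_iota //= [X in _ < X](bigD1_seq c0) ?iota_uniq ?mem_index_iota //=.
rewrite -addSn leq_add //.
rewrite big_nat_cond [X in _ <= X]big_nat_cond; apply: leq_sum => c /andP[hc' _].
by apply: le; rewrite /in_rect /=; lia.
Qed.

Lemma eq_total f g : eq_rect f g -> Defs.total R C f = Defs.total R C g.
Proof.
move=> fg; rewrite !totalE; rewrite big_nat [RHS]big_nat; apply: eq_bigr => r hr.
rewrite big_nat [RHS]big_nat; apply: eq_bigr => c hc; apply: fg.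
by rewrite /in_rect /=; lia.
Qed.

Lemma eq_rpp f g : eq_rect f g -> rpp_b R C f = rpp_b R C g.
Proof.
move=> fg; apply: eq_in_all => r; rewrite mem_iota => hr.
apply: eq_in_all => c; rewrite mem_iota => hc.
rewrite (fg r c); last by rewrite /in_rect /=; lia.
by congr (_ && _); case: ltnP => //= h; rewrite fg // /in_rect /=; lia.
Qed.

Lemma eq_hginv_full f g : eq_rect f g -> hginv_full n R C f = hginv_full n R C g.
Proof. by move=> fg; rewrite /hginv_full (eq_total fg); exact: eq_hginv. Qed.

(** Every step, up or right, raises c - r by 1. By [path_diag] a cell thus determines its index on
    the path, and paths can be compared index by index. *)
Record path_spec f i j s : Prop := PathSpec {
  path_size : 0 < size s;
  path_head : nth (0, 0) s 0 = (i, j);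
  path_last : exists2 r, nth (0, 0) s (size s).-1 = (r, C) & ~~ climbs f r C;
  path_step : forall t r c, t.+1 < size s -> nth (0, 0) s t = (r, c) ->
     nth (0, 0) s t.+1 = if climbs f r c then (r.-1, c) else (r, c.+1);
  path_diag : forall t r c, t < size s -> nth (0, 0) s t = (r, c) ->
     [/\ 1 <= r <= i, j <= c <= C & c + i = r + j + t] }.

Lemma hg_pathP N f i j : 1 <= i -> j <= C -> i + C <= N + j ->
  path_spec f i j (hg_path N C f i j).
Proof.
elim: N i j => [|N IH] i j i1 jC hN; first by lia.
rewrite /= -/(climbs f i j); case: ifP => [cl|ncl].
  have [h1 h2 h3 h4 h5] := IH i.-1 j ltac:(by move: cl; rewrite /climbs; lia) jC ltac:(lia).
  set s := hg_path N C f i.-1 j in h1 h2 h3 h4 h5 *; split=> //.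
  - by case: h3 => r hr ncl; exists r => //; rewrite -hr -[size (_ :: s)]/(size s).+1 /= -{1}(prednK h1).
  - by case=> [|t] r c /= ht; [move=> [<- <-]; rewrite cl h2 | exact: h4].
  - move=> [|t] r c /=; first by move=> _ [<- <-]; split; lia.
    by rewrite ltnS => ht e; have [? ? ?] := h5 t r c ht e; split; lia.
case: ifP => [jltC|jeC].
  have [h1 h2 h3 h4 h5] := IH i j.+1 i1 jltC ltac:(lia).
  set s := hg_path N C f i j.+1 in h1 h2 h3 h4 h5 *; split=> //.
  - by case: h3 => r hr nl; exists r => //; rewrite -hr -[size (_ :: s)]/(size s).+1 /= -{1}(prednK h1).
  - by case=> [|t] r c /= ht; [move=> [<- <-]; rewrite ncl h2 | exact: h4].
  - move=> [|t] r c /=; first by move=> _ [<- <-]; split; lia.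
    by rewrite ltnS => ht e; have [? ? ?] := h5 t r c ht e; split; lia.
have -> : j = C by lia.
split=> //.
- have e : j = C by lia.
  by exists i => //=; rewrite -{1}e ncl.
- by case=> [|t] r c //= _ [<- <-]; split; lia.
Qed.

Section Peel.
Variable f : nat -> nat -> nat.
Hypothesis f_rpp : rpp_b R C f.

Lemma rpp_row r c : 1 <= r <= R -> 1 <= c < C -> f r c <= f r c.+1.
Proof.
move=> hr hc; have /allP/(_ r) := f_rpp; rewrite mem_iota => /(_ ltac:(lia)) /allP/(_ c).
by rewrite mem_iota => /(_ ltac:(lia)) /andP[/implyP h _]; apply: h; lia.
Qed.

Lemma rpp_col r c : 1 <= r < R -> 1 <= c <= C -> f r c <= f r.+1 c.
Proof.
move=> hr hc; have /allP/(_ r) := f_rpp; rewrite mem_iota => /(_ ltac:(lia)) /allP/(_ c).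
by rewrite mem_iota => /(_ ltac:(lia)) /andP[_ /implyP h]; apply: h; lia.
Qed.

Lemma rpp_col_le r r' c : 1 <= r -> r <= r' <= R -> 1 <= c <= C -> f r c <= f r' c.
Proof.
move=> h1 /andP[/subnK <- h2] hc; elim: (r' - r) h2 => [|d IH] h2 //.
apply: leq_trans (IH _) _; first by lia.
by rewrite addSn; apply: rpp_col; lia.
Qed.

Variables (j0 : nat) (cs : seq nat).
Hypothesis f_col : first_col f = j0 :: cs.

Lemma zigzag_start : 1 <= j0 <= C /\ 0 < f R j0.
Proof.
have [hc [r hr nz] _] := first_col_head f_col; split=> //.
by apply: leq_trans (rpp_col_le _ _ hc); rewrite ?lt0n; [exact: nz | lia | lia].
Qed.

Lemma zigzagE : hg_zigzag f = hg_path (R + C) C f R j0.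
Proof.
by rewrite /hg_zigzag f_col /= last_row_full // -lt0n; case: zigzag_start.
Qed.

Lemma zigzagP : path_spec f R j0 (hg_zigzag f).
Proof. by rewrite zigzagE; apply: hg_pathP; case: zigzag_start; lia. Qed.

Lemma zigzag_in r c : (r, c) \in hg_zigzag f -> exists2 t, t < size (hg_zigzag f) &
  nth (0, 0) (hg_zigzag f) t = (r, c).
Proof. by move=> /(nthP (0, 0))[t ht e]; exists t. Qed.

Lemma zigzag_rect r c : (r, c) \in hg_zigzag f -> in_rect (r, c) /\ j0 <= c.
Proof.
move=> /zigzag_in[t ht e]; have [? ? ?] := path_diag zigzagP ht e.
by have [? _] := zigzag_start; rewrite /in_rect /=; lia.
Qed.

(** The second claim makes positivity useful: where only the right one of two neighbours is
    decremented, the strict inequality keeps the row weakly increasing. *)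
Lemma zigzag_pos_aux t r c : t < size (hg_zigzag f) -> nth (0, 0) (hg_zigzag f) t = (r, c) ->
  0 < f r c /\ (j0 < c -> (r, c.-1) \notin hg_zigzag f -> f r c.-1 < f r c).
Proof.
have [hj fpos] := zigzag_start.
elim: t r c => [|t IH] r c ht e.
  move: e; rewrite (path_head zigzagP) => -[<- <-]; split=> //; lia.
have ht' : t < size (hg_zigzag f) by lia.
case e' : (nth (0, 0) (hg_zigzag f) t) => [r' c'].
have [? ? dg] := path_diag zigzagP ht' e'.
have [IH1 IH2] := IH r' c' ht' e'.
move: e; rewrite (path_step zigzagP ht e').
case: ifP => [/andP[r'1 /eqP eq]|ncl] [<- <-].
  rewrite eq; split=> // jc nin.
  have [nin'|/negPn in'] := boolP ((r', c'.-1) \notin hg_zigzag f).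
    apply: leq_ltn_trans (IH2 jc nin').
    by have := @rpp_col r'.-1 c'.-1; rewrite prednK; [apply; lia|lia].
  have [t' ht2 e2] := zigzag_in in'.
  have [? ? dg2] := path_diag zigzagP ht2 e2.
  (* The left neighbour is the previous cell of the path, which moved right. Its failed climbing
     test is a strict inequality that passes to the row above. *)
  have et : t = t'.+1 by lia.
  rewrite -et in ht2.
  have := path_step zigzagP (t := t') _ e2; rewrite -et e' => /(_ ht').
  case: ifP => [_ []|]; first by lia.
  rewrite /climbs r'1 /= => /negbT ne _.
  have := @rpp_col r'.-1 c'.-1; rewrite prednK; last by lia.
  have := @rpp_row r'.-1 c'.-1; rewrite [c'.-1.+1]prednK; last by lia.
  have := @rpp_row r' c'.-1; rewrite [c'.-1.+1]prednK; last by lia.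
  by rewrite -eq; lia.
have e3 : nth (0, 0) (hg_zigzag f) t.+1 = (r', c'.+1) by rewrite (path_step zigzagP ht e') ncl.
have [? ? ?] := path_diag zigzagP ht e3.
split; first by apply: leq_trans IH1 _; apply: rpp_row; lia.
by move=> _; rewrite /= -e' mem_nth.
Qed.

Lemma zigzag_gt0 r c : (r, c) \in hg_zigzag f -> 0 < f r c.
Proof. by move=> /zigzag_in[t ht e]; case: (zigzag_pos_aux ht e). Qed.

Lemma peelE r c : f r c = peel f r c + ((r, c) \in hg_zigzag f).
Proof.
rewrite /peel; case: (boolP (_ \in _)) => [/zigzag_gt0|_]; last by rewrite subn0 addn0.
by move=> h; rewrite subnK.
Qed.

Lemma zigzag_index r c t : (r, c) \in hg_zigzag f -> c + R = r + j0 + t ->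
  t < size (hg_zigzag f) /\ nth (0, 0) (hg_zigzag f) t = (r, c).
Proof.
move=> /zigzag_in[t' ht e] h; have [_ _ h'] := path_diag zigzagP ht e.
by have -> : t = t' by lia.
Qed.

Lemma zigzag_climb r c : (r, c) \in hg_zigzag f -> climbs f r c -> (r.-1, c) \in hg_zigzag f.
Proof.
move=> /zigzag_in[t ht e] cl.
have [ht1|ht1] := ltnP t.+1 (size (hg_zigzag f)).
  by have := path_step zigzagP ht1 e; rewrite cl => <-; exact: mem_nth.
have [r' e' ncl] := path_last zigzagP.
have et : t = (size (hg_zigzag f)).-1 by lia.
by move: e'; rewrite -et e => -[er ec]; move: ncl; rewrite -er -ec cl.
Qed.

Lemma peel_rpp : rpp_b R C (peel f).
Proof.
have [hj _] := zigzag_start; have [_ _ hz] := first_col_head f_col.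
apply/allP => r; rewrite mem_iota => hr; apply/allP => c; rewrite mem_iota => hc.
apply/andP; split; apply/implyP => h; rewrite /peel.
  have := @rpp_row r c; have [in1|nin1] := boolP ((r, c.+1) \in hg_zigzag f); last by lia.
  have [in2|nin2] := boolP ((r, c) \in hg_zigzag f); first by lia.
  have [t ht e] := zigzag_in in1; have [_ /= h2] := zigzag_pos_aux ht e.
  have [jc|cj] := ltnP j0 c.+1; first by have := h2 jc nin2; lia.
  by rewrite (hz r c) //; lia.
have := @rpp_col r c; have [in1|nin1] := boolP ((r.+1, c) \in hg_zigzag f); last by lia.
have [in2|nin2] := boolP ((r, c) \in hg_zigzag f); first by lia.
have [e|ne] := eqVneq (f r c) (f r.+1 c); last by lia.
have := zigzag_climb in1; rewrite /climbs /= e eqxx (negbTE nin2) andbT.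
by move=> h1; suff : false by []; apply: h1; lia.
Qed.

Lemma total_peel : Defs.total R C (peel f) < Defs.total R C f.
Proof.
have [hj fpos] := zigzag_start.
have in0 : (R, j0) \in hg_zigzag f.
  by rewrite -(path_head zigzagP) mem_nth // (path_size zigzagP).
apply: (@total_lt _ _ R j0); first by move=> r c _; rewrite [f r c]peelE leq_addr.
  by rewrite /in_rect /= leqnn R_gt0.
by rewrite [f R j0]peelE in0 addn1.
Qed.

Lemma hookE : exists rE, [/\ hook f = (j0, n.+1 - rE), 1 <= rE <= R,
  ~~ climbs f rE C, nth (0, 0) (hg_zigzag f) (size (hg_zigzag f)).-1 = (rE, C) &
  C + R = rE + j0 + (size (hg_zigzag f)).-1].
Proof.
have [rE e ncl] := path_last zigzagP; have sp := path_size zigzagP.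
have hs : (size (hg_zigzag f)).-1 < size (hg_zigzag f) by lia.
have [? ? ?] := path_diag zigzagP hs e.
exists rE; split=> //; rewrite /hook f_col /=.
by rewrite -nth_last (set_nth_default (0, 0)) // e.
Qed.

(** Read backwards, the path depends on [peel f] alone. This is the reverse step of the algorithm,
    from which injectivity follows. *)
Lemma zigzag_prev t r c : t.+1 < size (hg_zigzag f) ->
  nth (0, 0) (hg_zigzag f) t.+1 = (r, c) ->
  nth (0, 0) (hg_zigzag f) t = 
    if (r < R) && (peel f r.+1 c == peel f r c) then (r.+1, c) else (r, c.-1).
Proof.
move=> ht e1; have ht' : t < size (hg_zigzag f) by lia.
case e0 : (nth (0, 0) (hg_zigzag f) t) => [r' c'].
have [? ? dg0] := path_diag zigzagP ht' e0; have [? ? dg1] := path_diag zigzagP ht e1.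
have in0 : (r', c') \in hg_zigzag f by rewrite -e0 mem_nth.
have in1 : (r, c) \in hg_zigzag f by rewrite -e1 mem_nth.
have := path_step zigzagP ht e0; rewrite e1; case: ifP => [/andP[r1 /eqP eq]|ncl] [er ec].
  have er' : r' = r.+1 by lia.
  subst c' r'; rewrite (peelE r.+1 c) (peelE r c) in0 in1 /= in eq.
  have -> : peel f r.+1 c == peel f r c by lia.
  by have -> : r < R by lia.
subst r' c; rewrite /=; case: ifP => // /andP[rR /eqP eq].
have nin : (r.+1, c'.+1) \notin hg_zigzag f.
  apply/negP => inn; have [|_] := @zigzag_index r.+1 c'.+1 t inn; first by lia.
  by rewrite e0 => -[]; lia.
have := @rpp_col r c'.+1; rewrite (peelE r.+1 c'.+1) (peelE r c'.+1) (negbTE nin) in1 eq.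
lia.
Qed.

End Peel.

(** If both paths start in the same column, the second stays weakly above the first: where the first
    climbs, both entries have dropped by 1, so the second climbs from that cell too. Its final row
    is then no lower. *)
Lemma hook_le f js j0 js' : rpp_b R C f -> first_col f = j0 :: js ->
  forall j1, first_col (peel f) = j1 :: js' ->
  j0 < j1 \/ j0 = j1 /\ (hook f).2 <= (hook (peel f)).2.
Proof.
move=> frpp fcol j1 gcol.
have grpp := peel_rpp frpp fcol; set g := peel f in grpp gcol *.
have [hj0 _ hz] := first_col_head fcol; have [hj1 [r1 hr1 nz1] _] := first_col_head gcol.
have j01 : j0 <= j1.
  rewrite leqNgt; apply/negP => lt; move: nz1.
  by rewrite /g /peel hz ?sub0n ?eqxx //; lia.
have [e|ne] := eqVneq j0 j1; last by left; lia.
right; split=> //; subst j1.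
have pP := zigzagP frpp fcol; have qP := zigzagP grpp gcol.
have [rE [-> hrE _ _ dE]] := hookE frpp fcol.
have [rE' [-> hrE' _ _ dE']] := hookE grpp gcol.
set p := hg_zigzag f in pP dE; set q := hg_zigzag g in qP dE'.
have climb_pq r c : (r, c) \in p -> climbs f r c -> climbs g r c.
  move=> inp cl; have inp' := zigzag_climb frpp fcol inp cl.
  move: cl; rewrite /climbs (peelE frpp fcol r.-1 c) (peelE frpp fcol r c) -/g -/p inp inp'.
  by move=> /andP[-> /eqP]; lia.
suff main t : t < size p -> t < size q /\ (nth (0, 0) q t).1 <= (nth (0, 0) p t).1.
  have sp := path_size pP; have [] := main (size p).-1 ltac:(lia).
  by rewrite /=; lia.
elim: t => [|t IH] ht.
  by rewrite (path_size qP) (path_head qP) (path_head pP).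
have ht0 : t < size p by lia.
have [hq le] := IH ht0.
case ep : (nth (0, 0) p t) le => [r c]; case eq : (nth (0, 0) q t) => [r' c'] /= le.
have [? ? dp] := path_diag pP ht0 ep; have [? ? dq] := path_diag qP hq eq.
have inp : (r, c) \in p by rewrite -ep mem_nth.
have hq1 : t.+1 < size q.
  rewrite ltnNge; apply/negP => hq1.
  have [r'' e'' ncl] := path_last qP.
  have et : (size q).-1 = t by lia.
  rewrite et eq in e''; case: e'' => er ec.
  have [er' ec'] : r = r' /\ c = C by lia.
  case es : (nth (0, 0) p t.+1) => [rn cn].
  have [? ? _] := path_diag pP ht es.
  have := path_step pP ht ep; rewrite es; case: ifP => [cl _|_ []]; last by lia.
  by have := climb_pq _ _ inp cl; rewrite ec' er' er (negbTE ncl).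
split=> //; rewrite (path_step pP ht ep) (path_step qP hq1 eq).
case: (boolP (climbs f r c)) => [cl|_]; last by case: ifP => _ /=; lia.
have [er|ne] := eqVneq r' r; last by case: ifP => _ /=; lia.
have ec : c' = c by lia.
by rewrite er ec (climb_pq _ _ inp cl) /=.
Qed.

Definition lex_le (x y : nat * nat) := (x.1 < y.1) || (x.1 == y.1) && (x.2 <= y.2).

Lemma lex_le_trans : transitive lex_le.
Proof. by move=> [? ?] [? ?] [? ?]; rewrite /lex_le /=; lia. Qed.

Lemma lex_le_anti : antisymmetric lex_le.
Proof. by move=> [a b] [c d]; rewrite /lex_le /= => h; congr pair; lia. Qed.

(** Since the hooks come out in lexicographic order, two outputs equal up to permutation are
    equal. *)
Lemma hginv_sorted N f : rpp_b R C f -> sorted lex_le (hginv N n R C f).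
Proof.
elim: N f => // N IH f frpp; rewrite hginvS; case e : (first_col f) => [|j0 js] //=.
have := IH _ (peel_rpp frpp e).
case: N {IH} => // N; rewrite hginvS; case e' : (first_col (peel f)) => [|j1 js'] //= ->.
rewrite andbT /lex_le.
have -> : (hook f).1 = j0 by rewrite /hook e.
have -> : (hook (peel f)).1 = j1 by rewrite /hook e'.
by case: (hook_le frpp e e') => [->//|[-> ->]]; rewrite eqxx orbT.
Qed.

Hypothesis R_le : R <= n.+1.

Lemma peel_inj f g : rpp_b R C f -> rpp_b R C g -> first_col f <> [::] -> first_col g <> [::] ->
  hook f = hook g -> eq_rect (peel f) (peel g) -> eq_rect f g.
Proof.
move=> frpp grpp; case ef : (first_col f) => [|j0 js] // _; case eg : (first_col g) => [|j1 js'] // _.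
have [rE [-> hrE _ lf dE]] := hookE frpp ef; have [rE' [-> hrE' _ lg dE']] := hookE grpp eg.
move=> [ej er]; subst j1 => fg.
have err : rE' = rE by lia.
rewrite err in lg dE' hrE'.
have sf := path_size (zigzagP frpp ef); have sg := path_size (zigzagP grpp eg).
have es : size (hg_zigzag f) = size (hg_zigzag g) by lia.
suff E : hg_zigzag f = hg_zigzag g.
  by move=> r c rc; rewrite (peelE frpp ef) (peelE grpp eg) E fg.
apply: (@eq_from_nth _ (0, 0)) => // t ht.
(* The index is rewritten through its distance to the end: the two paths share their last cell and
   are compared backwards. *)
have : (size (hg_zigzag f)).-1 - ((size (hg_zigzag f)).-1 - t) = t by lia.
move: (_ - t) => d <-; elim: d => [|d IH]; first by rewrite subn0 lf es lg.
have [h|h] := leqP (size (hg_zigzag f)).-1 d.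
  by have -> : (size (hg_zigzag f)).-1 - d.+1 = (size (hg_zigzag f)).-1 - d by lia.
set u := _ - d.+1; have eu : (size (hg_zigzag f)).-1 - d = u.+1 by rewrite /u; lia.
rewrite eu in IH; have hu : u.+1 < size (hg_zigzag f) by lia.
case e : (nth (0, 0) (hg_zigzag f) u.+1) => [r c].
have inf : (r, c) \in hg_zigzag f by rewrite -e mem_nth.
have [rc _] := zigzag_rect frpp ef inf.
rewrite (zigzag_prev frpp ef hu e); rewrite es in hu; rewrite IH in e.
rewrite (zigzag_prev grpp eg hu e).
case: ltnP => //= rR; rewrite !fg //.
by move: rc rR; rewrite /in_rect /=; lia.
Qed.

Lemma hginv_inj N N' f g : rpp_b R C f -> rpp_b R C g ->
  Defs.total R C f < N -> Defs.total R C g < N' -> hginv N n R C f = hginv N' n R C g -> eq_rect f g.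
Proof.
elim: N N' f g => // N IH [|N'] f g frpp grpp hf hg //; rewrite !hginvS.
case ef : (first_col f) => [|j0 js]; case eg : (first_col g) => [|j1 js'] //.
  by move=> _ r c rc; rewrite (first_col_nil ef) // (first_col_nil eg).
move=> E; have eh := congr1 (head (0, 0)) E; have et := congr1 behead E; rewrite /= in eh et.
have nf : first_col f <> [::] by rewrite ef.
have ng : first_col g <> [::] by rewrite eg.
apply: (peel_inj frpp grpp nf ng eh).
apply: (IH N') => //; [exact: peel_rpp ef|exact: peel_rpp eg| |].
  by apply: leq_trans (total_peel frpp ef) _.
by apply: leq_trans (total_peel grpp eg) _.
Qed.

Theorem hginv_full_inj f g : rpp_b R C f -> rpp_b R C g ->
  perm_eq (hginv_full n R C f) (hginv_full n R C g) -> eq_rect f g.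
Proof.
move=> frpp grpp h; apply: hginv_inj (ltnSn _) (ltnSn _) _ => //.
by apply: (sorted_eq lex_le_trans lex_le_anti) => //; exact: hginv_sorted.
Qed.

End HillmanGrassl.

(** * Pair codes, and ranks on the chains of the Auslander-Reiten quiver *)

Lemma ltn_pair_code N a b a' b' : b < N -> b' < N ->
  (a * N + b < a' * N + b') = (a < a') || (a == a') && (b < b').
Proof.
move=> bN b'N; case: (ltngtP a a') => [lt|gt|->] /=; last by rewrite ltn_add2l.
- have : a.+1 * N <= a' * N by rewrite leq_mul2r lt orbT.
  by rewrite mulSn; lia.
- have : a'.+1 * N <= a * N by rewrite leq_mul2r gt orbT.
  by rewrite mulSn; lia.
Qed.

Lemma eqn_pair_code N a b a' b' : b < N -> b' < N ->
  (a * N + b == a' * N + b') = (a == a') && (b == b').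
Proof.
move=> bN b'N; case: (ltngtP a a') => [lt|gt|->] /=; last by rewrite eqn_add2l.
- have : a.+1 * N <= a' * N by rewrite leq_mul2r lt orbT.
  by rewrite mulSn; lia.
- have : a'.+1 * N <= a * N by rewrite leq_mul2r gt orbT.
  by rewrite mulSn; lia.
Qed.

Lemma iter_tau t x : iter t tau x = (x.1 - t, x.2 - t).
Proof.
elim: t => [|t IH]; first by rewrite !subn0; case: x.
by rewrite iterS IH /tau /= !subnS.
Qed.

Lemma ar_piE a b : ar_pi (a, b) = b - a.-1.
Proof. by rewrite /ar_pi iter_tau. Qed.

Section ChainRank.
Variables (n m : nat).
Implicit Types (x y : ptype n).

Lemma leP_le x y : @Defs.leP n m x y -> (x.1 <= y.1) && (x.2 <= y.2).
Proof.
case/connectP => p; elim: p x => [|z p IH] x /= => [_ -> |/andP[xz pz] e]; first by rewrite !leqnn.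
move: xz (IH _ pz e); rewrite /subarrow /ar_arrow /pval /= => /and3P[_ _].
by case/orP => /eqP [-> ->]; lia.
Qed.

Lemma pval_toP a b : a <= n -> b <= n -> pval (toP n (a, b)) = (a, b).
Proof. by move=> an bn; rewrite /pval /toP /= !inordK. Qed.

Lemma leP_diag a b t : 1 <= a -> m <= b -> a + t <= m -> b + t <= n -> m <= n ->
  @Defs.leP n m (toP n (a, b)) (toP n (a + t, b + t)).
Proof.
move=> a1 mb; elim: t => [|t IH] at_ bt mn; first by rewrite !addn0; exact: connect0.
apply: connect_trans (IH _ _ _) _; try by lia.
apply: (@connect_trans _ _ (toP n (a + t, b + t.+1))); apply: connect1;
  by rewrite /subarrow !pval_toP ?/inP ?/ar_arrow ?xpair_eqE /=; lia.
Qed.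

(** Below (a, b) on its chain lie the translates (a - t, b - t) with t >= 1; they stay in the poset
    as long as a - t >= 1 and b - t >= m. *)
Lemma chain_rankE a b : 1 <= a <= m -> m <= b <= n -> chain_rank n m (a, b) = minn a.-1 (b - m).
Proof.
move=> ha hb; rewrite /chain_rank; set k := minn _ _.
pose g (t : 'I_k) : ptype n := toP n (a - t.+1, b - t.+1).
have gE t : pval (g t) = (a - t.+1, b - t.+1) by rewrite pval_toP //; lia.
have g_inj : injective g.
  move=> t t' e; have := gE t; rewrite e gE => /(congr1 fst) /= h; apply: val_inj => /=.
  move: (ltn_ord t) (ltn_ord t') h; move: (nat_of_ord t) (nat_of_ord t').
  by rewrite /k; lia.
rewrite -[RHS]card_ord -(card_imset predT g_inj); apply: eq_card => y.
rewrite inE; apply/idP/imsetP => [/and4P[yP /eqP]|[t _ ->]].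
  rewrite ar_piE => py ny /leP_le.
  have [y1 y2] : (toP n (a, b)).1 = a :> nat /\ (toP n (a, b)).2 = b :> nat.
    by rewrite /toP /= !inordK; lia.
  rewrite y1 y2; move: yP py; rewrite /inP /pval /= ar_piE => yP py le.
  have ne : (y.1 : nat) != a.
    apply: contraNneq ny => e; apply/eqP; case: y e yP py le => [u v] /= e yP py le.
    by rewrite /toP; congr pair; apply: val_inj; rewrite /= inordK; lia.
  have tk : a - y.1 - 1 < k.
    move: ha hb yP py le ne; clear; rewrite /k; case: y => [[u ?] [v ?]] /=; lia.
  exists (Ordinal tk) => //; case: y ny yP py le ne tk => [u v] /= _ yP py le ne tk.
  by rewrite /g /toP; congr pair; apply: val_inj; rewrite /= inordK; lia.
have ht : nat_of_ord t < minn a.-1 (b - m) := ltn_ord t.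
rewrite gE !ar_piE /inP /=; apply/and4P; split; try by lia.
  apply/negP => /eqP e; have := gE t; rewrite e pval_toP; try by lia.
  by move=> /(congr1 fst) /= h; lia.
have := @leP_diag (a - t.+1) (b - t.+1) t.+1; rewrite !subnK; try by lia.
by apply; lia.
Qed.
End ChainRank.

(** * Ranks of generic nilpotent matrices *)

Local Open Scope ring_scope.

Section Minors.
Variable K : fieldType.

Lemma unitmx_mxsub m n (A : 'M[K]_(m, n)) :
  exists (f : 'I_(\rank A) -> 'I_m) (g : 'I_(\rank A) -> 'I_n), mxsub f g A \in unitmx.
Proof.
have full : row_full (rowsub (maxrankfun A) A)^T.
  by rewrite /row_full mxrank_tr; exact: maxrowsub_free.
exists (maxrankfun A), (fullrankfun full).
have := fullrowsub_unit full.
rewrite -unitmx_tr; congr (_ \in unitmx).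
by apply/matrixP => i j; rewrite !mxE.
Qed.

Lemma rank_ge_mxsub m n r (A : 'M[K]_(m, n)) (f : 'I_r -> 'I_m) (g : 'I_r -> 'I_n) :
  mxsub f g A \in unitmx -> (r <= \rank A)%N.
Proof.
move=> /mulmxV; set B := mxsub _ _ _ => h.
have e : B = rowsub f 1%:M *m A *m colsub g 1%:M.
  by rewrite mulmx_colsub mulmx1 mul_rowsub_mx mul1mx /B mxsubcr.
apply: (@mulmx1_min_rank _ r _ _ A (rowsub f 1%:M) (colsub g 1%:M *m invmx B)).
by rewrite mulmxA -e.
Qed.

(* A minor that does not vanish at [ev0] is an element of the coefficient ring
   whose nonvanishing keeps the rank at least as large. *)
Lemma rank_semicont (R : comNzRingType) m n (A : 'M[R]_(m, n)) (ev0 : {rmorphism R -> K}) :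
  exists2 P : R, ev0 P != 0 & forall ev : {rmorphism R -> K}, ev P != 0 ->
    (\rank (map_mx ev0 A) <= \rank (map_mx ev A))%N.
Proof.
have [f [g u]] := unitmx_mxsub (map_mx ev0 A).
exists (\det (mxsub f g A)).
  by rewrite -det_map_mx map_mxsub -unitfE -unitmxE.
move=> ev h; apply: (@rank_ge_mxsub _ _ _ _ f g).
by rewrite unitmxE unitfE -map_mxsub det_map_mx.
Qed.
End Minors.

(** * Powers of the corners of a matrix *)

Section Corner.
Variables (R : comNzRingType) (D : nat).
Implicit Types (S W : {set 'I_D}) (F : 'M[R]_D) (h : nat).

Definition proj_mx S : 'M[R]_D := diag_mx (\row_j (j \in S)%:R).
(** The h-th power of the principal submatrix on [S], padded by zeros to a fixed size so that
    corners for different sets can be multiplied and compared. *)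
Definition corner_pow F S h : 'M[R]_D := proj_mx S *m (F *m proj_mx S) ^+ h.

Lemma proj_mxE S p q : proj_mx S p q = ((p == q) && (p \in S))%:R.
Proof.
rewrite !mxE; case: eqVneq => [->|]; last by rewrite mulr0n.
by rewrite mulr1n.
Qed.

Lemma mul_proj_mx n S (A : 'M[R]_(D, n)) p q : (proj_mx S *m A) p q = (p \in S)%:R * A p q.
Proof. by rewrite mul_diag_mx !mxE. Qed.

Lemma mul_mx_proj n S (A : 'M[R]_(n, D)) p q : (A *m proj_mx S) p q = A p q * (q \in S)%:R.
Proof. by rewrite mul_mx_diag !mxE. Qed.

Lemma proj_mxI S (S' : {set 'I_D}) : proj_mx S *m proj_mx S' = proj_mx (S :&: S').
Proof.
apply/matrixP => p q; rewrite mul_proj_mx !proj_mxE inE.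
by case: (p == q); case: (p \in S); rewrite ?(mul0r, mulr0, mul1r).
Qed.

Lemma proj_mx_id S : proj_mx S *m proj_mx S = proj_mx S.
Proof. by rewrite proj_mxI setIid. Qed.

Lemma corner_pow0 F S : corner_pow F S 0 = proj_mx S.
Proof. by rewrite /corner_pow expr0 mulmx1. Qed.

Lemma corner_powSr F S h : corner_pow F S h.+1 = corner_pow F S h *m (F *m proj_mx S).
Proof. by rewrite /corner_pow exprSr -mulmxE mulmxA. Qed.

Lemma corner_powS F S h : corner_pow F S h.+1 = (proj_mx S *m F) *m corner_pow F S h.
Proof. by rewrite /corner_pow exprS -mulmxE !mulmxA. Qed.

Lemma corner_pow_projr F S h : corner_pow F S h *m proj_mx S = corner_pow F S h.
Proof.
case: h => [|h]; first by rewrite corner_pow0 proj_mx_id.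
by rewrite corner_powSr -!mulmxA proj_mx_id.
Qed.

Lemma corner_pow_projl F S h : proj_mx S *m corner_pow F S h = corner_pow F S h.
Proof. by rewrite /corner_pow mulmxA proj_mx_id. Qed.

(** Matrices act on row vectors: the span of [W] is stable under the corner on [S], and powers
    restrict to it. *)
Lemma corner_pow_up F S W h : W \subset S ->
  (forall p q, p \in W -> q \in S -> q \notin W -> F p q = 0) ->
  corner_pow F W h = proj_mx W *m corner_pow F S h.
Proof.
move=> WS hF; elim: h => [|h IH].
  by rewrite !corner_pow0 proj_mxI (setIidPl WS).
rewrite corner_powSr -{1}(corner_pow_projr F W h) -(mulmxA (corner_pow _ _ _)).
suff -> : proj_mx W *m (F *m proj_mx W) = proj_mx W *m (F *m proj_mx S).
  by rewrite mulmxA corner_pow_projr IH -mulmxA -corner_powSr.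
apply/matrixP => p q; rewrite !mul_proj_mx !mul_mx_proj.
case: (boolP (p \in W)) => pW; rewrite ?mul0r // !mul1r.
case: (boolP (q \in W)) => qW; first by rewrite (subsetP WS).
case: (boolP (q \in S)) => qS //.
by rewrite hF // !mul0r.
Qed.

(** Here the span of the complement of [W] in [S] is stable, and the corner on [W] is the quotient
    map. *)
Lemma corner_pow_down F S W h : W \subset S ->
  (forall p q, q \in W -> p \in S -> p \notin W -> F p q = 0) ->
  corner_pow F W h = corner_pow F S h *m proj_mx W.
Proof.
move=> WS hF; elim: h => [|h IH].
  by rewrite !corner_pow0 proj_mxI (setIidPr WS).
rewrite corner_powS -{1}(corner_pow_projl F W h) mulmxA.
suff -> : proj_mx W *m F *m proj_mx W = proj_mx S *m F *m proj_mx W.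
  by rewrite -mulmxA corner_pow_projl IH mulmxA -corner_powS.
apply/matrixP => p q; rewrite !mul_mx_proj !mul_proj_mx.
case: (boolP (q \in W)) => qW; rewrite ?mulr0 // !mulr1.
case: (boolP (p \in W)) => pW; first by rewrite (subsetP WS).
case: (boolP (p \in S)) => pS //.
by rewrite hF // !mulr0.
Qed.

End Corner.

Lemma map_corner_pow (R R' : comNzRingType) (f : {rmorphism R -> R'}) D (F : 'M[R]_D) S h :
  map_mx f (corner_pow F S h) = corner_pow (map_mx f F) S h.
Proof.
have e : map_mx f (proj_mx R S) = proj_mx R' S.
  by apply/matrixP => p q; rewrite mxE !proj_mxE rmorph_nat.
by rewrite /corner_pow map_mxM rmorphXn /= map_mxM e.
Qed.

Section CornerRank.
Variables (K : fieldType) (D : nat).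
Implicit Types (S W X Y Z : {set 'I_D}) (F : 'M[K]_D) (h : nat).

Lemma mxrank_proj S : \rank (proj_mx K S) = #|S|.
Proof.
pose P : 'M[K]_(#|S|, D) := \matrix_(i, j) (enum_val i == j)%:R.
apply/eqP; rewrite eqn_leq; apply/andP; split.
  have -> : proj_mx K S = P^T *m P; last exact: mulmx_max_rank.
  apply/matrixP => p q; rewrite proj_mxE mxE.
  case: (boolP (p \in S)) => pS.
    rewrite andbT (bigD1 (enum_rank_in pS p)) //= big1 => [|i ni].
      by rewrite !mxE enum_rankK_in // eqxx mul1r addr0.
    rewrite !mxE; case: eqP => [e|]; last by rewrite mul0r.
    by case/eqP: ni; apply: enum_val_inj; rewrite e enum_rankK_in.
  rewrite andbF big1 // => i _; rewrite !mxE; case: eqP => [e|]; last by rewrite mul0r.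
  by move: (enum_valP i); rewrite e (negbTE pS).
apply: (@mulmx1_min_rank _ #|S| _ _ _ P P^T).
apply/matrixP => i j; rewrite mxE [RHS]mxE (bigD1 (enum_val j)) //= big1 => [|p np].
  rewrite mul_mx_proj !mxE enum_valP mulr1 eqxx mulr1 addr0.
  by rewrite (inj_eq enum_val_inj).
by rewrite [X in _ * X]mxE [X in _ * X]mxE [enum_val j == p]eq_sym (negbTE np) mulr0.
Qed.

Lemma rank_corner0 F S : \rank (corner_pow F S 0) = #|S|.
Proof. by rewrite corner_pow0 mxrank_proj. Qed.

(** Frobenius' rank inequality with middle factor [corner_pow F S h]. *)
Lemma rank_corner_convex F S h :
  (\rank (corner_pow F S h.+1) + \rank (corner_pow F S h.+1) <=
   \rank (corner_pow F S h) + \rank (corner_pow F S h.+2))%N.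
Proof.
have := mxrank_Frobenius (proj_mx K S *m F) (corner_pow F S h) (F *m proj_mx K S).
by rewrite -corner_powS -!corner_powSr.
Qed.

Lemma rank_corner_leS F S h : (\rank (corner_pow F S h.+1) <= \rank (corner_pow F S h))%N.
Proof. by rewrite corner_powSr mxrankM_maxl. Qed.

Lemma rank_corner_diff F S h h' : (h <= h')%N ->
  (\rank (corner_pow F S h') + \rank (corner_pow F S h.+1) <=
   \rank (corner_pow F S h) + \rank (corner_pow F S h'.+1))%N.
Proof.
move=> /subnK <-; elim: (h' - h)%N => [|d IH]; first by rewrite add0n.
by have := rank_corner_convex F S (d + h); move: IH; rewrite addSn; lia.
Qed.

Definition up_closed F W S :=
  W \subset S /\ forall p q, p \in W -> q \in S -> q \notin W -> F p q = 0.
Definition down_closed F W S :=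
  W \subset S /\ forall p q, q \in W -> p \in S -> p \notin W -> F p q = 0.

Lemma rank_corner_up_le F W S h : up_closed F W S ->
  (\rank (corner_pow F W h) <= \rank (corner_pow F S h))%N.
Proof. by move=> [WS hF]; rewrite (corner_pow_up h WS hF) mxrankM_maxr. Qed.

Lemma rank_corner_up1 F W x h : x \notin W -> up_closed F W (W :|: [set x]) ->
  (\rank (corner_pow F (W :|: [set x]) h) <= \rank (corner_pow F W h) + 1)%N.
Proof.
move=> xW [WS hF]; set S := _ :|: _ in WS hF *.
rewrite (corner_pow_up h WS hF) -{1}(corner_pow_projl F S h).
have -> : proj_mx K S = proj_mx K W + proj_mx K [set x].
  apply/matrixP => p q; rewrite [RHS]mxE !proj_mxE !inE; case: (p == q); rewrite ?addr0 //=.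
  by case: eqP => [->|_]; rewrite ?(negbTE xW) ?orbF ?addr0 //= add0r.
rewrite mulmxDl; apply: leq_trans (mxrank_add _ _) _; rewrite leq_add2l.
by rewrite (leq_trans (mxrankM_maxl _ _)) // mxrank_proj cards1.
Qed.

(** The row space for the union lies in the sum of the two row spaces, and the one for [W] in their
    intersection. *)
Lemma rank_corner_submod F W X Y h :
  up_closed F W (W :|: X :|: Y) -> up_closed F (W :|: X) (W :|: X :|: Y) ->
  up_closed F (W :|: Y) (W :|: X :|: Y) ->
  (\rank (corner_pow F (W :|: X :|: Y) h) + \rank (corner_pow F W h) <=
   \rank (corner_pow F (W :|: X) h) + \rank (corner_pow F (W :|: Y) h))%N.
Proof.
move=> [s1 h1] [s2 h2] [s3 h3].
rewrite (corner_pow_up h s1 h1) (corner_pow_up h s2 h2) (corner_pow_up h s3 h3).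
set S := _ :|: Y in s1 s2 s3 *; set N := corner_pow F S h.
rewrite -(mxrank_sum_cap (_ *m N)); apply: leq_add; apply: mxrankS.
  rewrite -{1}[N]corner_pow_projl.
  have -> : proj_mx K S = proj_mx K (W :|: X) + proj_mx K (S :\: (W :|: X)) *m proj_mx K (W :|: Y).
    apply/matrixP => p q; rewrite [RHS]mxE mul_proj_mx !proj_mxE !inE; case: (p == q); rewrite ?mulr0 ?addr0 //=.
    by case: (p \in W); case: (p \in X); case: (p \in Y); rewrite ?(mulr0, mul0r, addr0, mulr1, add0r).
  by rewrite mulmxDl addmx_sub_adds // -mulmxA submxMl.
rewrite sub_capmx.
have e (A : {set 'I_D}) : W \subset A -> proj_mx K W = proj_mx K W *m proj_mx K A.
  by move=> WA; rewrite proj_mxI (setIidPl WA).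
by apply/andP; split; [rewrite (e _ (subsetUl W X)) | rewrite (e _ (subsetUl W Y))];
  rewrite -mulmxA submxMl.
Qed.

(** Frobenius' inequality for the corner power of the union, multiplied on the left by the
    projection on [W :|: Z] and on the right by that on [W :|: X]. With both factors it becomes the
    corner power of [W], as [X] and [Z] are disjoint. *)
Lemma rank_corner_supermod F W X Z h :
  up_closed F (W :|: Z) (W :|: X :|: Z) -> down_closed F (W :|: X) (W :|: X :|: Z) ->
  up_closed F W (W :|: X) -> [disjoint X & Z] -> 
  (\rank (corner_pow F (W :|: X) h) + \rank (corner_pow F (W :|: Z) h) <=
   \rank (corner_pow F (W :|: X :|: Z) h) + \rank (corner_pow F W h))%N.
Proof.
move=> [s1 h1] [s2 h2] [s3 h3] XZ.
rewrite (corner_pow_up h s3 h3).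
have -> : proj_mx K W *m corner_pow F (W :|: X) h = proj_mx K (W :|: Z) *m corner_pow F (W :|: X) h.
  rewrite -[corner_pow _ _ _]corner_pow_projl !mulmxA !proj_mxI; congr (proj_mx K _ *m _).
  apply/setP => p; rewrite !inE.
  have /pred0P/(_ p) := XZ.
  by rewrite /=; case: (p \in W); case: (p \in X); case: (p \in Z).
rewrite (corner_pow_down h s2 h2) (corner_pow_up h s1 h1) mulmxA addnC.
exact: mxrank_Frobenius.
Qed.

Variables (al be : 'I_D -> nat).

Definition strict_mx F := forall p q, F p q != 0 -> plt al be p q.

Lemma strict_mx0 F p q : strict_mx F -> ~~ plt al be p q -> F p q = 0.
Proof. by move=> sF; apply: contraNeq; exact: sF. Qed.

Lemma strict_nilp F S : strict_mx F -> exists N, forall h, (N <= h)%N -> corner_pow F S h = 0.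
Proof.
move=> sF; pose G := F *m proj_mx K S.
have hG h p q : (G ^+ h) p q != 0 -> (al p + h <= al q)%N.
  elim: h p q => [|h IH] p q.
    by rewrite expr0 !mxE; case: (eqVneq p q) => [->|_]; rewrite ?addn0 // mulr0n eqxx.
  rewrite exprSr -mulmxE mxE => nz.
  have [r nr] : exists r, (G ^+ h) p r * G r q != 0.
    apply/existsP; apply: contraNT nz => /existsPn z.
    by rewrite big1 // => i _; apply/eqP; move: (z i); rewrite negbK.
  move: nr; rewrite mulf_eq0 negb_or => /andP[/IH h1].
  rewrite mul_mx_proj mulf_eq0 negb_or => /andP[/sF/andP[h2 _] _].
  by rewrite addnS; apply: leq_ltn_trans h1 h2.
exists (\max_p al p).+1 => h hh; rewrite /corner_pow -/G.
suff -> : G ^+ h = 0 by rewrite mulmx0.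
apply/matrixP => p q; rewrite mxE; apply/eqP; apply/contraT => /hG h1.
have := @leq_bigmax _ al q; lia.
Qed.

(** By convexity a plateau at positive rank would persist for ever, against nilpotency. *)
Lemma rank_corner_pos F S h : strict_mx F -> (0 < \rank (corner_pow F S h.+1))%N ->
  (\rank (corner_pow F S h.+1) < \rank (corner_pow F S h))%N.
Proof.
move=> sF pos; rewrite ltn_neqAle rank_corner_leS andbT; apply/negP => /eqP e.
have st j : \rank (corner_pow F S (h + j)) = \rank (corner_pow F S (h + j).+1).
  elim: j => [|j IH]; first by rewrite addn0.
  by have := rank_corner_convex F S (h + j); have := rank_corner_leS F S (h + j).+1;
     rewrite addnS; lia.
have c j : \rank (corner_pow F S (h + j).+1) = \rank (corner_pow F S h.+1).
  by elim: j => [|j IH]; rewrite ?addn0 // -st addnS.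
have [N hN] := strict_nilp S sF.
by move: pos; rewrite -(c N) hN ?mxrank0 //; lia.
Qed.

Lemma strict_pencil F0 F1 t : strict_mx F0 -> strict_mx F1 -> strict_mx (F0 + t *: (F1 - F0)).
Proof.
move=> s0 s1 p q; rewrite !mxE; apply: contraR => npq.
by rewrite (strict_mx0 s0) // (strict_mx0 s1) // subr0 mulr0 addr0.
Qed.

End CornerRank.

(** * Strict matrices generic for several corners at once *)

Section Generic.
Variables (K : fieldType) (D : nat) (al be : 'I_D -> nat).
Hypothesis nonroot : forall P : {poly K}, P != 0 -> exists t, ~~ root P t.
Implicit Types (S : {set 'I_D}) (F : 'M[K]_D) (h : nat).
Local Notation strict_mx := (strict_mx al be).

Lemma pencil_semicont F0 F1 S h t0 : exists2 P : {poly K}, P.[t0] != 0 &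
  forall t, P.[t] != 0 -> (\rank (corner_pow (F0 + t0 *: (F1 - F0)) S h) <=
                           \rank (corner_pow (F0 + t *: (F1 - F0)) S h))%N.
Proof.
pose G : 'M[{poly K}]_D := map_mx polyC F0 + 'X *: (map_mx polyC F1 - map_mx polyC F0).
have e t : map_mx (horner_eval t) G = F0 + t *: (F1 - F0).
  by apply/matrixP => p q; rewrite !mxE /horner_eval !hornerE.
have [P nP hP] := rank_semicont (corner_pow G S h) (horner_eval t0).
exists P; first exact: nP.
move=> t; have := hP (horner_eval t).
by rewrite !map_corner_pow !e; apply.
Qed.

(** Strict matrices form a linear space. On the line through two of them, all but finitely many
    points keep the bounds already met at t = 0 and the new one met at t = 1. *)
Lemma strict_generic (L : seq ({set 'I_D} * nat)) (r : {set 'I_D} -> nat -> nat) :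
  (forall S h, (S, h) \in L ->
     exists2 F : 'M[K]_D, strict_mx F & (r S h <= \rank (corner_pow F S h))%N) ->
  exists2 F : 'M[K]_D, strict_mx F & forall S h, (S, h) \in L ->
    (r S h <= \rank (corner_pow F S h))%N.
Proof.
elim: L => [|[S h] L IH] hL.
  by exists 0 => // p q; rewrite mxE eqxx.
have [S' h' xL|F0 s0 h0] := IH; first by apply: hL; rewrite inE xL orbT.
have [F1 s1 h1] := hL S h (mem_head _ _).
have [P nP hP] : exists2 P : {poly K}, P.[0] != 0 & forall t, P.[t] != 0 ->
   forall S' h', (S', h') \in L -> (\rank (corner_pow F0 S' h') <=
     \rank (corner_pow (F0 + t *: (F1 - F0)) S' h'))%N.
  elim: (L) => [|[S' h'] L' [P nP hP]].
    by exists 1 => //; rewrite hornerE oner_eq0.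
  have [Q nQ hQ] := pencil_semicont F0 F1 S' h' 0.
  exists (P * Q); first by rewrite hornerM mulf_neq0.
  move=> t; rewrite hornerM mulf_eq0 negb_or => /andP[Pt Qt] S'' h''.
  rewrite inE => /predU1P[[-> ->]|]; last exact: hP.
  by have := hQ t Qt; rewrite scale0r addr0.
have [Q nQ hQ] := pencil_semicont F0 F1 S h 1.
have nPQ : P * Q != 0.
  by rewrite mulf_neq0 //; [apply: contraNneq nP|apply: contraNneq nQ] => ->; rewrite horner0.
have [t] := nonroot nPQ.
rewrite /root hornerM mulf_eq0 negb_or => /andP[Pt Qt].
exists (F0 + t *: (F1 - F0)); first exact: strict_pencil.
move=> S' h'; rewrite inE => /predU1P[[-> ->]|xL].
  by apply: leq_trans h1 _; have := hQ t Qt; rewrite scale1r addrCA subrr addr0.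
by apply: leq_trans (h0 _ _ xL) (hP _ Pt _ _ xL).
Qed.

End Generic.

(** * The rank function attached to a Greene-Kleitman shape *)

Section GenericRank.
Local Open Scope nat_scope.
Variables (D : nat) (al be : 'I_D -> nat).
Hypotheses (al_inj : injective al) (be_inj : injective be).
Implicit Types (S W X Y Z : {set 'I_D}) (h j k : nat) (p q x y : 'I_D).
Local Notation plt := (plt al be).
Local Notation gk := (gk al be).
Local Notation gk_part := (gk_part al be).

(** The rank of the h-th power of a nilpotent matrix whose Jordan type is the shape of [S]. *)
Definition gk_rank S h := \sum_(j < D) (gk_part S j - h).

Lemma card_le_D S : #|S| <= D.
Proof. by rewrite -[D in _ <= D]card_ord max_card. Qed.

Lemma gk_part_ge_D S j : D <= j -> gk_part S j = 0.
Proof.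
by move=> Dj; apply: gk_part_eq0; apply: width_le_card; apply: leq_trans (card_le_D S) Dj.
Qed.

Lemma gk_part_count S h : 0 < h ->
  exists J, forall j, (h <= gk_part S j) = (j < J).
Proof.
move=> h0; have ex : exists j, gk_part S j < h by exists D; rewrite gk_part_ge_D.
exists (ex_minn ex) => j; case: ex_minnP => J hJ mJ; apply/idP/idP.
  rewrite [j < J]ltnNge; apply: contraL => Jj; rewrite -ltnNge.
  by apply: leq_ltn_trans hJ; exact: gk_part_noninc.
by move=> jJ; rewrite leqNgt; apply/negP => /mJ; rewrite leqNgt jJ.
Qed.

Lemma gk_rankE S h N : D <= N -> gk_rank S h = \sum_(j < N) (gk_part S j - h).
Proof.
move=> DN; rewrite /gk_rank -!(big_mkord xpredT (fun j => gk_part S j - h)).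
rewrite [RHS](big_cat_nat (n := D)) //= [X in _ = _ + X]big_nat [X in _ = _ + X]big1 ?addn0 //.
by move=> i /andP[Di _]; rewrite gk_part_ge_D.
Qed.

(** With [gk_rank_eq], a Legendre duality: for h > 0, [gk_rank S h] is the maximum over j of gk j S
    - j * h, attained when j counts the parts of size at least h. *)
Lemma gk_rank_ge S h j : gk j S <= gk_rank S h + j * h.
Proof.
rewrite (@gk_rankE S h (D + j)) ?leq_addr // gk_sum // addnC big_split_ord /=.
pose G i := gk_part S i.
have : \sum_(i < j) G i <= \sum_(i < D + j) (G i - h) + j * h.
  rewrite -[X in X <= _](big_mkord xpredT) -[X in _ <= X + _](big_mkord xpredT (fun i => G i - h)).
  rewrite [X in _ <= X + _](big_cat_nat (n := j)) //=; last exact: leq_addl.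
  rewrite [j * h](_ : _ = \sum_(0 <= i < j) h); last by rewrite sum_nat_const_nat subn0.
  rewrite addnAC -big_split /=; apply: leq_trans (leq_addr _ _).
  by apply: leq_sum => i _; lia.
by rewrite big_split_ord /= [j * h + _]addnC.
Qed.

Lemma gk_rank_eq S h J : (forall j, (h <= gk_part S j) = (j < J)) ->
  gk_rank S h + J * h = gk J S.
Proof.
move=> hJ; rewrite (@gk_rankE S h (D + J)) ?leq_addr // gk_sum //.
rewrite -(big_mkord xpredT (fun i => gk_part S i - h)) -[RHS](big_mkord xpredT).
rewrite (big_cat_nat (n := J)) //=; last exact: leq_addl.
rewrite [J * h](_ : _ = \sum_(0 <= i < J) h); last by rewrite sum_nat_const_nat subn0.
rewrite addnAC -big_split /= [X in _ + X = _]big_nat [X in _ + X = _]big1 ?addn0.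
  by rewrite !big_nat; apply: eq_bigr => i /andP[_ iJ]; rewrite subnK // hJ.
by move=> i /andP[Ji _]; have := hJ i; lia.
Qed.

Lemma gk_rank0 S : gk_rank S 0 = #|S|.
Proof.
have := @gk_all _ al be D S; rewrite width_le_card ?card_le_D // => <- //.
by rewrite gk_sum //; apply: eq_bigr => i _; rewrite subn0.
Qed.

Lemma gk_rankS S h J : (forall j, (h < gk_part S j) = (j < J)) ->
  gk_rank S h = gk_rank S h.+1 + J.
Proof.
move=> hJ; have [N DN JN] : exists2 N, D <= N & J <= N.
  by exists (D + J); rewrite ?leq_addr ?leq_addl.
rewrite !(gk_rankE S _ DN).
have {1}-> : J = \sum_(j < N) (j < J).
  rewrite -(big_mkord xpredT (fun j => (j < J) : nat)) (big_cat_nat (n := J)) //=.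
  rewrite [X in _ = _ + X]big_nat [X in _ = _ + X]big1 ?addn0; last by move=> i; lia.
  rewrite big_nat (eq_bigr (fun=> 1)); last by move=> i; lia.
  by rewrite -big_nat sum_nat_const_nat subn0 muln1.
by rewrite -big_split /=; apply: eq_bigr => i _; have := hJ i; lia.
Qed.

Lemma gk_rank_part S W k h : k < D ->
  (forall j, gk_part S j = gk_part W j + (j == k)) ->
  gk_rank S h = gk_rank W h + (h <= gk_part W k).
Proof.
move=> kD hS; rewrite /gk_rank (bigD1 (Ordinal kD)) //= [in RHS](bigD1 (Ordinal kD)) //=.
rewrite hS eqxx addn1 addnAC; congr (_ + _); first by lia.
by apply: eq_bigr => i; rewrite hS -val_eqE /= => /negbTE ->; rewrite addn0.
Qed.

End GenericRank.

(** * Generic corner ranks are given by the shapes (Gansner-Saks theorem) *)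

Section RankTheorem.
Local Open Scope nat_scope.
Variables (K : fieldType) (D : nat) (al be : 'I_D -> nat).
Hypothesis nonroot : forall P : {poly K}, P != 0%R -> exists t, ~~ root P t.
Hypotheses (al_inj : injective al) (be_inj : injective be).
Implicit Types (B S W X Y Z : {set 'I_D}) (h j k : nat) (p q x y : 'I_D) (F : 'M[K]_D).
Local Notation plt := (plt al be).
Local Notation gk := (gk al be).
Local Notation gk_part := (gk_part al be).
Local Notation gk_rank := (gk_rank al be).
Local Notation strict_mx := (strict_mx al be).

Lemma strict_up_closed F W S : strict_mx F -> W \subset S ->
  (forall p q, p \in W -> q \in S -> q \notin W -> plt p q = false) -> up_closed F W S.
Proof.
by move=> sF WS h; split=> // p q pW qS qW; apply: (strict_mx0 sF); rewrite h.
Qed.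

Lemma strict_down_closed F W S : strict_mx F -> W \subset S ->
  (forall p q, q \in W -> p \in S -> p \notin W -> plt p q = false) -> down_closed F W S.
Proof.
by move=> sF WS h; split=> // p q pW qS qW; apply: (strict_mx0 sF); rewrite h.
Qed.

(* The matrix sending each element of [B] to its successor in its chain. *)
Lemma chain_mx_rank B j : width_le al be j B ->
  exists2 F : 'M[K]_D, strict_mx F &
    (forall p q, p \in B -> q \notin B -> F p q = 0%R) /\
    forall h, #|B| <= \rank (corner_pow F B h) + j * h.
Proof.
move=> wB; have [phi hphi mphi] := width_le_coloring wB.
have cmp p q : p \in B -> q \in B -> phi p = phi q -> p != q -> plt p q || plt q p.
  move=> pB qB e npq; have := comparable_or al_inj be_inj npq.
  case/or4P => [->//|->|/mphi|/mphi]; rewrite ?orbT //.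
    by move=> /(_ pB qB); rewrite e ltnn.
  by move=> /(_ qB pB); rewrite e ltnn.
pose sc p q := [&& p \in B, q \in B, phi p == phi q, plt p q &
  [forall r in B, ~~ [&& phi r == phi p, plt p r & plt r q]]].
have scP p q r : sc p q -> r \in B -> phi r = phi p -> plt p r -> plt r q -> False.
  case/and5P=> _ _ _ _ /forall_inP /(_ r) hr rB e pr rq.
  by move: (hr rB); rewrite e eqxx pr rq.
have sc_inj p p' q : sc p q -> sc p' q -> p = p'.
  move=> s1 s2; apply/eqP/contraT => np.
  case/and5P: (s1) => pB qB /eqP e1 l1 _; case/and5P: (s2) => p'B _ /eqP e2 l2 _.
  case/orP: (cmp _ _ pB p'B (etrans e1 (esym e2)) np) => l.
    by case: (scP _ _ _ s1 p'B _ l l2); rewrite e1.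
  by case: (scP _ _ _ s2 pB _ l l1); rewrite e2.
pose F : 'M[K]_D := (\matrix_(p, q) ((sc p q)%:R))%R.
exists F => [p q|].
  by rewrite mxE; case: (boolP (sc p q)) => [/and5P[]//|]; rewrite eqxx.
split=> [p q pB qB|].
  by rewrite mxE /sc (negbTE qB) andbF.
pose B' := [set p in B | [exists q, sc p q]].
have h1 : #|B'| <= \rank (corner_pow F B 1).
  have -> : #|B'| = \rank (corner_pow F B 1 *m F^T)%R; last exact: mxrankM_maxl.
  rewrite -(mxrank_proj K B'); congr (\rank _); apply/matrixP => p p'.
  rewrite corner_powSr corner_pow0 [RHS]mxE proj_mxE inE.
  have E q : ((proj_mx K B *m (F *m proj_mx K B)) p q * F^T q p' = (sc p q && sc p' q)%:R)%R.
    rewrite mul_proj_mx mul_mx_proj !mxE.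
    case: (boolP (sc p q)) => [/and5P[-> -> _ _ _]|_]; rewrite ?(mul0r, mul1r, mulr0, mulr1) //.
  rewrite (eq_bigr _ (fun q _ => E q)).
  case: (eqVneq p p') => [<-|np] /=.
    case: (boolP (p \in B)) => pB /=; last first.
      by rewrite big1 // => q _; rewrite /sc (negbTE pB).
    case: (boolP [exists q, sc p q]) => [/existsP[q pq]|/existsPn n]; last first.
      by rewrite big1 // => q _; rewrite (negbTE (n q)).
    rewrite (bigD1 q) //= pq big1 ?GRing.addr0 // => q' nq; case: (boolP (sc p q')) => //= pq'.
    have [/and5P[_ qB /eqP e1 l1 _] /and5P[_ qB' /eqP e2 l2 _]] := (pq, pq').
    have nq' : q != q' by rewrite eq_sym.
    case/orP: (cmp _ _ qB qB' (etrans (esym e1) e2) nq').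
      by move=> l; case: (scP _ _ _ pq' qB (esym e1) l1 l).
    by move=> l; case: (scP _ _ _ pq qB' (esym e2) l2 l).
  rewrite big1 // => q _; case: (boolP (sc p q)) => //= pq; case: (boolP (sc p' q)) => //= pq'.
  by move: np; rewrite (sc_inj _ _ _ pq pq') eqxx.
(* What is left of [B] are the tops of the chains, at most one for each colour. *)
have h2 : #|B :\: B'| <= j.
  apply: (card_le_inj (phi := phi)) => [p|p q].
    by rewrite inE => /andP[_]; exact: hphi.
  have nos u v : u \in B :\: B' -> v \in B -> phi u = phi v -> plt u v = false.
    rewrite !inE => /andP[+ uB] vB e; rewrite uB /= => n; apply/negP => uv; case/existsP: n.
    pose P := [pred w | [&& w \in B, phi w == phi u & plt u w]].
    have Pv : P v by rewrite /P /= vB e eqxx.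
    case: (arg_minnP al Pv) => w /and3P[winB /eqP we uw] mw.
    exists w; rewrite /sc uB winB we eqxx uw /=.
    apply/forall_inP => r rB; apply/negP => /and3P[/eqP re ur rw].
    have := mw r; rewrite /P /= rB re eqxx ur => /(_ isT); rewrite leqNgt.
    by case/andP: rw => ->.
  move=> pB qB e; apply/eqP/contraT => npq.
  have [pB' qB'] : p \in B /\ q \in B by move: pB qB; rewrite !inE => /andP[_ ->] /andP[_ ->].
  by have := cmp _ _ pB' qB' e npq; rewrite !nos.
have BE : #|B| = #|B'| + #|B :\: B'|.
  rewrite -(cardsID B' B); congr (#|pred_of_set _| + _); apply/setP => p; rewrite !inE.
  by case: (p \in B).
(* The first power loses at most j in rank; by convexity so does every later one. *)
elim=> [|h IH]; first by rewrite rank_corner0 muln0 addn0.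
move: (rank_corner_diff F B (leq0n h)) IH h1 h2 BE; rewrite rank_corner0 mulnS.
clear; lia.
Qed.

Lemma gk_rank_attained S h : exists2 F : 'M[K]_D, strict_mx F & gk_rank S h <= \rank (corner_pow F S h).
Proof.
(* An index at which the Legendre maximum is attained; a witness for [gk j S] then supplies the
   chains. *)
have [j hj] : exists j, gk_rank S h + j * h = gk j S.
  case: h => [|h]; last first.
    have [J hJ] := gk_part_count al_inj be_inj S (ltn0Sn h).
    by exists J; rewrite (gk_rank_eq hJ).
  by exists D; rewrite gk_rank0 // muln0 addn0 gk_all // width_le_card ?card_le_D.
case: (gk_witness al be j S) => B [BS wB cB].
have [F sF [F0 hF]] := chain_mx_rank wB; exists F => //.
have := rank_corner_up_le h (conj BS (fun p q pW _ qW => F0 p q pW qW)).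
apply: leq_trans; rewrite -(leq_add2r (j * h)) hj -cB; exact: hF.
Qed.

Lemma gk1_add_min W x : x \notin W -> (forall p, p \in W -> plt x p) ->
  gk 1 W < gk 1 (W :|: [set x]).
Proof.
move=> xW xmin; case: (gk_witness al be 1 W) => A [AW wA cA].
have xA : x \notin A by apply: contra xW; exact: (subsetP AW).
rewrite -cA; have -> : #|A|.+1 = #|x |: A| by rewrite cardsU1 xA.
apply: gk_ge.
  by rewrite setUC; apply: setSU.
apply: (width_le_height (phi := fun=> 0)) => // p q.
have xl r : r \in A -> plt x r by move=> /(subsetP AW)/xmin.
rewrite !inE => /predU1P[->|pA] /predU1P[->|qA] npq h1 h2.
- by move: npq; rewrite eqxx.
- by move: h1; rewrite xl.
- by move: h2; rewrite xl.
have /width_leP /(_ [set p; q]) := wA; rewrite cards2 npq => hh.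
suff : 1 < 1 by []. 
apply: hh; first by rewrite subUset !sub1set pA qA.
apply/antichainP => u v; rewrite !inE => /orP[]/eqP-> /orP[]/eqP->;
  by rewrite ?plt_irr // ?(negbTE h1) ?(negbTE h2).
Qed.

(** [x] precedes all of [W] and lengthens its longest chain, so the new box is in row 0. The
    delicate case is h beyond the largest part of [W]: a positive rank at h would force rank at
    least 2 at h - 1, where the bound is 1. *)
Lemma rank_corner_min F W x h : x \notin W -> strict_mx F ->
  (forall p, p \in W -> plt x p) -> (forall h, \rank (corner_pow F W h) <= gk_rank W h) ->
  \rank (corner_pow F (W :|: [set x]) h) <= gk_rank (W :|: [set x]) h.
Proof.
move=> xW sF xmin IH; set S := _ :|: _.
have xS p : p \in S -> conj_lt al be p x = false.
  by rewrite !inE => /orP[/xmin|/eqP->]; rewrite /plt /conj_lt; lia.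
have up : up_closed F W S.
  apply: strict_up_closed => //; first exact: subsetUl.
  move=> p q pW; rewrite !inE => /orP[-> //|/eqP-> _].
  by have := xmin p pW; rewrite /plt; lia.
have [k [kW hk hp]] : exists k, [/\ k <= #|W|, forall j, gk j S = gk j W + (k < j)
    & forall j, gk_part S j = gk_part W j + (j == k)].
  apply: gk_add1_box => //; left; move=> a p; rewrite inE => /eqP->; exact: xS.
have k0 : k = 0.
  by have := gk1_add_min xW xmin; rewrite -/S hk; case: (k) => //; lia.
have kD : 0 < D by apply: leq_trans (card_le_D S); apply/card_gt0P; exists x; rewrite !inE eqxx orbT.
rewrite k0 in hp; rewrite (gk_rank_part h kD hp).
have rS h' : \rank (corner_pow F S h') <= gk_rank W h' + 1.
  by apply: leq_trans (rank_corner_up1 h' xW up) _; rewrite leq_add2r.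
case: (leqP h (gk_part W 0)) => [_|hlt]; first exact: rS.
have Z h' : gk_part W 0 <= h' -> gk_rank W h' = 0.
  move=> hh; rewrite /gk_rank big1 // => i _; apply/eqP; rewrite subn_eq0.
  by apply: leq_trans hh; exact: gk_part_noninc.
case: h hlt => // h hlt; rewrite Z ?(ltnW hlt) // leqNgt; apply/negP => pos.
have := rank_corner_pos sF pos; have := rS h; rewrite Z //; lia.
Qed.

(** Submodularity bounds the rank on the union by the shapes of three smaller sets. The bound is
    insufficient only if [x] and [y] add their boxes to [W] in the same row. A violation at h then
    propagates by convexity up to the length of that row plus 1, where submodularity refutes it. *)
Lemma rank_corner_step F W x y h : x \notin W -> y \notin W -> x != y -> strict_mx F ->
  (forall p, p \in W -> al x < al p) -> al x < al y ->
  (forall p, p \in W -> be y < be p) -> be y < be x ->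
  (forall T, T \in [:: W; W :|: [set x]; W :|: [set y]] ->
     forall (F : 'M[K]_D) h, strict_mx F -> \rank (corner_pow F T h) <= gk_rank T h) ->
  \rank (corner_pow F (W :|: [set x] :|: [set y]) h) <= gk_rank (W :|: [set x] :|: [set y]) h.
Proof.
move=> xW yW nxy sF ax axy ey eyx IH; set S := _ :|: [set y].
have SP p : p \in S -> [\/ p \in W, p = x | p = y].
  by rewrite !inE => /orP[/orP[|/eqP]|/eqP] ?; [constructor 1|constructor 2|constructor 3].
have [X0 XY [YS XS]] : [/\ [disjoint [set x] & [set y]], [disjoint [set y] & [set x]]
      & [disjoint [set y] & W] /\ [disjoint [set x] & W]].
  by rewrite !disjoints1 !inE xW yW nxy eq_sym nxy.
have Xm : conj_min al be [set x] S.
  move=> a p; rewrite inE => /eqP-> /SP[/ax|->|->]; rewrite /conj_lt; move: axy eyx; clear; lia.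
have Ym : conj_max al be [set y] S.
  move=> a p; rewrite inE => /eqP-> /SP[/ey|->|->]; rewrite /conj_lt; move: axy eyx; clear; lia.
have WS : W \subset S by rewrite /S -setUA subsetUl.
have WXS : W :|: [set x] \subset S by rewrite subsetUl.
have WYS : W :|: [set y] \subset S by rewrite /S setUAC subsetUl.
have [kx [kxW hkx hpx]] := gk_add1_box al_inj be_inj xW (or_introl (fun a p ha hp => Xm a p ha (subsetP WXS p hp))).
have [ky [kyW hky hpy]] := gk_add1_box al_inj be_inj yW (or_intror (fun a p ha hp => Ym a p ha (subsetP WYS p hp))).
have cW : #|W| < D.
  apply: leq_trans (card_le_D (W :|: [set x])); by rewrite setUC cardsU1 xW.
have kxD : kx < D by apply: leq_ltn_trans cW.
have kyD : ky < D by apply: leq_ltn_trans cW.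
have rx h' := gk_rank_part h' kxD hpx.
have ry h' := gk_rank_part h' kyD hpy.
case: (posnP h) => [->|h0]; first by rewrite rank_corner0 gk_rank0.
rewrite leqNgt; apply/negP => bad.
set T3 := [:: W; W :|: [set x]; W :|: [set y]] in IH.
(* The exponents used below go up to h or to c.+1, where c is a part of [W], hence at most [D]. *)
pose N := h + D.+2.
pose L := (S, h) :: [seq (T, h') | T <- T3, h' <- iota 0 N].
pose r T h' := if (T, h') == (S, h) then (gk_rank S h).+1 else gk_rank T h'.
(* A single matrix keeping the violation at (S, h) and generic on the three smaller sets for all
   exponents below [N]. *)
have [G sG hG] : exists2 F : 'M[K]_D, strict_mx F & forall T h', (T, h') \in L ->
    r T h' <= \rank (corner_pow F T h').
  apply: (strict_generic nonroot) => T h' _; rewrite /r; case: eqP => [[-> ->]|_].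
    by exists F.
  exact: gk_rank_attained.
have nST T h' : T \in T3 -> (T, h') == (S, h) = false.
  move=> hT; apply/negP => /eqP[e _]; move: hT; rewrite e !inE => /or3P[]/eqP E.
  - by move: xW; rewrite -E !inE eqxx orbT.
  - have : y \in S by rewrite !inE eqxx orbT.
    by rewrite E !inE eq_sym (negbTE nxy) (negbTE yW).
  - have : x \in S by rewrite !inE eqxx orbT.
    by rewrite E !inE (negbTE nxy) (negbTE xW).
have rG T h' : T \in T3 -> h' < N -> \rank (corner_pow G T h') = gk_rank T h'.
  move=> hT hN; apply/eqP; rewrite eqn_leq IH //=.
  have := hG T h'; rewrite /r nST //; apply; rewrite inE; apply/orP; right.
  by apply: allpairs_f => //; rewrite mem_iota.
have rS : gk_rank S h < \rank (corner_pow G S h).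
  by have := hG S h (mem_head _ _); rewrite /r eqxx.
have {hG L r nST} _ := tt.
have upT : up_closed G W S.
  apply: strict_up_closed => // p q pW /SP[->//|->|->] _; move: (ax p pW) (ey p pW); rewrite /plt; clear; lia.
have upX : up_closed G (W :|: [set x]) S.
  apply: strict_up_closed => // p q; rewrite [p \in _]inE in_set1 => pWx /SP[h1|->|->]; rewrite !inE ?h1 ?eqxx ?orbT // => _.
  by case/orP: pWx => [/ey|/eqP->]; rewrite /plt; move: eyx; clear; lia.
have upY : up_closed G (W :|: [set y]) S.
  apply: strict_up_closed => // p q; rewrite [p \in _]inE in_set1 => pWx /SP[h1|->|->]; rewrite !inE ?h1 ?eqxx ?orbT // => _.
  by case/orP: pWx => [/ax|/eqP->]; rewrite /plt; move: axy; clear; lia.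
have sub h' : h' < N -> \rank (corner_pow G S h') <= 
     gk_rank W h' + (h' <= gk_part W kx) + (h' <= gk_part W ky).
  move=> hN; have := rank_corner_submod h' upT upX upY.
  rewrite (rG W) ?(rG (W :|: [set x])) ?(rG (W :|: [set y])) ?inE ?eqxx ?orbT // rx ry.
  by rewrite -/S; clear; lia.
have [J hJ] := gk_part_count al_inj be_inj W h0.
have JE := gk_rank_eq hJ.
have hN : h < N by rewrite /N; clear; lia.
have sJ := sub h hN; rewrite !hJ in sJ.
have gJ := gk_rank_ge al be S h J.
(* By [gk_add_l] and [gk_add_r], the upper bound [sJ] exceeds the lower bound for the shape of [S]
   only if [kx] and [ky] are both the last row of length at least h. *)
have [kxJ kyJ] : kx.+1 = J /\ ky.+1 = J.
  case: J {hJ} JE sJ gJ => [|j] JE sJ gJ; first by move: sJ gJ JE rS; rewrite !gk0; clear; lia.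
  have := gk_add_l al_inj be_inj X0 XS YS Xm Ym j.
  have := gk_add_r al_inj be_inj X0 XS YS Xm Ym j.
  by rewrite !hkx !hky -/S; move: gJ JE rS sJ; clear; lia.
have e : kx = ky by apply: succn_inj; rewrite kxJ kyJ.
subst ky; have {kyD kyW kyJ} _ := tt.
have rS2 : gk_rank W h + 2 <= \rank (corner_pow G S h).
  have := gk_add_r al_inj be_inj X0 XS YS Xm Ym kx.
  by rewrite !hkx !hky -/S kxJ; move: gJ JE bad rS sJ kxJ; clear; lia.
have hk : h <= gk_part W kx by rewrite hJ -kxJ.
set c := gk_part W kx in hk sub rx ry *.
have cD : c <= D.
  apply: leq_trans (card_le_D W); have := gk_le_card al be kx.+1 W.
  by rewrite (gkE al be W kx) -/c; apply: leq_trans; apply: leq_addl.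
have yWY : W :|: [set y] \in T3 by rewrite !inE eqxx !orbT.
have Sx : S = W :|: [set y] :|: [set x] by rewrite /S setUAC.
have slopeh : gk_rank (W :|: [set y]) h.-1 = gk_rank (W :|: [set y]) h + J.
  rewrite -[in gk_rank _ h](prednK h0); apply: gk_rankS => j.
  rewrite (prednK h0) hpy; case: eqP => [->|nj]; last by rewrite addn0 hJ.
  by rewrite -kxJ ltnSn addn1 leqW.
(* The rank drops by at most [J] from h.-1 to h, so by convexity at every later step, whereas
   [gk_rank (W :|: [set y])] drops by at least [J] at each step up to c.+1. *)
have dS : \rank (corner_pow G S h.-1) <= \rank (corner_pow G S h) + J.
  have h1 := @rank_corner_up1 _ _ G (W :|: [set y]) x h.-1; rewrite -Sx in h1.
  have : x \notin W :|: [set y] by rewrite !inE (negbTE xW) (negbTE nxy).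
  move=> /h1 /(_ upY); rewrite (rG (W :|: [set y])) //; last first.
    exact: leq_ltn_trans (leq_pred h) hN.
  by rewrite slopeh ry hk; move: rS2; clear; lia.
have key i : h + i <= c.+1 -> gk_rank (W :|: [set y]) (h + i) < \rank (corner_pow G S (h + i)).
  elim: i => [|i IHi] hi; first by rewrite addn0 ry hk; move: rS2; clear; lia.
  have {}IHi := IHi (leq_trans (leq_add (leqnn h) (leqnSn i)) hi).
  have hh : h.-1 <= h + i by apply: leq_trans (leq_pred h) (leq_addr _ _).
  have := rank_corner_diff G S hh; rewrite (prednK h0).
  have h1 : 0 < (h + i).+1 by [].
  have [J' hJ'] := gk_part_count al_inj be_inj (W :|: [set y]) h1.
  have : kx < J' by rewrite -hJ' hpy eqxx -/c addn1 -addnS.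
  have := gk_rankS hJ'.
  by rewrite addnS; move: IHi dS kxJ; clear; lia.
have cN : c.+1 < N by rewrite /N; move: cD; clear; lia.
(* At exponent c.+1 neither box contributes to the submodular bound, which contradicts [key]. *)
have := key (c.+1 - h); rewrite subnKC; last exact: leqW.
move=> /(_ (leqnn _)); have := sub c.+1 cN; rewrite ry -/c ltnn; clear; lia.
Qed.

Theorem rank_corner_le F S h : strict_mx F -> \rank (corner_pow F S h) <= gk_rank S h.
Proof.
have [n] := ubnP #|S|; elim: n S F h => // n IH S F h cS sF.
have [S0|/set0Pn[s sS]] := eqVneq S set0.
  by apply: leq_trans (mxrankM_maxl _ _) _; rewrite mxrank_proj S0 cards0.
case: (arg_minnP al sS) => x xS mx; case: (arg_minnP be sS) => y yS my.
have {}xS : x \in S by []; have {}yS : y \in S by [].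
have xlt p : p \in S -> p != x -> al x < al p.
  by move=> pS np; rewrite ltn_neqAle mx // andbT eq_sym (inj_eq al_inj).
have ylt p : p \in S -> p != y -> be y < be p.
  by move=> pS np; rewrite ltn_neqAle my // andbT eq_sym (inj_eq be_inj).
have [exy|nxy] := eqVneq x y.
  have -> : S = (S :\ x) :|: [set x] by rewrite setUC setD1K.
  apply: rank_corner_min => //; first by rewrite !inE eqxx.
    move=> p; rewrite !inE => /andP[px pS]; rewrite /plt xlt // exy ylt //.
    by rewrite -exy.
  by move=> h'; apply: IH => //; move: cS; rewrite (cardsD1 x S) xS.
pose W := S :\ x :\ y.
have SE : S = W :|: [set x] :|: [set y].
  by apply/setP => p; rewrite !inE; do 2 case: eqP => [->|_]; rewrite ?xS ?yS ?orbT ?orbF.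
have cW : #|W|.+2 = #|S|.
  by rewrite (cardsD1 x S) xS (cardsD1 y (S :\ x)) !inE yS eq_sym nxy.
have WP p : p \in W -> [/\ p != y, p != x & p \in S] by rewrite !inE => /and3P[].
rewrite SE; apply: rank_corner_step => //.
- by rewrite !inE eqxx andbF.
- by rewrite !inE eqxx.
- by move=> p /WP[_ px pS]; exact: xlt.
- by apply: xlt => //; rewrite eq_sym.
- by move=> p /WP[py _ pS]; exact: ylt.
- by apply: ylt.
move=> T hT F' h' sF'; apply: IH => //.
by move: hT; rewrite !inE => /or3P[]/eqP->; rewrite ?[W :|: _]setUC ?cardsU1 ?inE; lia.
Qed.

End RankTheorem.

(** * Local rules for the box added by one point *)

Section BoxRules.
Local Open Scope nat_scope.
Variables (K : fieldType) (D : nat) (al be : 'I_D -> nat).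
Hypothesis nonroot : forall P : {poly K}, P != 0%R -> exists t, ~~ root P t.
Hypotheses (al_inj : injective al) (be_inj : injective be).
Implicit Types (S W X Y Z : {set 'I_D}) (h j k : nat) (p q x y : 'I_D) (F : 'M[K]_D).
Local Notation plt := (plt al be).
Local Notation gk := (gk al be).
Local Notation gk_part := (gk_part al be).
Local Notation gk_rank := (gk_rank al be).

Lemma generic_pair S S' h : exists F, strict_mx al be F /\
  [/\ \rank (corner_pow F S h) = gk_rank S h, \rank (corner_pow F S' h) = gk_rank S' h
    & forall W, \rank (corner_pow F W h) <= gk_rank W h].
Proof.
have [F sF hF] : exists2 F : 'M[K]_D, strict_mx al be F &
    forall T h', (T, h') \in [:: (S, h); (S', h)] -> gk_rank T h' <= \rank (corner_pow F T h').
  by apply: (strict_generic nonroot) => T h' _; exact: gk_rank_attained.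
have le W : \rank (corner_pow F W h) <= gk_rank W h by exact: rank_corner_le.
exists F; split=> //; split=> //; apply/eqP; rewrite eqn_leq le hF // !inE eqxx ?orbT //.
Qed.

(** A rank inequality for one matrix passes to shapes: the left-hand terms are attained exactly and
    the right-hand ones are bounded by [rank_corner_le]. *)
Lemma gk_rank_supermod W X Z h :
  (forall p q, p \in W :|: Z -> q \in X -> plt p q = false) ->
  (forall p q, p \in Z -> q \in W :|: X -> plt p q = false) ->
  [disjoint X & Z] ->
  gk_rank (W :|: X) h + gk_rank (W :|: Z) h <= gk_rank (W :|: X :|: Z) h + gk_rank W h.
Proof.
move=> h1 h2 XZ.
have [F [sF [<- <- le]]] := generic_pair (W :|: X) (W :|: Z) h.
apply: leq_trans (leq_add (le _) (le _)); apply: rank_corner_supermod => //.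
- apply: (strict_up_closed sF); first by rewrite setUAC subsetUl.
  move=> p q pW; rewrite !inE => /orP[/orP[->//|qX]|->]; rewrite ?orbT // => _.
  exact: h1.
- apply: (strict_down_closed sF); first exact: subsetUl.
  move=> p q qW; rewrite !inE => /orP[->//|pZ] _; exact: h2.
- apply: (strict_up_closed sF); first exact: subsetUl.
  move=> p q pW; rewrite inE => /orP[->//|qX] _; apply: h1 => //.
  by rewrite inE pW.
Qed.

Lemma gk_rank_submod W X Y h :
  (forall p q, p \in W :|: Y -> q \in X -> plt p q = false) ->
  (forall p q, p \in W :|: X -> q \in Y -> plt p q = false) ->
  gk_rank (W :|: X :|: Y) h + gk_rank W h <= gk_rank (W :|: X) h + gk_rank (W :|: Y) h.
Proof.
move=> h1 h2.
have [F [sF [<- <- le]]] := generic_pair (W :|: X :|: Y) W h.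
apply: leq_trans (leq_add (le _) (le _)); apply: rank_corner_submod => //.
- apply: (strict_up_closed sF); first by rewrite -setUA subsetUl.
  move=> p q pW; rewrite !inE => /orP[/orP[->//|qX]|qY] _.
    by apply: h1 => //; rewrite inE pW.
  by apply: h2 => //; rewrite inE pW.
- apply: (strict_up_closed sF); first exact: subsetUl.
  move=> p q pW; rewrite !inE => /orP[->//|qX] _; exact: h2.
- apply: (strict_up_closed sF); first by rewrite setUAC subsetUl.
  move=> p q pW; rewrite !inE => /orP[/orP[->//|qX]|->]; rewrite ?orbT // => _.
  exact: h1.
Qed.

(** A closed formula for the row of the added box: when one box is added, only its row has a nonzero
    difference. *)
Definition box_row S x := \sum_(j < D) j * (gk_part (S :|: [set x]) j - gk_part S j).

Definition is_box S x k := k < D /\ forall j, gk_part (S :|: [set x]) j = gk_part S j + (j == k).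

Lemma is_box_row S x k : is_box S x k -> box_row S x = k.
Proof.
move=> [kD hk]; rewrite /box_row (bigD1 (Ordinal kD)) //= hk eqxx addKn muln1.
rewrite big1 ?addn0 // => j; rewrite hk -val_eqE /= => /negbTE ->.
by rewrite addn0 subnn muln0.
Qed.

Lemma box_rowP S x : x \notin S ->
  conj_min al be [set x] (S :|: [set x]) \/ conj_max al be [set x] (S :|: [set x]) ->
  is_box S x (box_row S x).
Proof.
move=> xS xm; have [k [kS _ hk]] := gk_add1_box al_inj be_inj xS xm.
suff b : is_box S x k by rewrite (is_box_row b).
split=> //; apply: leq_ltn_trans kS _; apply: leq_trans (card_le_D (S :|: [set x])).
by rewrite setUC cardsU1 xS.
Qed.

Section Pair.
Variables (S Z : {set 'I_D}) (x : 'I_D) (k k' : nat).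
Hypotheses (xS : x \notin S) (xZ : x \notin Z) (ZS : [disjoint Z & S]).
Hypotheses (Xm : conj_min al be [set x] (S :|: [set x] :|: Z)).
Hypotheses (Zm : conj_max al be Z (S :|: [set x] :|: Z)).
Hypotheses (bk : is_box S x k) (bk' : is_box (S :|: Z) x k').

Let dX : [disjoint [set x] & Z]. Proof. by rewrite disjoints1. Qed.
Let dS : [disjoint [set x] & S]. Proof. by rewrite disjoints1. Qed.

Lemma is_box_gk T l j : is_box T x l -> gk j (T :|: [set x]) = gk j T + (l < j).
Proof.
move=> [_ hl]; rewrite !gk_sum.
under eq_bigr => i _ do rewrite hl.
rewrite big_split /=; congr (_ + _).
elim: j => [|j IH]; first by rewrite big_ord0.
by rewrite big_ord_recr /= IH ltnS; clear; lia.
Qed.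

Lemma box_row_le : k <= k' <= k.+1.
Proof.
have h1 := gk_add_sub al_inj be_inj dX dS ZS Xm Zm k'.+1.
have h2 := gk_add_r al_inj be_inj dX dS ZS Xm Zm k.+1.
rewrite setUAC !(is_box_gk _ bk) !(is_box_gk _ bk') in h1 h2.
by move: (gk k'.+1 (S :|: Z)) (gk k'.+1 S) (gk k.+1 S) (gk k.+2 (S :|: Z)) h1 h2; clear; lia.
Qed.

Let xE : S :|: [set x] :|: Z = S :|: Z :|: [set x]. Proof. by rewrite setUAC. Qed.

Lemma box_row_supermod :
  (forall p q, p \in S :|: Z -> q \in [set x] -> plt p q = false) ->
  (forall p q, p \in Z -> q \in S :|: [set x] -> plt p q = false) ->
  gk_part S k <= gk_part (S :|: Z) k'.
Proof.
move=> h1 h2; have := gk_rank_supermod (gk_part S k) h1 h2 dX.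
rewrite xE (gk_rank_part _ (proj1 bk) (proj2 bk)) (gk_rank_part _ (proj1 bk') (proj2 bk')).
by rewrite leqnn; clear; lia.
Qed.

Lemma box_row_submod :
  (forall p q, p \in S :|: Z -> q \in [set x] -> plt p q = false) ->
  (forall p q, p \in S :|: [set x] -> q \in Z -> plt p q = false) ->
  gk_part (S :|: Z) k' <= gk_part S k.
Proof.
move=> h1 h2; have := gk_rank_submod (gk_part (S :|: Z) k') h1 h2.
rewrite xE (gk_rank_part _ (proj1 bk) (proj2 bk)) (gk_rank_part _ (proj1 bk') (proj2 bk')).
by rewrite leqnn; clear; lia.
Qed.

Let Zm0 : conj_max al be Z (S :|: Z).
Proof. by move=> z p zZ pS; apply: Zm => //; rewrite setUAC inE pS. Qed.

(** Uncrossing leaves k' = k or k' = k.+1. In the first case interlacing makes the equality test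
    fail; in the second supermodularity makes it succeed. *)
Lemma box_up :
  (forall p q, p \in S :|: Z -> q \in [set x] -> plt p q = false) ->
  (forall p q, p \in Z -> q \in S :|: [set x] -> plt p q = false) ->
  k' = k + (gk_part (S :|: Z :|: [set x]) k.+1 == gk_part (S :|: [set x]) k).
Proof.
move=> h1 h2; have h3 := box_row_supermod h1 h2; have h4 := box_row_le.
have ZSx : [disjoint Z & S :|: [set x]].
  by rewrite -setI_eq0 setIUr setU_eq0 !setI_eq0 ZS disjoint_sym dX.
have i1 := gk_part_interlace al_inj be_inj k ZSx Zm.
have i2 := gk_part_interlace al_inj be_inj k ZS Zm0.
move: (proj2 bk k) (proj2 bk' k.+1) i1; rewrite xE => -> ->.
have [e|e] : k' = k \/ k' = k.+1 by move: h4; clear; lia.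
  rewrite e; move: i2; move: (gk_part _ _) (gk_part _ _); clear; lia.
rewrite e in h3 *; move: h3; move: (gk_part _ _) (gk_part _ _); clear; lia.
Qed.

(** If k' = k, submodularity forces the two entries to agree. If k' = k.+1, the box of [x] enters
    row k' only in the presence of [Z], so by monotonicity the entries differ. *)
Lemma box_down :
  (forall p q, p \in S :|: Z -> q \in [set x] -> plt p q = false) ->
  (forall p q, p \in S :|: [set x] -> q \in Z -> plt p q = false) ->
  k' = k + (gk_part (S :|: [set x]) k' != gk_part (S :|: Z :|: [set x]) k').
Proof.
move=> h1 h2; have h3 := box_row_submod h1 h2; have h4 := box_row_le.
have ZSx : [disjoint Z & S :|: [set x]].
  by rewrite -setI_eq0 setIUr setU_eq0 !setI_eq0 ZS disjoint_sym dX.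
have i1 := gk_part_add al_inj be_inj k' ZSx Zm.
have i2 := gk_part_add al_inj be_inj k' ZS Zm0.
move: (proj2 bk k') (proj2 bk' k') i1; rewrite xE => -> ->.
have [e|e] : k' = k \/ k' = k.+1 by move: h4; clear; lia.
  rewrite e in h3 *; move: h3; move: (gk_part _ _) (gk_part _ _); clear; lia.
rewrite e in i2 *; move: i2; move: (gk_part _ _) (gk_part _ _); clear; lia.
Qed.
End Pair.
End BoxRules.

(** * Deleting the minimal interval *)

Section Shapes.
Local Open Scope nat_scope.
Variables (K : fieldType) (n m D : nat) (pos : 'I_D -> nat * nat) (al be : 'I_D -> nat).
Hypothesis nonroot : forall P : {poly K}, P != 0%R -> exists t, ~~ root P t.
Hypotheses (al_inj : injective al) (be_inj : injective be).
Hypothesis m_n : 1 <= m <= n.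
Hypothesis pos_inP : forall p, inP n m (pos p).
Hypothesis al_mono : forall p q, (pos p).1 < (pos q).1 -> al p < al q.
Hypothesis be_mono : forall p q, (pos p).2 < (pos q).2 -> be p < be q.
(** Ties are broken so that intervals with a common endpoint are always comparable; they form
    chains, which bounds the widths at each vertex. *)
Hypothesis al_be1 : forall p q, (pos p).1 = (pos q).1 -> (al p < al q) = (be p < be q).
Hypothesis al_be2 : forall p q, (pos p).2 = (pos q).2 -> (al p < al q) = (be p < be q).
Implicit Types (U S Z : {set 'I_D}) (p q x : 'I_D) (i j k r c : nat).
Local Notation plt := (plt al be).
Local Notation gk_part := (gk_part al be).

Let R := n.+1 - m.
Definition through i : {set 'I_D} := [set p | in_int (pos p) i].
Definition shape U i k := gk_part (through i :&: U) k.
(** For the interval [m + 1 - c, n + 1 - r] at cell (r, c), R + c - r is its [ar_pi] and the minimum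
    its [chain_rank]; [cell] inverts this change of coordinates. *)
Definition filling U r c := shape U (R + c - r) (minn (R - r) (m - c)).
Definition cell i k := (R - (i - m) - k, minn i m - k).

Lemma in_through p U i : (p \in through i :&: U) = ((pos p).1 <= i <= (pos p).2) && (p \in U).
Proof. by rewrite !inE. Qed.

Lemma pos_bounds p : [/\ 1 <= (pos p).1, (pos p).1 <= m, m <= (pos p).2 & (pos p).2 <= n].
Proof. by have := pos_inP p; rewrite /inP => /andP[/andP[-> ->] /andP[-> ->]]. Qed.

Lemma al_le p q : al p < al q -> (pos p).1 <= (pos q).1.
Proof. by move=> h; rewrite leqNgt; apply/negP => /al_mono; lia. Qed.

Definition new_a i U := [set p in U | (pos p).1 == i.+1].
Definition new_b i U := [set p in U | (pos p).2 == i].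

Lemma through_up i U : i < m -> through i.+1 :&: U = (through i :&: U) :|: new_a i U.
Proof.
move=> im; apply/setP => p; rewrite in_setU !in_through in_set; have [] := pos_bounds p.
by case: (p \in U); rewrite ?andbF // !andbT; lia.
Qed.

Lemma through_down i U : m <= i -> through i :&: U = (through i.+1 :&: U) :|: new_b i U.
Proof.
move=> im; apply/setP => p; rewrite in_setU !in_through in_set; have [] := pos_bounds p.
by case: (p \in U); rewrite ?andbF // !andbT; lia.
Qed.

Lemma new_a_disj i U : [disjoint new_a i U & through i :&: U].
Proof.
by apply/pred0P => p /=; rewrite in_through in_set; case: (p \in U); rewrite ?andbF //; lia.
Qed.

Lemma new_b_disj i U : [disjoint new_b i U & through i.+1 :&: U].
Proof.
by apply/pred0P => p /=; rewrite in_through in_set; case: (p \in U); rewrite ?andbF //; lia.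
Qed.

Lemma new_a_max i S Z : (forall p, p \in Z -> (pos p).1 = i.+1) ->
  (forall p, p \in S -> (pos p).1 <= i.+1) -> conj_max al be Z S.
Proof.
move=> hZ hS z p /hZ zi /hS pi; apply/negP => /andP[h1 h2].
have := al_le h1; rewrite zi => h3.
have e : (pos z).1 = (pos p).1 by lia.
by rewrite al_be1 // in h1; lia.
Qed.

Lemma new_b_max i S Z : (forall p, p \in Z -> (pos p).2 = i) ->
  (forall p, p \in S -> i <= (pos p).2) -> conj_max al be Z S.
Proof.
move=> hZ hS z p /hZ zi /hS pi; apply/negP => /andP[h1 h2].
have [e|h] := eqVneq (pos z).2 (pos p).2.
  by rewrite al_be2 // in h1; lia.
have : be z < be p by apply: be_mono; lia.
lia.
Qed.

(** Below m, passing from i to i.+1 adds the summands starting at i.+1, which are conjugate-maximal,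
    hence a horizontal strip. In [shape_down] the summands ending at i play this part, in passing
    from i.+1 to i. *)
Lemma shape_up i U k : i < m ->
  shape U i k <= shape U i.+1 k /\ shape U i.+1 k.+1 <= shape U i k.
Proof.
move=> im; rewrite /shape through_up //.
have Zm : conj_max al be (new_a i U) (through i :&: U :|: new_a i U).
  apply: (@new_a_max i) => p; rewrite !inE; last by case: (p \in U); rewrite /in_int; lia.
  by move=> /andP[_ /eqP].
by split; [apply: gk_part_add | apply: gk_part_interlace] => //; exact: new_a_disj.
Qed.

Lemma shape_down i U k : m <= i ->
  shape U i.+1 k <= shape U i k /\ shape U i k.+1 <= shape U i.+1 k.
Proof.
move=> im; rewrite /shape (through_down _ im) //.
have Zm : conj_max al be (new_b i U) (through i.+1 :&: U :|: new_b i U).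
  apply: (@new_b_max i) => p; rewrite !inE; last by case: (p \in U); rewrite /in_int; lia.
  by move=> /andP[_ /eqP].
by split; [apply: gk_part_add | apply: gk_part_interlace] => //; exact: new_b_disj.
Qed.

Lemma comparable1 p q : p != q -> (pos p).1 = (pos q).1 -> plt p q || plt q p.
Proof.
move=> npq e; rewrite !pltE -!al_be1 // !andbb.
by move: npq; rewrite -(inj_eq al_inj); lia.
Qed.

Lemma comparable2 p q : p != q -> (pos p).2 = (pos q).2 -> plt p q || plt q p.
Proof.
move=> npq e; rewrite !pltE -!al_be2 // !andbb.
by move: npq; rewrite -(inj_eq al_inj); lia.
Qed.

(** Summands with the same left endpoint form a chain, so the width is at most the number of left
    endpoints available. *)
Lemma shape_eq0a U i k a0 : (forall p, p \in U -> a0 <= (pos p).1) ->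
  minn i m < a0 + k -> shape U i k = 0.
Proof.
move=> ha hk; apply: gk_part_eq0; apply: (width_le_height (phi := fun p => (pos p).1 - a0)).
  move=> p; rewrite in_through => /andP[pi /ha h]; have [] := pos_bounds p; lia.
move=> p q; rewrite !in_through => /andP[_ /ha h1] /andP[_ /ha h2] npq l1 l2.
apply/negP => /eqP e; have := comparable1 npq.
by rewrite (negbTE l1) (negbTE l2) => h; suff : false by []; apply: h; lia.
Qed.

Lemma shape_eq0b U i k : n < maxn i m + k -> shape U i k = 0.
Proof.
move=> hk; apply: gk_part_eq0; apply: (width_le_height (phi := fun p => (pos p).2 - maxn i m)).
  move=> p; rewrite in_through => /andP[pi _]; have [] := pos_bounds p; lia.
move=> p q; rewrite !in_through => /andP[h1 _] /andP[h2 _] npq l1 l2.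
have [? ? ? ?] := pos_bounds p; have [? ? ? ?] := pos_bounds q.
apply/negP => /eqP e; have := comparable2 npq.
by rewrite (negbTE l1) (negbTE l2) => h; suff : false by []; apply: h; lia.
Qed.

Lemma cellK r c : 1 <= r <= R -> 1 <= c <= m ->
  cell (R + c - r) (minn (R - r) (m - c)) = (r, c).
Proof. by move=> hr hc; rewrite /cell; congr pair; lia. Qed.

Lemma filling_cell U i k : k < minn i m -> k < R - (i - m) ->
  filling U (cell i k).1 (cell i k).2 = shape U i k.
Proof. by move=> h1 h2; rewrite /filling /cell /=; congr shape; lia. Qed.

Lemma cell_inj i k i' k' : k < minn i m -> k < R - (i - m) -> k' < minn i' m ->
  k' < R - (i' - m) -> cell i k = cell i' k' -> i = i' /\ k = k'.
Proof. by rewrite /cell => ? ? ? ? [] ? ?; lia. Qed.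

Lemma filling_rpp U : rpp_b R m (filling U).
Proof.
apply/allP => r; rewrite mem_iota => hr; apply/allP => c; rewrite mem_iota => hc.
rewrite /filling; set i := R + c - r.
apply/andP; split; apply/implyP => h.
  have [im|im] := ltnP i m.
    have [h1 _] := shape_up U (R - r) im.
    rewrite (_ : R + c.+1 - r = i.+1); last by rewrite /i; lia.
    rewrite (_ : minn (R - r) (m - c) = R - r); last by rewrite /i in im; lia.
    rewrite (_ : minn (R - r) (m - c.+1) = R - r) //; by rewrite /i in im; lia.
  have [_ h1] := shape_down U (m - c).-1 im.
  rewrite (_ : R + c.+1 - r = i.+1); last by rewrite /i; lia.
  rewrite (_ : minn (R - r) (m - c) = (m - c).-1.+1); last by rewrite /i in im; lia.
  rewrite (_ : minn (R - r) (m - c.+1) = (m - c).-1) //; by rewrite /i in im; lia.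
have [i' ei] : exists i', i = i'.+1 by exists i.-1; rewrite /i; lia.
rewrite (_ : R + c - r.+1 = i'); last by rewrite /i in ei; lia.
rewrite ei; have [im|im] := ltnP i' m.
  have [_ h1] := shape_up U (R - r).-1 im.
  rewrite (_ : minn (R - r) (m - c) = (R - r).-1.+1); last by rewrite /i in ei; lia.
  rewrite (_ : minn (R - r.+1) (m - c) = (R - r).-1) //; by rewrite /i in ei; lia.
have [h1 _] := shape_down U (m - c) im.
rewrite (_ : minn (R - r) (m - c) = m - c); last by rewrite /i in ei; lia.
rewrite (_ : minn (R - r.+1) (m - c) = m - c) //; by rewrite /i in ei; lia.
Qed.

Section Removal.
Variables (U : {set 'I_D}) (x : 'I_D).
Hypotheses (xU : x \in U) (xmin : forall p, p \in U -> p != x -> al x < al p).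
Let a := (pos x).1.
Let b := (pos x).2.
Let U' := U :\ x.
Let S i := through i :&: U'.
(** The row of the shape at vertex i that receives the box of [x]; the cells [cell i (track i)] turn
    out to be the Hillman-Grassl path. *)
Definition track i := box_row al be (S i) x.

Let xS i : x \notin S i. Proof. by rewrite !inE eqxx !andbF. Qed.

Let SE i : a <= i <= b -> through i :&: U = S i :|: [set x].
Proof.
move=> hi; apply/setP => p; rewrite !inE /in_int; case: eqP => [->|]; last by rewrite orbF.
by rewrite -/a -/b hi xU orbT.
Qed.

Let SN i : ~~ (a <= i <= b) -> through i :&: U = S i.
Proof.
move=> hi; apply/setP => p; rewrite !inE /in_int; case: eqP => [->|] //.
by rewrite -/a -/b (negbTE hi).
Qed.

Let U'lt p : p \in U' -> al x < al p.
Proof. by rewrite !inE => /andP[px pU]; apply: xmin. Qed.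

Let xconj (T : {set 'I_D}) : (forall p, p \in T -> p = x \/ p \in U') -> conj_min al be [set x] T.
Proof.
move=> hT y p; rewrite inE => /eqP-> /hT[->|/U'lt]; rewrite /conj_lt ?ltnn //; lia.
Qed.

Lemma track_box i : is_box al be (S i) x (track i).
Proof.
apply: box_rowP => //; left; apply: xconj => p; rewrite !inE => /orP[/and3P[_ -> ->]|/eqP->]; by auto.
Qed.

Lemma shape_remove i j : shape U i j = shape U' i j + ((a <= i <= b) && (j == track i)).
Proof.
rewrite /shape; case: (boolP (a <= i <= b)) => hi; last by rewrite SN // addn0.
by rewrite SE // (proj2 (track_box i)).
Qed.

Lemma track_pos i : a <= i <= b -> 0 < shape U i (track i).
Proof. by move=> hi; rewrite shape_remove hi eqxx addn1. Qed.

Lemma a_min p : p \in U -> a <= (pos p).1.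
Proof.
move=> pU; have [->|npx] := eqVneq p x; first by [].
by apply: al_le; exact: xmin.
Qed.

Lemma track_bounds i : a <= i <= b -> track i < minn i m /\ track i < R - (i - m).
Proof.
move=> hi; have H := track_pos hi; have [? ? ? ?] := pos_bounds x.
have h1 := @shape_eq0a U i (track i) a a_min.
have h2 := @shape_eq0b U i (track i).
split; rewrite ltnNge; apply/negP => h.
  by move: H; rewrite h1 //; move: h hi; rewrite /a; lia.
by move: H; rewrite h2 //; move: h hi; rewrite /R /b /a; lia.
Qed.

(** For i below m the cells of (i.+1, k.+1) and (i.+1, k) lie above and to the right of the cell of
    (i, k), so this rule is the climbing test of the algorithm. *)
Lemma track_up i : a <= i -> i < m ->
  track i.+1 = track i + (shape U i.+1 (track i).+1 == shape U i (track i)).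
Proof.
move=> ai im; have [? ? ? ?] := pos_bounds x.
rewrite /shape SE ?SE; try by rewrite /b; lia.
have e : S i.+1 = S i :|: new_a i U' by rewrite /S through_up.
have xZ : x \notin new_a i U' by rewrite !inE eqxx.
have b1 := track_box i; have b2 := track_box i.+1; rewrite e in b2 *.
have inSZ p : p \in S i :|: [set x] :|: new_a i U' -> p = x \/ p \in U'.
  by rewrite !inE => /orP[/orP[/and3P[_ -> ->]|/eqP->]|/andP[->]]; auto.
apply: (box_up nonroot al_inj be_inj (xS i) xZ _ _ _ b1 b2).
- exact: new_a_disj.
- exact: xconj.
- apply: (@new_a_max i) => p; rewrite !inE; first by move=> /andP[_ /eqP].
  rewrite /in_int => /orP[/orP[|/eqP->]|]; rewrite -?/a; case: (p \in U); lia.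
- move=> p q pS; rewrite inE => /eqP->; rewrite !pltE.
  have : al x < al p by apply: U'lt; move: pS; rewrite !inE => /orP[/and3P[_ -> ->]|/andP[->]].
  lia.
move=> p q; rewrite !inE => /andP[/andP[px pU] /eqP pi] hq.
have : (pos q).1 < (pos p).1.
  by move: hq; rewrite pi /in_int => /orP[/andP[]|/eqP->]; rewrite -?/a; lia.
by move/al_mono; rewrite !pltE; lia.
Qed.

(** From m on the cells of (i.+1, k) and (i.+1, k.-1) lie above and to the right of the cell of (i,
    k). Points are now added in passing from i.+1 to i, so the rule expresses [track i] by its
    successor. *)
Lemma track_down i : m <= i -> i < b ->
  track i = track i.+1 + (shape U i.+1 (track i) != shape U i (track i)).
Proof.
move=> mi ib; have [? ? ? ?] := pos_bounds x.
rewrite /shape SE ?SE; try by rewrite /a; lia.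
have e : S i = S i.+1 :|: new_b i U' by rewrite /S (through_down _ mi).
have xZ : x \notin new_b i U' by rewrite !inE eqxx.
have b1 := track_box i.+1; have b2 := track_box i; rewrite e in b2 *.
have inSZ p : p \in S i.+1 :|: [set x] :|: new_b i U' -> p = x \/ p \in U'.
  by rewrite !inE => /orP[/orP[/and3P[_ -> ->]|/eqP->]|/andP[->]]; auto.
apply: (box_down nonroot al_inj be_inj (xS i.+1) xZ _ _ _ b1 b2).
- exact: new_b_disj.
- exact: xconj.
- apply: (@new_b_max i) => p; rewrite !inE; first by move=> /andP[_ /eqP].
  rewrite /in_int => /orP[/orP[|/eqP->]|]; rewrite -?/b; case: (p \in U); lia.
- move=> p q pS; rewrite inE => /eqP->; rewrite !pltE.
  have : al x < al p by apply: U'lt; move: pS; rewrite !inE => /orP[/and3P[_ -> ->]|/andP[->]].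
  lia.
move=> p q hp; rewrite !inE => /andP[/andP[qx qU] /eqP qi].
have : (pos q).2 < (pos p).2.
  by move: hp; rewrite !inE qi /in_int => /orP[/andP[]|/eqP->]; rewrite -?/b; lia.
by move/be_mono; rewrite !pltE; lia.
Qed.

Let ab : [/\ 1 <= a, a <= m, m <= b & b <= n]. Proof. exact: pos_bounds. Qed.

(** No left endpoint is smaller than [a], so the summands present at vertex [a] all start there and
    form a chain. *)
Lemma track_first : track a = 0.
Proof.
have [? ? ? ?] := ab; have h : a <= a <= b by lia.
apply/eqP; rewrite -leqn0 leqNgt; apply/negP => k0; have := track_pos h.
by rewrite (shape_eq0a a_min) //; lia.
Qed.

(** At vertex [b] all other summands present end at [b] or later, so [x] precedes them and lengthens
    the longest chain. *)
Lemma track_last : track b = 0.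
Proof.
have xlt p : p \in S b -> plt x p.
  move=> pS; have := pS; rewrite in_through -/b => /andP[/andP[_ hb] /U'lt lt].
  rewrite !pltE lt /=; have [e|ne] := eqVneq (pos x).2 (pos p).2; first by rewrite -al_be2.
  by apply: be_mono; rewrite -/b in ne *; lia.
have := gk1_add_min (xS b) xlt; rewrite (is_box_gk 1 (track_box b)); lia.
Qed.

(** This strict inequality stops the path in the last column, at row n + 1 - b. *)
Lemma shape_last : shape U b.+1 0 < shape U b 0.
Proof.
have [? ? ? ?] := ab; have hb : a <= b <= b by lia.
rewrite [shape U b 0]shape_remove hb track_last eqxx addn1 ltnS.
rewrite /shape !gk_partE !gk0 !subn0; apply: gkS => //; apply/subsetP => p.
rewrite !in_through !inE => /andP[h ->]; have [? ? ? ?] := pos_bounds p.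
by apply/andP; split; [lia|apply/andP; split=> //; apply/eqP => e; move: h; rewrite e -/b; lia].
Qed.

Local Notation f := (filling U).

Lemma track_path N i : a <= i <= b -> b - i <= N ->
  hg_path N m f (cell i (track i)).1 (cell i (track i)).2 =
  [seq cell j (track j) | j <- iota i (b.+1 - i)].
Proof.
have [? ? ? ?] := ab.
have cE j k : ((cell j k).1, (cell j k).2) = cell j k by [].
elim: N i => [|N IH] i hi hN.
  have -> : i = b by lia.
  by rewrite subSnn /= cE.
have [k1 k2] := track_bounds hi; have kpos := track_pos hi.
have := filling_cell U k1 k2; set k := track i in k1 k2 kpos *.
have [r [c [er ec ->]]] : exists r c,
    [/\ r = R - (i - m) - k, c = minn i m - k & cell i k = (r, c)] by exists (cell i k).1, (cell i k).2.
move=> /= fE; rewrite fE.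
have [ib|ib] := eqVneq i b.
  have k0 : k = 0 by rewrite /k ib track_last.
  have -> : (1 < r) && (f r.-1 c == shape U i k) = false.
    apply/negP => /andP[r1 /eqP e]; have := shape_last; rewrite -ib -k0 -e.
    have b1 : k < minn i.+1 m by rewrite k0; lia.
    have b2 : k < R - (i.+1 - m) by lia.
    by rewrite -(filling_cell U b1 b2) (_ : cell i.+1 k = (r.-1, c)) ?ltnn // /cell; congr pair; lia.
  have -> : c < m = false by lia.
  rewrite ib subSnn /=; congr cons; rewrite -ib -/k /cell; congr pair; lia.
have -> : b.+1 - i = (b.+1 - i.+1).+1 by lia.
rewrite /= -/k; congr cons; first by rewrite /cell er ec.
have hi1 : a <= i.+1 <= b by lia.
have hN1 : b - i.+1 <= N by lia.
have IH1 := IH _ hi1 hN1.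
case: (boolP (i < m)) => im.
  have tE := track_up (proj1 (andP hi)) im; rewrite -/k in tE.
  have -> : (1 < r) && (f r.-1 c == shape U i k) = (shape U i.+1 k.+1 == shape U i k).
    have [r1|r1] /= := ltnP 1 r.
      have b1 : k.+1 < minn i.+1 m by lia.
      have b2 : k.+1 < R - (i.+1 - m) by lia.
      by rewrite -(filling_cell U b1 b2) /cell /=; congr (f _ _ == _); lia.
    (* In row 1 there is no cell above: the corresponding shape entry is 0, while the current one is
       positive, so both tests fail. *)
    by rewrite shape_eq0b; lia.
  case: ifP tE => _ tE.
    by rewrite -IH1 tE addn1 /cell /=; congr hg_path; lia.
  have -> : c < m by lia.
  by rewrite -IH1 tE addn0 /cell /=; congr hg_path; lia.
have mi : m <= i by lia.
have ib' : i < b by lia.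
have tE := track_down mi ib'; rewrite -/k in tE.
have -> : (1 < r) && (f r.-1 c == shape U i k) = (shape U i.+1 k == shape U i k).
  have [r1|r1] /= := ltnP 1 r.
    have b1 : k < minn i.+1 m by lia.
    have b2 : k < R - (i.+1 - m) by lia.
    by rewrite -(filling_cell U b1 b2) /cell /=; congr (f _ _ == _); lia.
  by rewrite shape_eq0b; lia.
case: ifP tE => _ tE.
  by rewrite -IH1 /cell /=; congr hg_path; lia.
have -> : c < m by lia.
by rewrite -IH1 /cell /=; congr hg_path; lia.
Qed.

Let R0 : 0 < R. Proof. by rewrite /R; lia. Qed.
Let m0 : 0 < m. Proof. by lia. Qed.

Lemma filling_first_col : exists cs, first_col R m f = a :: cs.
Proof.
have [? ? ? ?] := ab; apply: (first_colP R0 m0); first by lia.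
  exists R; first by lia.
  have h : a <= a <= b by lia.
  have [k1 k2] := track_bounds h; have := track_pos h.
  rewrite track_first in k1 k2 *; rewrite -(filling_cell U k1 k2) lt0n.
  by rewrite (_ : cell a 0 = (R, a)) // /cell; congr pair; lia.
move=> r c hr hc; rewrite /filling (shape_eq0a a_min) //; lia.
Qed.

Lemma filling_zigzag : hg_zigzag R m f = [seq cell j (track j) | j <- iota a (b.+1 - a)].
Proof.
have [? ? ? ?] := ab; have [cs fc] := filling_first_col.
rewrite (zigzagE R0 m0 (filling_rpp U) fc) -(track_path (N := R + m)); try by rewrite /R; lia.
by congr hg_path; rewrite track_first /cell /=; lia.
Qed.

Lemma filling_hook : hook n R m f = pos x.
Proof.
have [? ? ? ?] := ab; have [cs fc] := filling_first_col.
rewrite /hook fc /= filling_zigzag.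
have -> : b.+1 - a = (b - a) + 1 by lia.
rewrite iotaD map_cat last_cat /= (_ : a + (b - a) = b); last by lia.
rewrite track_last /cell /= [pos x]surjective_pairing; congr pair; rewrite -/b /R; lia.
Qed.

Lemma filling_peel : eq_rect R m (peel R m f) (filling U').
Proof.
have [? ? ? ?] := ab; move=> r c /andP[/= hr hc].
rewrite /peel /filling; set i := R + c - r; set k := minn _ _.
rewrite shape_remove; suff -> : ((r, c) \in hg_zigzag R m f) = (a <= i <= b) && (k == track i).
  by rewrite addnK.
rewrite filling_zigzag -(cellK hr hc) -/i -/k.
have [h1 h2] : k < minn i m /\ k < R - (i - m) by rewrite /k /i; lia.
apply/mapP/andP => [[j]|[hi /eqP ek]]; last by exists i; rewrite ?ek // mem_iota; lia.
rewrite mem_iota => hj; have hj' : a <= j <= b by lia.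
have [h3 h4] := track_bounds hj'.
by move=> /(cell_inj h1 h2 h3 h4) [-> ->].
Qed.

End Removal.

Let R0 : 0 < R. Proof. by rewrite /R; lia. Qed.
Let m0 : 0 < m. Proof. by lia. Qed.

Lemma filling0 r c : filling set0 r c = 0.
Proof. by rewrite /filling /shape setI0 gk_part_eq0 // width_le0. Qed.

Lemma exists_al_min U p : p \in U -> exists2 x, x \in U & forall q, q \in U -> q != x -> al x < al q.
Proof.
move=> pU; case: (arg_minnP al pU) => x xU mx; exists x => // q qU nq.
by rewrite ltn_neqAle mx // andbT eq_sym (inj_eq al_inj).
Qed.

Lemma hginv_filling N U : #|U| < N ->
  perm_eq (hginv N n R m (filling U)) [seq pos p | p <- enum U].
Proof.
elim: N U => // N IH U cU; rewrite hginvS.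
have [U0|/set0Pn[p pU]] := eqVneq U set0.
  rewrite U0 enum_set0; case e : (first_col _ _ _) => [|j0 js] //.
  by have [_ [r _]] := first_col_head R0 m0 e; rewrite filling0.
have [x xU mx] := exists_al_min pU.
have [cs fc] := filling_first_col xU mx; rewrite fc (filling_hook xU mx).
rewrite (eq_hginv n R0 m0 N (filling_peel xU mx)).
have cU' : #|U :\ x| < N by move: cU; rewrite (cardsD1 x) xU.
have e : perm_eq (x :: enum (U :\ x)) (enum U).
  apply: uniq_perm; rewrite ?enum_uniq //= ?mem_enum ?inE ?eqxx ?enum_uniq //.
  by move=> q; rewrite inE !mem_enum !inE; case: eqP => // ->.
by apply: perm_trans (perm_map pos e); rewrite /= perm_cons IH.
Qed.

(** This shows that the fuel of [hginv_full] suffices to extract every summand. *)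
Lemma card_le_total U : #|U| <= Defs.total R m (filling U).
Proof.
have [N] := ubnP #|U|; elim: N U => // N IH U cU.
have [->|/set0Pn[p pU]] := eqVneq U set0; first by rewrite cards0.
have [x xU mx] := exists_al_min pU.
have [cs fc] := filling_first_col xU mx.
have lt := total_peel R0 m0 (filling_rpp U) fc.
rewrite (eq_total R0 m0 (filling_peel xU mx)) in lt.
have cE : #|U| = #|U :\ x|.+1 by rewrite (cardsD1 x) xU.
by rewrite cE; apply: leq_ltn_trans lt; apply: IH; rewrite -ltnS -cE.
Qed.

Theorem hginv_full_filling U :
  perm_eq (hginv_full n R m (filling U)) [seq pos p | p <- enum U].
Proof. by apply: hginv_filling; rewrite ltnS card_le_total. Qed.

End Shapes.

(** * The two orders on the summands, and the filling computed by HG *)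

Section Positions.
Local Open Scope nat_scope.
Variables (n m : nat) (M : seq (nat * nat)).
Hypotheses (m_n : 1 <= m <= n) (M_inP : all (inP n m) M).
Local Notation D := (size M).

Definition supp (j : 'I_D) := nth (0, 0) M j.

(* Lexicographic codes of (a, b, j) and (b, a, j); breaking ties by the index
   makes equal intervals comparable. *)
Definition lexa (j : 'I_D) := ((supp j).1 * n.+1 + (supp j).2) * D.+1 + j.
Definition lexb (j : 'I_D) := ((supp j).2 * n.+1 + (supp j).1) * D.+1 + j.

Lemma supp_inP j : inP n m (supp j).
Proof. by have /allP := M_inP; apply; exact: mem_nth. Qed.

Lemma supp_bounds j : [/\ 1 <= (supp j).1, (supp j).1 <= m, m <= (supp j).2 & (supp j).2 <= n].
Proof. by have := supp_inP j; rewrite /inP => /andP[/andP[-> ->] /andP[-> ->]]. Qed.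

Let ord_small (j : 'I_D) : j < D.+1. Proof. exact: leqW. Qed.
Let supp2_small j : (supp j).2 < n.+1. Proof. by have [] := supp_bounds j. Qed.
Let supp1_small j : (supp j).1 < n.+1. Proof. by have [] := supp_bounds j; lia. Qed.

Lemma lexaE p q : (lexa p < lexa q) =
  [|| (supp p).1 < (supp q).1, ((supp p).1 == (supp q).1) && ((supp p).2 < (supp q).2)
    | [&& (supp p).1 == (supp q).1, (supp p).2 == (supp q).2 & p < q]].
Proof. by rewrite /lexa ltn_pair_code // ltn_pair_code // eqn_pair_code // -!orbA -!andbA. Qed.

Lemma lexbE p q : (lexb p < lexb q) =
  [|| (supp p).2 < (supp q).2, ((supp p).2 == (supp q).2) && ((supp p).1 < (supp q).1)
    | [&& (supp p).2 == (supp q).2, (supp p).1 == (supp q).1 & p < q]].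
Proof. by rewrite /lexb ltn_pair_code // ltn_pair_code // eqn_pair_code // -!orbA -!andbA. Qed.

Lemma lexa_inj : injective lexa.
Proof.
move=> p q /eqP; rewrite /lexa eqn_pair_code // => /andP[_ /eqP e]; exact: val_inj.
Qed.

Lemma lexb_inj : injective lexb.
Proof.
move=> p q /eqP; rewrite /lexb eqn_pair_code // => /andP[_ /eqP e]; exact: val_inj.
Qed.

Lemma lexa_mono p q : (supp p).1 < (supp q).1 -> lexa p < lexa q.
Proof. by rewrite lexaE => ->. Qed.

Lemma lexb_mono p q : (supp p).2 < (supp q).2 -> lexb p < lexb q.
Proof. by rewrite lexbE => ->. Qed.

Lemma lexab1 p q : (supp p).1 = (supp q).1 -> (lexa p < lexa q) = (lexb p < lexb q).
Proof. by move=> e; rewrite lexaE lexbE e eqxx ltnn /= andbF /=. Qed.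

Lemma lexab2 p q : (supp p).2 = (supp q).2 -> (lexa p < lexa q) = (lexb p < lexb q).
Proof. by move=> e; rewrite lexaE lexbE e eqxx ltnn /= andbF /=. Qed.

Lemma map_supp : [seq supp p | p <- enum [set: 'I_D]] = M.
Proof.
rewrite enum_setT -enumT /supp (map_comp (nth (0, 0) M) val) val_enum_ord.
exact: mkseq_nth.
Qed.

Variable K : fieldType.
Hypothesis nonroot : forall P : {poly K}, P != 0%R -> exists t, ~~ root P t.

(** The filling itself passes the test in [HG], its entries being at most [size M]; any filling
    picked has the same image under the injective inverse algorithm. *)
Lemma HG_filling r c : 1 <= r <= n.+1 - m -> 1 <= c <= m ->
  HG n m M r c = filling n m supp lexa lexb setT r c.
Proof.
move=> hr hc; set R := n.+1 - m in hr *; set f := filling _ _ _ _ _ _.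
have R0 : 0 < R by rewrite /R; lia.
have m0 : 0 < m by lia.
have frpp : rpp_b R m f.
  exact: filling_rpp lexa_inj lexb_inj m_n supp_inP lexa_mono lexb_mono lexab1 lexab2 setT.
have fM : perm_eq (hginv_full n R m f) M.
  rewrite -[M in perm_eq _ M]map_supp.
  exact: hginv_full_filling nonroot lexa_inj lexb_inj m_n supp_inP lexa_mono lexb_mono lexab1 lexab2 setT.
have ofF_E (F : {ffun 'I_R * 'I_m -> 'I_D.+1}) r' c' (hr' : r'.-1 < R) (hc' : c'.-1 < m) :
    ofF F r' c' = F (Ordinal hr', Ordinal hc').
  by rewrite /ofF !insubT.
rewrite /HG -/R; case: pickP => [F /andP[Frpp FM]|none].
  have Rn : R <= n.+1 by rewrite /R; lia.
  have FfM : perm_eq (hginv_full n R m (ofF F)) (hginv_full n R m f).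
    by apply: perm_trans FM _; rewrite perm_sym.
  by apply: (hginv_full_inj R0 m0 Rn Frpp frpp FfM); rewrite /in_rect /=; lia.
pose F : {ffun 'I_R * 'I_m -> 'I_D.+1} := [ffun x : 'I_R * 'I_m => inord (f x.1.+1 x.2.+1)].
have e : eq_rect R m (ofF F) f.
  move=> r' c' /andP[/= hr' hc'].
  have h1 : r'.-1 < R by lia.
  have h2 : c'.-1 < m by lia.
  rewrite (ofF_E F _ _ h1 h2) ffunE /= !prednK; try by lia.
  rewrite inordK // ltnS /f /filling /shape.
  apply: leq_trans (card_le_D (through supp (R + c' - r') :&: setT)).
  apply: leq_trans (gk_le_card lexa lexb (minn (R - r') (m - c')).+1 _).
  by rewrite gkE leq_addl.
by have := none F; rewrite (eq_rpp R0 m0 e) frpp (eq_hginv_full n R0 m0 e) fM.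
Qed.

End Positions.

(** * Jordan types of nilpotent matrices *)

Section Jordan.
Variable K : fieldType.
Implicit Types (d h l : nat) (lam : seq nat).

(** The h-th power of the nilpotent Jordan block of size l. *)
Definition shift_mx h l : 'M[K]_l := \matrix_(p, q) ((q : nat) == p + h)%N%:R.

Lemma mul_shift_mx h l : shift_mx h l *m shift_mx 1 l = shift_mx h.+1 l.
Proof.
apply/matrixP => p q; rewrite !mxE.
have [lt|ge] := ltnP (p + h) l.
  rewrite (bigD1 (Ordinal lt)) //= !mxE eqxx mul1r big1 ?addr0; last first.
    by move=> r nr; rewrite !mxE; case: eqP => [e|]; rewrite ?mul0r //; case/eqP: nr; apply: val_inj.
  by rewrite addn1 addnS.
rewrite big1; last first.
  by move=> r _; rewrite !mxE; case: eqP => [e|]; rewrite ?mul0r //; have := ltn_ord r; lia.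
by case: eqP => // e; have := ltn_ord q; lia.
Qed.

Lemma rank_shift_mx h l : \rank (shift_mx h l) = (l - h)%N.
Proof.
pose S := [set p : 'I_l | (p + h < l)%N].
have cS : #|S| = (l - h)%N.
  rewrite -sum1dep_card (eq_bigl (fun p : 'I_l => (p < l - h)%N)); last by move=> p; lia.
  by rewrite -(big_ord_widen l (fun=> 1%N)) ?leq_subr // sum1_card card_ord.
rewrite -cS -(mxrank_proj K S); apply/eqP; rewrite eqn_leq; apply/andP; split.
  have -> : shift_mx h l = proj_mx K S *m shift_mx h l; last exact: mxrankM_maxl.
  apply/matrixP => p q; rewrite mul_proj_mx !mxE inE.
  case: ltnP => pl; rewrite ?mul1r ?mul0r //.
  by case: eqP => // e; have := ltn_ord q; lia.
have -> : proj_mx K S = shift_mx h l *m (shift_mx h l)^T; last exact: mxrankM_maxl.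
apply/matrixP => p p'; rewrite proj_mxE mxE inE.
have [lt|ge] := ltnP (p + h) l.
  rewrite (bigD1 (Ordinal lt)) //= !mxE eqxx mul1r big1 ?addr0; last first.
    by move=> r nr; rewrite !mxE; case: eqP => [e|]; rewrite ?mul0r //; case/eqP: nr; apply: val_inj.
  by rewrite /= eqn_add2r andbT.
rewrite andbF big1 // => r _; rewrite !mxE; case: eqP => [e|]; rewrite ?mul0r //.
by have := ltn_ord r; lia.
Qed.

Lemma jmx1 l : jmx K l [:: l] = shift_mx 1 l.
Proof.
apply/matrixP => p q; rewrite !mxE /psums /= addn0 inE addn1.
by case: eqP => //= e; have := ltn_ord q; case: eqP => //; lia.
Qed.

Lemma psums_cons l lam : psums (l :: lam) = l :: [seq (l + x)%N | x <- psums lam].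
Proof.
rewrite /psums /= take0 addn0; congr cons.
rewrite -[X in iota X _](addn1 1) iotaDl -!map_comp; apply: eq_map => j /=.
by [].
Qed.

Lemma jmx_cons l lam : jmx K (sumn (l :: lam)) (l :: lam) =
  block_mx (shift_mx 1 l) 0 0 (jmx K (sumn lam) lam).
Proof.
rewrite -jmx1; apply/matrixP => p q; rewrite [LHS]mxE psums_cons inE.
case: (split_ordP p) => p' ->; case: (split_ordP q) => q' ->.
- rewrite block_mxEul !mxE psums_cons /= !inE; congr ((_ && ~~ _)%:R).
  apply: orb_idr => /mapP[x _ e]; have := ltn_ord p'; lia.
- rewrite block_mxEur !mxE /=; case: eqP => //= e.
  by have -> : p'.+1 == l by have := ltn_ord p'; lia.
- rewrite block_mxEdl !mxE /=; case: eqP => //= e.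
  by have := ltn_ord q'; lia.
rewrite block_mxEdr !mxE /= -addnS eqn_add2l mem_map; last exact: addnI.
by have -> : (l + p'.+1 == l)%N = false by lia.
Qed.

Lemma rank_jmxX lam h : \rank (jmx K (sumn lam) lam ^+ h) = sumn [seq (x - h)%N | x <- lam].
Proof.
have jmxX l lam' : jmx K (sumn (l :: lam')) (l :: lam') ^+ h =
    block_mx (shift_mx 1 l ^+ h) 0 0 (jmx K (sumn lam') lam' ^+ h).
  rewrite jmx_cons; elim: h => [|h IH]; first by rewrite !expr0; exact: scalar_mx_block.
  by rewrite !exprSr -!mulmxE IH mulmx_block !(mul0mx, mulmx0, addr0, add0r).
elim: lam => [|l lam IH]; first by apply/eqP; rewrite -leqn0 rank_leq_row.
rewrite jmxX rank_diag_block_mx IH /=; congr (_ + _)%N.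
rewrite -rank_shift_mx; congr (\rank _).
elim: h {jmxX IH} => [|h IH].
  by rewrite expr0; apply/matrixP => p q; rewrite !mxE addn0 eq_sym.
by rewrite exprSr -mulmxE IH mul_shift_mx.
Qed.

Lemma jtype_rank d (A : 'M[K]_d) lam h : jtype A lam ->
  \rank (A ^+ h) = sumn [seq (x - h)%N | x <- lam].
Proof.
case=> _ e [P uP ->]; subst d; rewrite -rank_jmxX.
have -> : (invmx P *m jmx K (sumn lam) lam *m P) ^+ h = invmx P *m jmx K (sumn lam) lam ^+ h *m P.
  elim: h => [|h IH]; first by rewrite !expr0 mulmx1 mulVmx.
  by rewrite !exprSr -!mulmxE IH -!mulmxA (mulmxA P) mulmxV // mul1mx.
by rewrite mxrankMfree ?row_free_unit // -mxrank_tr trmx_mul mxrankMfree ?mxrank_tr //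
   row_free_unit unitmx_tr unitmx_inv.
Qed.

(* A vector [v] and a functional [phi] with [v A^N phi <> 0], where [N.+1] is
   the nilpotency index: the common kernel of the [A^s phi] is an invariant
   complement of the cyclic subspace generated by [v]. *)
Lemma cyclic_summand d (A : 'M[K]_d) N (i j : 'I_d) :
  A ^+ N.+1 = 0 -> (A ^+ N) i j != 0 ->
  exists (V : 'M[K]_(N.+1, d)) (B : 'M[K]_(d - N.+1, d)) (A' : 'M[K]_(d - N.+1)),
  [/\ (N.+1 <= d)%N, V *m A = shift_mx 1 N.+1 *m V, B *m A = A' *m B, row_free B
    & forall x y, x *m V + y *m B = 0 -> x = 0 /\ y = 0 :> 'rV_(d - N.+1)].
Proof.
move=> AN nz.
have A0 h : (N < h)%N -> A ^+ h = 0.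
  by move=> /subnK <-; rewrite exprD AN mulr0.
pose V : 'M[K]_(N.+1, d) := \matrix_(t, q) (A ^+ t) i q.
pose Phi : 'M[K]_(d, N.+1) := \matrix_(p, s) (A ^+ s) p j.
have VPhi t s : (V *m Phi) t s = (A ^+ (t + s)) i j.
  by rewrite exprD -mulmxE !mxE; apply: eq_bigr => r _; rewrite !mxE.
(* Entry (t, s) is that of A ^+ (t + s): zero beyond the antidiagonal t + s = N and nonzero on
   it. *)
have uVPhi : row_free (V *m Phi).
  apply: inj_row_free => x xVP; apply/rowP => t; rewrite [RHS]mxE.
  have [u] := ubnP t; elim: u t => // u IH t tu.
  have tN : (N - t < N.+1)%N by lia.
  have := congr1 (fun w : 'rV_N.+1 => w 0 (Ordinal tN)) xVP.
  rewrite mxE [RHS]mxE (bigD1 t) //= big1 ?addr0; last first.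
    move=> r nr; rewrite VPhi /=; have [rt|tr] := ltnP r t.
      by rewrite IH ?mul0r //; lia.
    rewrite A0 ?mxE ?mulr0 //; move: nr; rewrite -val_eqE /=; have := ltn_ord t; lia.
  rewrite VPhi /= (_ : (t + (N - t) = N)%N); last by have := ltn_ord t; lia.
  by move/eqP; rewrite mulf_eq0 (negbTE nz) orbF => /eqP.
have rPhi : \rank Phi = N.+1.
  apply/eqP; rewrite eqn_leq rank_leq_col -[X in (X <= _)%N](eqP uVPhi).
  exact: mxrankM_maxr.
have Nd : (N.+1 <= d)%N by rewrite -rPhi rank_leq_row.
have rk : \rank (kermx Phi) = (d - N.+1)%N by rewrite mxrank_ker rPhi.
have [B [Bfree BPhi Bker]] : exists B : 'M[K]_(d - N.+1, d),
    [/\ row_free B, B *m Phi = 0 & forall n' (X : 'M_(n', d)), X *m Phi = 0 -> (X <= B)%MS].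
  rewrite -rk; exists (row_base (kermx Phi)); split; first exact: row_base_free.
    by apply/eqP; rewrite -sub_kermx eq_row_base.
  by move=> n' X XP; rewrite eq_row_base; apply/sub_kermxP.
have APhi : A *m Phi = Phi *m (shift_mx 1 N.+1)^T.
  apply/matrixP => p s; rewrite mxE.
  have -> : \sum_r A p r * Phi r s = (A ^+ s.+1) p j.
    by rewrite exprS -mulmxE mxE; apply: eq_bigr => r _; rewrite !mxE.
  rewrite mxE; have [sN|Ns] := ltnP s.+1 N.+1.
    rewrite (bigD1 (Ordinal sN)) //= !mxE /= addn1 eqxx mulr1 big1 ?addr0 //.
    by move=> r nr; rewrite !mxE addn1; case: eqP => [e|]; rewrite ?mulr0 //; case/eqP: nr; apply: val_inj.
  rewrite A0 // mxE big1 // => r _; rewrite !mxE addn1; case: eqP => [e|]; rewrite ?mulr0 //.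
  by have := ltn_ord r; lia.
have /submxP[A' BA] : (B *m A <= B)%MS.
  by apply: Bker; rewrite -mulmxA APhi mulmxA BPhi mul0mx.
exists V, B, A'; split=> //.
  apply/matrixP => t q; rewrite mxE.
  have -> : \sum_r V t r * A r q = (A ^+ t.+1) i q.
    by rewrite exprSr -mulmxE mxE; apply: eq_bigr => r _; rewrite !mxE.
  rewrite mxE; have [tN|Nt] := ltnP t.+1 N.+1.
    rewrite (bigD1 (Ordinal tN)) //= !mxE /= addn1 eqxx mul1r big1 ?addr0 //.
    by move=> r nr; rewrite !mxE addn1; case: eqP => [e|]; rewrite ?mul0r //; case/eqP: nr; apply: val_inj.
  rewrite A0 // mxE big1 // => r _; rewrite !mxE addn1; case: eqP => [e|]; rewrite ?mul0r //.
  by have := ltn_ord r; lia.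
move=> x y e.
have x0 : x = 0.
  apply: (row_free_inj uVPhi); rewrite mul0mx mulmxA.
  have := congr1 (fun w => w *m Phi) e.
  by rewrite mulmxDl mul0mx -[y *m B *m Phi]mulmxA BPhi mulmx0 addr0.
split=> //; apply: (row_free_inj Bfree); rewrite mul0mx.
by move: e; rewrite x0 mul0mx add0r.
Qed.

Lemma jordan_basis d (A : 'M[K]_d) n : A ^+ n = 0 -> exists lam, [/\ is_partition lam, sumn lam = d &
  exists2 P : 'M[K]_(sumn lam, d), row_free P & P *m A = jmx K (sumn lam) lam *m P].
Proof.
have [e] := ubnP d; elim: e d A n => // e IH d A n de An.
have [d0|dpos] := posnP d.
  subst d; exists [::]; split=> //; exists 1%:M; first by rewrite row_free_unit unitmx1.
  by apply/matrixP => -[].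
have [N [AN nz]] : exists N, A ^+ N.+1 = 0 /\ A ^+ N != 0.
  have ex : exists n, A ^+ n == 0 by exists n; rewrite An.
  case: (ex_minnP ex) => -[|N] /eqP AN mN.
    have := congr1 mxrank AN; rewrite expr0 mxrank1 mxrank0; lia.
  by exists N; split=> //; apply/negP => /mN; rewrite ltnn.
have [i [j nij]] : exists i j, (A ^+ N) i j != 0.
  have : ~~ [forall i, forall j, (A ^+ N) i j == 0].
    apply: contra nz => /forallP z; apply/eqP/matrixP => i j; rewrite [RHS]mxE.
    exact/eqP/(forallP (z i)).
  by rewrite negb_forall => /existsP[i]; rewrite negb_forall => /existsP[j]; exists i, j.
have [V [B [A' [Nd VA BA Bfree ind]]]] := cyclic_summand AN nij.
have A'X h : A' ^+ h *m B = B *m A ^+ h.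
  elim: h => [|h IHh]; first by rewrite !expr0 mul1mx mulmx1.
  by rewrite !exprSr -!mulmxE -mulmxA -BA mulmxA IHh mulmxA.
have A'N : A' ^+ N.+1 = 0.
  by apply: (row_free_inj Bfree); rewrite mul0mx A'X AN mulmx0.
have [lam [plam slam [P' fP' P'A]]] := IH _ A' N.+1 ltac:(lia) A'N.
have P'X h : P' *m A' ^+ h = jmx K (sumn lam) lam ^+ h *m P'.
  elim: h => [|h IHh]; first by rewrite !expr0 mul1mx mulmx1.
  by rewrite !exprSr -!mulmxE mulmxA IHh -mulmxA P'A mulmxA.
(* The split-off block has the size of the nilpotency index, so no other block is larger and the
   list stays sorted. *)
have lamN x : x \in lam -> (x <= N.+1)%N.
  have : \rank (jmx K (sumn lam) lam ^+ N.+1) = 0%N.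
    by rewrite -(mxrankMfree _ fP') -P'X A'N mulmx0 mxrank0.
  rewrite rank_jmxX; elim: (lam) => //= y s IHs /eqP; rewrite addn_eq0 => /andP[h1 /eqP h2].
  by rewrite inE => /predU1P[->|]; [lia|exact: IHs].
exists (N.+1 :: lam); split.
- move: plam; rewrite /is_partition /= => /andP[sl ->]; rewrite andbT.
  by case: lam sl lamN {slam P' fP' P'A P'X} => //= y s -> h; rewrite andbT /geq /= h ?mem_head.
- by rewrite /= slam; lia.
exists (col_mx V (P' *m B)).
  apply: inj_row_free => w; rewrite -[w]hsubmxK mul_row_col mulmxA => /ind[-> y0].
  by rewrite (row_free_inj fP' (etrans y0 (esym (mul0mx _ _)))) row_mx0.
by rewrite jmx_cons mul_block_col !mul0mx addr0 add0r mul_col_mx VA -mulmxA BA !mulmxA P'A.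
Qed.

Lemma jordan_form d (A : 'M[K]_d) n : A ^+ n = 0 -> exists lam, jtype A lam.
Proof.
move=> An; have [lam [plam slam [P fP PA]]] := jordan_basis An.
exists lam; split=> //; subst d; have uP : P \in unitmx by rewrite -row_free_unit.
by exists P => //; rewrite -mulmxA -PA mulmxA mulVmx // mul1mx.
Qed.

End Jordan.

(** Successive differences in h count the entries above h, that is, give the conjugate partition. *)
Lemma noninc_sum_inj (u v : nat -> nat) E :
  (forall i j, (i <= j)%N -> (u j <= u i)%N) -> (forall i j, (i <= j)%N -> (v j <= v i)%N) ->
  (forall j, (E <= j)%N -> u j = 0%N) -> (forall j, (E <= j)%N -> v j = 0%N) ->
  (forall h, (\sum_(j < E) (u j - h))%N = (\sum_(j < E) (v j - h))%N) -> u =1 v.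
Proof.
have step (w : nat -> nat) h : (\sum_(j < E) (w j - h) =
    \sum_(j < E) (w j - h.+1) + \sum_(j < E) (h < w j))%N.
  by rewrite -big_split /=; apply: eq_bigr => i _; lia.
have cnt (w : nat -> nat) r : (forall i j, (i <= j)%N -> (w j <= w i)%N) -> (r < E)%N ->
    forall h, (h < w r)%N = (r < \sum_(j < E) (h < w j)%N)%N.
  move=> dw rE h; rewrite -(big_mkord xpredT (fun j => (h < w j) : nat)).
  rewrite (big_cat_nat (n := r.+1)) //=.
  apply/idP/idP => hr.
    rewrite -addn1 addnC; apply: leq_trans (leq_addr _ _).
    rewrite big_nat (eq_bigr (fun=> 1%N)); last by move=> j /andP[_ jr]; have := dw j r; lia.
    by rewrite -big_nat sum_nat_const_nat subn0 muln1 add1n.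
  rewrite ltnNge; apply/negP => wr; move: hr; rewrite ltnNge => /negP; apply.
  rewrite [X in (_ + X)%N]big_nat [X in (_ + X)%N]big1 ?addn0; last first.
    by move=> j /andP[jr _]; have := dw r j; lia.
  rewrite big_nat_recr //= ltnNge wr addn0.
  apply: leq_trans (_ : \sum_(0 <= j < r) 1 <= _)%N; last by rewrite sum_nat_const_nat subn0 muln1.
  by apply: leq_sum => j _; case: ltnP.
move=> du dv u0 v0 huv r; have [Er|rE] := leqP E r; first by rewrite u0 // v0.
have e h : (h < u r)%N = (h < v r)%N.
  rewrite !cnt //; congr (_ < _)%N.
  by have := step u h; have := step v h; rewrite !huv; lia.
by have := e (u r); have := e (v r); rewrite !ltnn; lia.
Qed.

Lemma partition_nth_noninc lam i j : is_partition lam -> (i <= j)%N -> (nth 0%N lam j <= nth 0%N lam i)%N.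
Proof.
move=> /andP[sl _] ij; have [jl|lj] := ltnP j (size lam); last by rewrite nth_default.
have gt : transitive geq by move=> ? ? ? h1 h2; exact: leq_trans h2 h1.
have gr : reflexive geq by move=> ?; exact: leqnn.
exact: (sorted_leq_nth gt gr 0%N sl) (leq_ltn_trans ij jl) jl ij.
Qed.

Lemma partition_sumE lam h E : (size lam <= E)%N ->
  sumn [seq (x - h)%N | x <- lam] = (\sum_(j < E) (nth 0%N lam j - h))%N.
Proof.
move=> sE; rewrite sumnE big_map (big_nth 0%N) -(big_mkord xpredT (fun j => (nth 0 lam j - h)%N)).
rewrite [RHS](big_cat_nat (n := size lam)) //= [X in (_ + X)%N]big_nat [X in (_ + X)%N]big1 ?addn0 //.
by move=> j /andP[h1 _]; rewrite nth_default.
Qed.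

Lemma partition_sum_nth lam (u : nat -> nat) D : is_partition lam ->
  (forall i j, (i <= j)%N -> (u j <= u i)%N) -> (forall j, (D <= j)%N -> u j = 0%N) ->
  (forall h, sumn [seq (x - h)%N | x <- lam] = (\sum_(j < D) (u j - h))%N) ->
  nth 0%N lam =1 u.
Proof.
move=> plam du u0 hs; pose E := (size lam + D)%N.
apply: (@noninc_sum_inj _ _ E) => //.
- by move=> i j; exact: partition_nth_noninc.
- by move=> j Ej; rewrite nth_default // (leq_trans _ Ej) // leq_addr.
- by move=> j Ej; rewrite u0 // (leq_trans _ Ej) // leq_addl.
move=> h; rewrite -(@partition_sumE lam h E) ?leq_addr // hs.
rewrite -!(big_mkord xpredT (fun j => (u j - h)%N)) [RHS](big_cat_nat (n := D)) ?leq_addl //=.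
rewrite [X in (_ + X)%N]big_nat [X in (_ + X)%N]big1 ?addn0 //.
by move=> j /andP[h1 _]; rewrite u0.
Qed.

Lemma partition_eq lam mu : is_partition lam -> is_partition mu ->
  nth 0%N lam =1 nth 0%N mu -> lam = mu.
Proof.
have le a b : is_partition a -> nth 0%N a =1 nth 0%N b -> (size a <= size b)%N.
  move=> /andP[_ /allP pa] e; rewrite leqNgt; apply/negP => lt.
  by have := pa _ (mem_nth 0%N lt); rewrite e nth_default.
move=> pl pm e; apply: (@eq_from_nth _ 0%N); last by move=> j _; exact: e.
by apply/eqP; rewrite eqn_leq !le.
Qed.

(** * Principal submatrices through selection matrices *)

Section Selection.
Variables (R : comNzRingType) (D e : nat) (g : 'I_e -> 'I_D) (S : {set 'I_D}).
Hypotheses (g_inj : injective g) (g_im : forall p, (p \in S) = [exists i, g i == p]).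

Definition sel : 'M[R]_(e, D) := \matrix_(i, p) (g i == p)%:R.

Lemma sel_in i : g i \in S. Proof. by rewrite g_im; apply/existsP; exists i. Qed.

Lemma mul_sel n (A : 'M[R]_(D, n)) i q : (sel *m A) i q = A (g i) q.
Proof.
rewrite mxE (bigD1 (g i)) //= mxE eqxx mul1r big1 ?addr0 // => p np.
by rewrite mxE eq_sym (negbTE np) mul0r.
Qed.

Lemma mul_trsel n (A : 'M[R]_(n, D)) p i : (A *m sel^T) p i = A p (g i).
Proof.
rewrite mxE (bigD1 (g i)) //= !mxE eqxx mulr1 big1 ?addr0 // => q nq.
by rewrite !mxE eq_sym (negbTE nq) mulr0.
Qed.

Lemma selK : sel *m sel^T = 1%:M.
Proof. by apply/matrixP => i j; rewrite mul_sel !mxE (inj_eq g_inj) eq_sym. Qed.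

Lemma trselK : sel^T *m sel = proj_mx R S.
Proof.
apply/matrixP => p q; rewrite proj_mxE mxE g_im.
case: (boolP [exists i, g i == p]) => [/existsP[i /eqP gi]|/existsPn n].
  rewrite (bigD1 i) //= !mxE gi eqxx mul1r big1 ?addr0 ?andbT // => j nj.
  by rewrite !mxE -gi (inj_eq g_inj) (negbTE nj) mul0r.
by rewrite andbF big1 // => i _; rewrite !mxE (negbTE (n i)) mul0r.
Qed.

Lemma sel_proj : sel *m proj_mx R S = sel.
Proof. by rewrite -trselK mulmxA selK mul1mx. Qed.

Definition sub_mx (F : 'M[R]_D) : 'M[R]_e := sel *m F *m sel^T.

Lemma sub_mxE F i j : sub_mx F i j = F (g i) (g j).
Proof. by rewrite mul_trsel mul_sel. Qed.

Lemma proj_trsel : proj_mx R S *m sel^T = sel^T.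
Proof. by rewrite -trselK -mulmxA selK mulmx1. Qed.

Lemma sel_expr_proj F h :
  sel *m (F *m proj_mx R S) ^+ h *m proj_mx R S = sel *m (F *m proj_mx R S) ^+ h.
Proof.
case: h => [|h]; first by rewrite expr0 mulmx1 sel_proj.
by rewrite exprSr -mulmxE -!mulmxA proj_mx_id.
Qed.

Lemma sub_mxX F h : sub_mx F ^+ h = sel *m (F *m proj_mx R S) ^+ h *m sel^T.
Proof.
elim: h => [|h IH]; first by rewrite !expr0 mulmx1 selK.
rewrite exprSr -mulmxE IH /sub_mx !mulmxA -(mulmxA (sel *m _)) trselK sel_expr_proj.
by rewrite exprSr -mulmxE !mulmxA -(mulmxA _ (proj_mx _ _) sel^T) proj_trsel.
Qed.
End Selection.

Section SelectionRank.
Variables (K : fieldType) (D e : nat) (g : 'I_e -> 'I_D) (S : {set 'I_D}).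
Hypotheses (g_inj : injective g) (g_im : forall p, (p \in S) = [exists i, g i == p]).

Lemma rank_sub_mxX (F : 'M[K]_D) h : \rank (sub_mx g F ^+ h) = \rank (corner_pow F S h).
Proof.
have e1 : corner_pow F S h = (sel K g)^T *m sub_mx g F ^+ h *m sel K g.
  rewrite (sub_mxX g_inj g_im) -!mulmxA (trselK K g_inj g_im) mulmxA (trselK K g_inj g_im).
  by rewrite mulmxA corner_pow_projr.
have e2 : sub_mx g F ^+ h = sel K g *m corner_pow F S h *m (sel K g)^T.
  by rewrite (sub_mxX g_inj g_im) /corner_pow mulmxA (sel_proj _ g_inj g_im).
apply/eqP; rewrite eqn_leq; apply/andP; split; [rewrite e2 | rewrite e1];
  exact: leq_trans (mxrankM_maxl _ _) (mxrankM_maxr _ _).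
Qed.
End SelectionRank.

(** * Generic nilpotent endomorphisms *)

Section Endomorphisms.
Variables (K : fieldType) (n m : nat) (M : seq (nat * nat)).
Local Notation D := (size M).
Local Notation supp := (@supp M).
Implicit Types (F T : 'M[K]_D) (i h : nat) (p q : 'I_D).

Lemma idxn_bound i (p : 'I_(Defs.dimv M i)) : (nth 0%N (idxn M i) p < D)%N.
Proof.
have := mem_nth 0%N (ltn_ord p); rewrite /idxn mem_filter mem_iota => /andP[_].
by rewrite add0n.
Qed.

Definition vtx i (p : 'I_(Defs.dimv M i)) : 'I_D := Ordinal (idxn_bound p).

Lemma vtx_inj i : injective (@vtx i).
Proof.
move=> p q [] /eqP; rewrite nth_uniq // ?filter_uniq ?iota_uniq // => /eqP; exact: val_inj.
Qed.

Lemma vtx_im i p : (p \in through supp i) = [exists j, @vtx i j == p].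
Proof.
rewrite inE; apply/idP/existsP => [pi|[j /eqP <-]]; last first.
  have := mem_nth 0%N (ltn_ord j); rewrite /idxn mem_filter => /andP[h _]; exact: h.
have pm : (p : nat) \in idxn M i by rewrite mem_filter mem_iota pi /=.
have hs : (index (p : nat) (idxn M i) < Defs.dimv M i)%N by rewrite /Defs.dimv index_mem.
by exists (Ordinal hs); apply/eqP/val_inj; rewrite /= nth_index.
Qed.

Definition sub_at i F : 'M[K]_(Defs.dimv M i) := sub_mx (@vtx i) F.

Lemma rank_sub_at i F h : \rank (sub_at i F ^+ h) = \rank (corner_pow F (through supp i) h).
Proof. exact: rank_sub_mxX (@vtx_inj i) (@vtx_im i) _ _. Qed.

Lemma arrow_mxE i : arrow_mx K M i = sel K (@vtx i.+1) *m (sel K (@vtx i))^T.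
Proof. by apply/matrixP => p q; rewrite mul_sel !mxE eq_sym -val_eqE. Qed.

(* The matrices of endomorphisms of M in the basis of M_m: a homomorphism
   between interval modules through m is nonzero only if both endpoints grow. *)
Definition monotone_mx F := forall p q, F p q != 0 ->
  ((supp p).1 <= (supp q).1)%N && ((supp p).2 <= (supp q).2)%N.

Lemma monotone_mx0 F p q : monotone_mx F ->
  ~~ (((supp p).1 <= (supp q).1) && ((supp p).2 <= (supp q).2))%N -> F p q = 0.
Proof. by move=> mF; apply: contraNeq; exact: mF. Qed.

Lemma monotone_mxM F T : monotone_mx F -> monotone_mx T -> monotone_mx (F *m T).
Proof.
move=> mF mT p q; rewrite mxE => nz.
have [r] : exists r, F p r * T r q != 0.
  apply/existsP; apply: contraNT nz => /existsPn z.
  by rewrite big1 // => i _; apply/eqP; move: (z i); rewrite negbK.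
rewrite mulf_eq0 negb_or => /andP[/mF h1 /mT h2]; lia.
Qed.

Lemma monotone_mx1 : monotone_mx 1%:M.
Proof. by move=> p q; rewrite mxE; case: (eqVneq p q) => [->|]; rewrite ?leqnn // eqxx. Qed.

Lemma monotone_mxX F h : monotone_mx F -> monotone_mx (F ^+ h).
Proof.
move=> mF; elim: h => [|h IH]; first by rewrite expr0; exact: monotone_mx1.
by rewrite exprS -mulmxE; apply: monotone_mxM.
Qed.

Hypotheses (m_n : (1 <= m <= n)%N) (M_inP : all (inP n m) M).

Let bnd p : [/\ 1 <= (supp p).1, (supp p).1 <= m, m <= (supp p).2 & (supp p).2 <= n]%N.
Proof. exact: supp_bounds. Qed.

Lemma through_m : through supp m = setT.
Proof. by apply/setP => p; rewrite !inE /in_int; have [? ? ? ?] := bnd p; lia. Qed.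

Lemma proj_setT : proj_mx K [set: 'I_D] = 1%:M.
Proof. by apply/matrixP => p q; rewrite proj_mxE !mxE inE andbT. Qed.

(** The summands through i span a stable subspace when i >= m, and index a quotient by a stable
    subspace when i < m. *)
Lemma sub_at_nilp F i N : monotone_mx F -> F ^+ N = 0 -> sub_at i F ^+ N = 0.
Proof.
move=> mF FN; apply/eqP; rewrite -mxrank_eq0 rank_sub_at mxrank_eq0.
have e : corner_pow F [set: 'I_D] N = 0 by rewrite /corner_pow proj_setT mulmx1 mul1mx FN.
have [mi|im] := leqP m i.
  rewrite (corner_pow_up (S := setT)) ?e ?mulmx0 ?subsetT //.
  move=> p q; rewrite !inE /in_int => pi _ qi; apply: monotone_mx0 => //.
  have [? ? ? ?] := bnd p; have [? ? ? ?] := bnd q; lia.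
rewrite (corner_pow_down (S := setT)) ?e ?mul0mx ?subsetT //.
move=> p q; rewrite !inE /in_int => pi _ qi; apply: monotone_mx0 => //.
have [? ? ? ?] := bnd p; have [? ? ? ?] := bnd q; lia.
Qed.

Definition nilpotent_mx F := exists N, F ^+ N = 0.

Lemma sub_at_nend F : monotone_mx F -> nilpotent_mx F -> is_nend n (fun i => sub_at i F).
Proof.
move=> mF [N FN]; split; last by move=> i _; exists N; exact: sub_at_nilp.
move=> i hi; rewrite arrow_mxE /sub_at /sub_mx.
set s' := sel K (@vtx i.+1); set s := sel K (@vtx i).
have -> : s' *m F *m s'^T *m (s' *m s^T) = s' *m (F *m proj_mx K (through supp i.+1)) *m s^T.
  by rewrite -(trselK K (@vtx_inj i.+1) (@vtx_im i.+1)) !mulmxA.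
have -> : s' *m s^T *m (s *m F *m s^T) = s' *m (proj_mx K (through supp i) *m F) *m s^T.
  by rewrite -(trselK K (@vtx_inj i) (@vtx_im i)) !mulmxA.
apply/matrixP => p q; rewrite !mul_trsel !mul_sel mul_mx_proj mul_proj_mx.
have := sel_in (@vtx_im i.+1) p; have := sel_in (@vtx_im i) q.
move: (vtx p) (vtx q) => P Q; rewrite !inE /in_int => hQ hP.
have [->|/mF nz] := eqVneq (F P Q) 0; first by rewrite mul0r mulr0.
have [? ? ? ?] := bnd P; have [? ? ? ?] := bnd Q.
have -> : ((supp Q).1 <= i.+1 <= (supp Q).2)%N by lia.
have -> : ((supp P).1 <= i <= (supp P).2)%N by lia.
by rewrite mul1r mulr1.
Qed.

(** [Phi] pads every f i to the size of M_m, and [rel] is compatibility with the arrows. Propagated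
    from m in both directions, it makes each f i a corner of [F]; read just outside an endpoint,
    where only one of two summands survives, it makes [F] monotone. *)
Lemma nend_sub_at (f : famT K M) : is_nend n f ->
  exists F, [/\ monotone_mx F, nilpotent_mx F & forall i, (1 <= i <= n)%N -> f i = sub_at i F].
Proof.
move=> [fE fN]; pose s i := sel K (@vtx i).
pose Phi i := (s i)^T *m f i *m s i.
pose E i := proj_mx K (through supp i).
have sK i : s i *m (s i)^T = 1%:M by exact: selK (@vtx_inj i).
have tK i : (s i)^T *m s i = E i by exact: trselK (@vtx_inj i) (@vtx_im i).
have EPhi i : E i *m Phi i = Phi i by rewrite /Phi -tK -!mulmxA (mulmxA (s i)) sK mul1mx.
have PhiE i : Phi i *m E i = Phi i by rewrite /Phi -tK -!mulmxA (mulmxA (s i)) sK mul1mx.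
have fPhi i : f i = s i *m Phi i *m (s i)^T.
  by rewrite /Phi !mulmxA sK mul1mx -mulmxA sK mulmx1.
have rel i : (1 <= i < n)%N -> Phi i.+1 *m E i = E i.+1 *m Phi i.
  move=> hi; have := fE i hi; rewrite arrow_mxE -/(s i) -/(s i.+1) => e.
  rewrite /Phi -!tK -!mulmxA; congr (_ *m _).
  by rewrite !mulmxA; congr (_ *m _); rewrite -!mulmxA e !mulmxA.
have Em : E m = 1%:M by rewrite /E through_m proj_setT.
pose F := Phi m.
have up i : (m <= i <= n)%N -> Phi i = E i *m F *m E i.
  move=> /andP[/subnK <-]; elim: (i - m)%N => [|d IH] hn.
    by rewrite add0n Em mulmx1 mul1mx.
  rewrite addSn; set j := (d + m)%N in IH hn *.
  have EE : E j *m E j.+1 = E j.+1.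
    rewrite proj_mxI; congr (proj_mx _ _); apply/setP => p; rewrite !inE /in_int.
    have [? ? ? ?] := bnd p; rewrite /j; lia.
  have EE' : E j.+1 *m E j = E j.+1 by rewrite proj_mxI setIC -proj_mxI.
  rewrite -PhiE -{1}EE mulmxA rel; last by rewrite /j; lia.
  rewrite IH; last by lia.
  by rewrite !mulmxA EE' -!mulmxA EE.
have down d : (d < m)%N -> Phi (m - d)%N = E (m - d)%N *m F *m E (m - d)%N.
  elim: d => [|d IH] hd; first by rewrite subn0 Em mulmx1 mul1mx.
  have e : (m - d = (m - d.+1).+1)%N by lia.
  set j := (m - d.+1)%N in e *; rewrite e in IH.
  have EE : E j *m E j.+1 = E j.
    rewrite proj_mxI; congr (proj_mx _ _); apply/setP => p; rewrite !inE /in_int.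
    have [? ? ? ?] := bnd p; rewrite /j; lia.
  have EE' : E j.+1 *m E j = E j by rewrite proj_mxI setIC -proj_mxI.
  rewrite -EPhi -{1}EE -mulmxA -rel; last by rewrite /j; lia.
  rewrite IH; last by lia.
  by rewrite !mulmxA EE -!mulmxA EE'.
have all i : (1 <= i <= n)%N -> Phi i = E i *m F *m E i.
  move=> hi; have [mi|im] := leqP m i; first by apply: up; rewrite mi; lia.
  by have := @down (m - i)%N; rewrite (_ : (m - (m - i) = i)%N); [apply; lia|lia].
exists F; split.
- move=> p q nz; have [? ? ? ?] := bnd p; have [? ? ? ?] := bnd q.
  have ent i : (1 <= i < n)%N -> Phi i.+1 p q * (q \in through supp i)%:R =
                                (p \in through supp i.+1)%:R * Phi i p q.
    by move=> hi; have := congr1 (fun A : 'M_D => A p q) (rel i hi); rewrite mul_mx_proj mul_proj_mx.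
  have PhiE' i : (1 <= i <= n)%N -> Phi i p q =
      (p \in through supp i)%:R * F p q * (q \in through supp i)%:R.
    by move=> hi; rewrite all // mul_mx_proj mul_proj_mx.
  apply/andP; split; rewrite leqNgt; apply/negP => lt; move: nz.
    have h1 : (1 <= (supp p).1.-1 < n)%N by lia.
    have := ent _ h1; rewrite (PhiE' (supp p).1.-1) ?(PhiE' (supp p).1.-1.+1); try by lia.
    rewrite prednK; last by lia.
    rewrite !inE /in_int.
    have -> : ((supp p).1 <= (supp p).1 <= (supp p).2)%N by lia.
    have -> : ((supp q).1 <= (supp p).1 <= (supp q).2)%N by lia.
    have -> : ((supp q).1 <= (supp p).1.-1 <= (supp q).2)%N by lia.
    have -> : ((supp p).1 <= (supp p).1.-1 <= (supp p).2)%N = false by lia.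
    by rewrite !(mul1r, mulr1, mul0r, mulr0) => ->; rewrite eqxx.
  have h1 : (1 <= (supp q).2 < n)%N by lia.
  have := ent _ h1; rewrite (PhiE' (supp q).2) ?(PhiE' (supp q).2.+1); try by lia.
  rewrite !inE /in_int.
  have -> : ((supp q).1 <= (supp q).2.+1 <= (supp q).2)%N = false by lia.
  have -> : ((supp q).1 <= (supp q).2 <= (supp q).2)%N by lia.
  have -> : ((supp p).1 <= (supp q).2 <= (supp p).2)%N by lia.
  have -> : ((supp p).1 <= (supp q).2.+1 <= (supp p).2)%N by lia.
  by rewrite !(mul1r, mulr1, mul0r, mulr0) => <-; rewrite eqxx.
- have [N fmN] := fN m ltac:(lia); exists N.+1.
  have FX h : F ^+ h *m (s m)^T = (s m)^T *m f m ^+ h.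
    elim: h => [|h IH]; first by rewrite !expr0 mulmx1 mul1mx.
    by rewrite !exprS -!mulmxE -mulmxA IH /F /Phi !mulmxA -(mulmxA _ (s m) (s m)^T) sK mulmx1.
  by rewrite exprSr -mulmxE /F {2}/Phi !mulmxA FX fmN mulmx0 !mul0mx.
move=> i hi; rewrite fPhi all // /sub_at /sub_mx -/(s i) !mulmxA.
have sE : s i *m E i = s i by rewrite -tK mulmxA sK mul1mx.
have Es : E i *m (s i)^T = (s i)^T by rewrite -tK -mulmxA sK mulmx1.
by rewrite sE -mulmxA Es.
Qed.

End Endomorphisms.

(** * Triangularising nilpotent endomorphisms by block diagonal matrices *)

Lemma enum_val_mono D (B : {set 'I_D}) (i j : 'I_#|B|) :
  (i < j)%N -> (enum_val i < enum_val j)%N.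
Proof.
have srt : sorted ltn [seq val p | p <- enum B].
  have tr : transitive (relpre (val : 'I_D -> nat) ltn) by move=> y x z; exact: ltn_trans.
  rewrite sorted_map /enum_mem; apply: (subseq_sorted tr (filter_subseq _ _)).
  by rewrite -sorted_map -enumT val_enum_ord iota_ltn_sorted.
move=> ij; have x0 : 'I_D := enum_val i.
rewrite !(enum_val_nth x0) -!(nth_map x0 0%N val) -?cardE //.
by apply: (sorted_ltn_nth ltn_trans 0%N srt) => //; rewrite inE size_map -cardE.
Qed.

Section Triangular.
Variables (K : fieldType) (n m : nat) (M : seq (nat * nat)).
Hypotheses (m_n : (1 <= m <= n)%N) (M_inP : all (inP n m) M).
Local Notation D := (size M).
Local Notation supp := (@supp M).
Implicit Types (F T : 'M[K]_D) (h : nat) (p q : 'I_D).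

Definition block_diag_mx T := forall p q, T p q != 0 -> supp p = supp q.

Lemma block_diag_monotone T : block_diag_mx T -> monotone_mx T.
Proof. by move=> bT p q /bT ->; rewrite !leqnn. Qed.

Definition same_supp p : {set 'I_D} := [set q | supp q == supp p].

(** A monotone path between two equal intervals only visits copies of that interval, so the diagonal
    block inherits nilpotency. Its Jordan form is strictly upper triangular for the index order. *)
Lemma block_jordan F p0 : monotone_mx F -> nilpotent_mx F ->
  exists TT : 'M[K]_D * 'M[K]_D,
    [/\ forall p q, TT.1 p q != 0 -> p \in same_supp p0 /\ q \in same_supp p0,
        forall p q, TT.2 p q != 0 -> p \in same_supp p0 /\ q \in same_supp p0,
        TT.1 *m TT.2 = proj_mx K (same_supp p0), TT.2 *m TT.1 = proj_mx K (same_supp p0)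
      & forall p q, (TT.1 *m F *m TT.2) p q != 0 -> (p < q)%N].
Proof.
move=> mF [N FN]; set B := same_supp p0.
pose g := @enum_val _ (mem B).
have g_inj : injective g by exact: enum_val_inj.
have g_im p : (p \in B) = [exists i, g i == p].
  apply/idP/existsP => [pB|[i /eqP <-]]; last exact: enum_valP.
  by exists (enum_rank_in pB p); rewrite /g enum_rankK_in.
set s := sel K g.
have conv h p q : p \in B -> q \in B -> ((F *m proj_mx K B) ^+ h) p q = (F ^+ h) p q.
  move=> pB; elim: h q => [|h IH] q qB; first by rewrite !expr0.
  rewrite !exprSr -!mulmxE mxE [RHS]mxE; apply: eq_bigr => r _.
  rewrite mul_mx_proj qB mulr1; have [rB|rB] := boolP (r \in B); first by rewrite IH.
  have -> : ((F *m proj_mx K B) ^+ h) p r = 0.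
    case: h {IH} => [|h]; first by rewrite expr0 mxE; case: eqP rB => // <-; rewrite pB.
    by rewrite exprSr -mulmxE mulmxA mul_mx_proj (negbTE rB) mulr0.
  rewrite mul0r; apply/esym/eqP; rewrite mulf_eq0; apply/contraT; rewrite negb_or.
  case/andP => /(monotone_mxX mF) h1 /mF h2; case/negP: rB.
  move: pB qB h1 h2; rewrite !inE => /eqP-> /eqP->.
  by case: (supp r) (supp p0) => [a b] [a' b'] /= *; apply/eqP; congr pair; lia.
have NX : sub_mx g F ^+ N = 0.
  rewrite (sub_mxX g_inj g_im); apply/matrixP => i j; rewrite mul_trsel mul_sel conv.
  - by rewrite FN !mxE.
  - exact: enum_valP.
  - exact: enum_valP.
have [lam [_ _ [P uP NE]]] := jordan_form NX.
set J := jmx K _ lam in NE.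
have sK : s *m s^T = 1%:M by exact: selK.
have tK : s^T *m s = proj_mx K B by exact: trselK.
have supported (A : 'M_#|B|) p q : (s^T *m A *m s) p q != 0 ->
    exists i j, [/\ g i = p, g j = q & A i j != 0].
  move=> nz; have [i /eqP ip] : exists i, g i == p.
    apply/existsP; rewrite -g_im; apply: contraNT nz => pB.
    by rewrite -[s^T](proj_trsel K g_inj g_im) -!mulmxA mul_proj_mx (negbTE pB) mul0r.
  have [j /eqP jq] : exists j, g j == q.
    apply/existsP; rewrite -g_im; apply: contraNT nz => qB.
    by rewrite -[s](sel_proj K g_inj g_im) !mulmxA mul_mx_proj (negbTE qB) mulr0.
  exists i, j; split=> //; move: nz; rewrite -ip -jq -mul_trsel -mul_sel -/s.
  by rewrite !mulmxA sK mul1mx -mulmxA sK mulmx1.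
exists (s^T *m P *m s, s^T *m invmx P *m s); split=> /=.
- by move=> p q /supported[i [j [<- <- _]]]; split; exact: enum_valP.
- by move=> p q /supported[i [j [<- <- _]]]; split; exact: enum_valP.
- by rewrite -!mulmxA (mulmxA s) sK mul1mx (mulmxA P) mulmxV // mul1mx tK.
- by rewrite -!mulmxA (mulmxA s) sK mul1mx (mulmxA (invmx P)) mulVmx // mul1mx tK.
have -> : s^T *m P *m s *m F *m (s^T *m invmx P *m s) = s^T *m J *m s.
  rewrite !mulmxA -(mulmxA _ s F) -(mulmxA _ (s *m F)) -/(sub_mx g F) NE.
  by rewrite !mulmxA -(mulmxA _ P) mulmxV // mulmx1 -(mulmxA _ P) mulmxV // mulmx1.
move=> p q /supported[i [j [<- <-]]]; rewrite mxE.
have [e _|ne] := eqVneq (j : nat) i.+1; last by rewrite /= mulr0n eqxx.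
by apply: enum_val_mono; rewrite e.
Qed.

Lemma strict_conj F : monotone_mx F -> nilpotent_mx F ->
  exists T T' F', [/\ block_diag_mx T, block_diag_mx T', T *m T' = 1%:M /\ T' *m T = 1%:M,
    strict_mx (@lexa n M) (@lexb n M) F' & F = T' *m F' *m T].
Proof.
move=> mF nF; have [f hf] := fin_all_exists (fun p0 => block_jordan p0 mF nF).
(* One representative per class of equal intervals, so that all members use the same base change. *)
pose r p := odflt p [pick q | supp q == supp p].
have r_supp p : supp (r p) = supp p.
  by rewrite /r; case: pickP => [q /eqP//|].
have r_eq p q : supp p = supp q -> r p = r q.
  move=> e; rewrite /r e; case: pickP => // /(_ q); by rewrite eqxx.
have inB p q : (q \in same_supp (r p)) = (supp q == supp p) by rewrite inE r_supp.
pose T : 'M[K]_D := \matrix_(p, q) if supp p == supp q then (f (r p)).1 p q else 0.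
pose T' : 'M[K]_D := \matrix_(p, q) if supp p == supp q then (f (r p)).2 p q else 0.
have TE p q l : supp p = supp q -> T p l = (f (r q)).1 p l.
  move=> e; rewrite mxE (r_eq _ _ e); case: eqP => // ne; apply/esym/eqP/contraT.
  by case: (hf (r q)) => h1 _ _ _ _ /h1 [_]; rewrite inB -e eq_sym => /eqP.
have T'E p q l : supp p = supp q -> T' l p = (f (r q)).2 l p.
  move=> e; rewrite mxE; case: eqP => [e'|ne]; first by rewrite (r_eq l q) // e'.
  apply/esym/eqP/contraT.
  by case: (hf (r q)) => _ h1 _ _ _ /h1 []; rewrite inB -e => /eqP.
have bT : block_diag_mx T by move=> p q; rewrite mxE; case: (eqVneq (supp p) (supp q)) => // _; rewrite eqxx.
have bT' : block_diag_mx T' by move=> p q; rewrite mxE; case: (eqVneq (supp p) (supp q)) => // _; rewrite eqxx.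
have T'E2 p q l : supp p = supp q -> T' p l = (f (r q)).2 p l.
  move=> e; rewrite mxE (r_eq _ _ e); case: eqP => // ne; apply/esym/eqP/contraT.
  by case: (hf (r q)) => _ h1 _ _ _ /h1 [_]; rewrite inB -e eq_sym => /eqP.
have TE2 p q l : supp p = supp q -> T l p = (f (r q)).1 l p.
  move=> e; rewrite mxE; case: eqP => [e'|ne]; first by rewrite (r_eq l q) // e'.
  apply/esym/eqP/contraT.
  by case: (hf (r q)) => h1 _ _ _ _ /h1 []; rewrite inB -e => /eqP.
have bM A A' : block_diag_mx A -> block_diag_mx A' -> forall p q, supp p != supp q -> (A *m A') p q = 0.
  move=> bA bA' p q; apply: contraNeq; rewrite mxE => nz.
  have [l] : exists l, A p l * A' l q != 0.
    apply/existsP; apply: contraNT nz => /existsPn z.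
    by rewrite big1 // => i _; apply/eqP; move: (z i); rewrite negbK.
  by rewrite mulf_eq0 negb_or => /andP[/bA -> /bA' ->].
have TT' : T *m T' = 1%:M.
  apply/matrixP => p q; rewrite [RHS]mxE.
  have [e|ne] := eqVneq (supp p) (supp q); last first.
    by rewrite bM //; case: (eqVneq p q) ne => // ->; rewrite eqxx.
  rewrite mxE (eq_bigr (fun l => (f (r q)).1 p l * (f (r q)).2 l q)); last first.
    by move=> l _; rewrite (TE p q) // (T'E q q).
  case: (hf (r q)) => _ _ h _ _; have := congr1 (fun A : 'M_D => A p q) h.
  by rewrite mxE proj_mxE inB e eqxx andbT.
have T'T : T' *m T = 1%:M.
  apply/matrixP => p q; rewrite [RHS]mxE.
  have [e|ne] := eqVneq (supp p) (supp q); last first.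
    by rewrite bM //; case: (eqVneq p q) ne => // ->; rewrite eqxx.
  rewrite mxE (eq_bigr (fun l => (f (r q)).2 p l * (f (r q)).1 l q)); last first.
    by move=> l _; rewrite (T'E2 p q) // (TE2 q q).
  case: (hf (r q)) => _ _ _ h _; have := congr1 (fun A : 'M_D => A p q) h.
  by rewrite mxE proj_mxE inB e eqxx andbT.
exists T, T', (T *m F *m T'); split=> //; last first.
  by rewrite !mulmxA T'T mul1mx -mulmxA T'T mulmx1.
have mono : monotone_mx (T *m F *m T').
  by apply: monotone_mxM; [apply: monotone_mxM => //|]; exact: block_diag_monotone.
move=> p q nz; have /andP[h1 h2] := mono p q nz.
have h3 : supp p = supp q -> (p < q)%N.
  move=> e; case: (hf (r q)) => _ _ _ _; apply; move: nz; apply: contra => /eqP z.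
  apply/eqP; rewrite -z mxE [RHS]mxE; apply: eq_bigr => l _.
  rewrite (T'E q q) // ; congr (_ * _).
  by rewrite mxE [RHS]mxE; apply: eq_bigr => l' _; rewrite (TE p q).
rewrite !pltE (lexaE M_inP) (lexbE m_n M_inP).
case: (supp p) (supp q) h1 h2 h3 => [a b] [a' b'] /= h1 h2 h3.
have [ea|na] := eqVneq a a'; have [eb|nb] := eqVneq b b'; rewrite /=; try lia.
by rewrite h3 ?ea ?eb // !orbT.
Qed.

End Triangular.

(** * Genericity in the variety of nilpotent endomorphisms *)

Section Genericity.
Variables (K : fieldType) (n m : nat) (M : seq (nat * nat)).
Hypothesis nonroot : forall P : {poly K}, P != 0 -> exists t, ~~ root P t.
Hypotheses (m_n : (1 <= m <= n)%N) (M_inP : all (inP n m) M).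
Local Notation D := (size M).
Local Notation supp := (@supp M).
Local Notation lexa := (@lexa n M).
Local Notation lexb := (@lexb n M).
Implicit Types (F T N : 'M[K]_D) (i h : nat) (p q : 'I_D).

Lemma block_diag_commute T (S : {set 'I_D}) :
  (forall p q, supp p = supp q -> (p \in S) = (q \in S)) -> block_diag_mx T ->
  T *m proj_mx K S = proj_mx K S *m T.
Proof.
move=> hS bT; apply/matrixP => p q; rewrite mul_mx_proj mul_proj_mx mulrC.
by have [->|/bT /hS ->] := eqVneq (T p q) 0; rewrite ?mulr0.
Qed.

(** A block diagonal matrix commutes with the projection on each class of equal intervals, and so
    does its inverse. *)
Lemma block_diag_invmx T : block_diag_mx T -> T \in unitmx -> block_diag_mx (invmx T).
Proof.
move=> bT uT p q nz; apply/eqP/contraT => ne; case/negP: nz.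
have hS a b : supp a = supp b -> (a \in same_supp p) = (b \in same_supp p).
  by rewrite !inE => ->.
have : proj_mx K (same_supp p) *m invmx T = invmx T *m proj_mx K (same_supp p).
  apply: (can_inj (mulKmx uT)); rewrite mulmxA (block_diag_commute hS bT).
  by rewrite -mulmxA mulmxV // mulmx1 mulmxA mulmxV // mul1mx.
move/(congr1 (fun A : 'M_D => A p q)); rewrite mul_proj_mx mul_mx_proj !inE eqxx mul1r => ->.
by rewrite [supp q == _]eq_sym (negbTE ne) mulr0.
Qed.

Lemma strict_monotone F : strict_mx lexa lexb F -> monotone_mx F.
Proof.
move=> sF p q /sF; rewrite !pltE (lexaE M_inP) (lexbE m_n M_inP).
case: (supp p) (supp q) => [a b] [a' b'] /=; lia.
Qed.

Lemma strict_nilpotent F : strict_mx lexa lexb F -> nilpotent_mx F.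
Proof.
move=> sF; have [N hN] := strict_nilp setT sF; exists N.
by have := hN N (leqnn _); rewrite /corner_pow proj_setT mulmx1 mul1mx.
Qed.

(* Conjugating by a path of block diagonal matrices, with the adjugate in place
   of the inverse, joins two nilpotent endomorphisms by a polynomial curve. *)
Lemma nilpotent_curve F0 F1 : monotone_mx F0 -> nilpotent_mx F0 ->
  monotone_mx F1 -> nilpotent_mx F1 ->
  exists (G : 'M[{poly K}]_D) (d : {poly K}),
    [/\ d != 0, map_mx (horner_eval 0) G = F0, map_mx (horner_eval 1) G = F1 &
        forall t, d.[t] != 0 -> monotone_mx (map_mx (horner_eval t) G) /\
                                nilpotent_mx (map_mx (horner_eval t) G)].
Proof.
move=> mF0 nF0 mF1 nF1.
have [T0 [T0' [N0 [bT0 _ [TT0 TT0'] sN0 ->]]]] := strict_conj m_n M_inP mF0 nF0.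
have [T1 [T1' [N1 [bT1 _ [TT1 TT1'] sN1 ->]]]] := strict_conj m_n M_inP mF1 nF1.
have d0 : \det T0 != 0 by rewrite -unitfE -unitmxE; case: (mulmx1_unit TT0).
have d1 : \det T1 != 0 by rewrite -unitfE -unitmxE; case: (mulmx1_unit TT1).
pose pen (A B : 'M[K]_D) : 'M[{poly K}]_D := map_mx polyC A + 'X *: map_mx polyC (B - A).
have penE A B t : map_mx (horner_eval t) (pen A B) = A + t *: (B - A).
  by apply/matrixP => p q; rewrite !mxE /horner_eval !hornerE.
(* The inverse determinants cancel the factor brought in by the adjugate at t = 0 and t = 1. *)
pose T := pen T0 T1; pose N := pen ((\det T0)^-1 *: N0) ((\det T1)^-1 *: N1).
have detE t : (\det T).[t] = \det (T0 + t *: (T1 - T0)).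
  by rewrite -[LHS]/(horner_eval t (\det T)) -det_map_mx penE.
have GE t : map_mx (horner_eval t) (\adj T *m N *m T) =
    \adj (T0 + t *: (T1 - T0)) *m map_mx (horner_eval t) N *m (T0 + t *: (T1 - T0)).
  by rewrite !map_mxM map_mx_adj /= penE.
have adjE (A A' : 'M[K]_D) : A *m A' = 1%:M -> \adj A = \det A *: A'.
  by move=> h; rewrite -(mulmx1 (\adj A)) -h mulmxA mul_adj_mx mul_scalar_mx.
exists (\adj T *m N *m T), (\det T); split.
- apply/eqP => e; have := detE 0; rewrite e horner0 scale0r addr0 => /esym/eqP.
  by rewrite (negbTE d0).
- rewrite GE scale0r addr0 penE scale0r addr0 (adjE _ _ TT0).
  by rewrite -!scalemxAl -!scalemxAr -scalemxAl scalerA mulfV // scale1r.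
- rewrite GE penE !scale1r ![_ + (_ - _)]addrC !subrK (adjE _ _ TT1).
  by rewrite -!scalemxAl -!scalemxAr -scalemxAl scalerA mulfV // scale1r.
move=> t; rewrite detE GE penE; set A := T0 + _; set B := _ + _ => dA.
have uA : A \in unitmx by rewrite unitmxE unitfE.
rewrite (adjE A (invmx A)) ?mulmxV // -!scalemxAl.
have bA : block_diag_mx A.
  move=> p q; rewrite !mxE => nz; apply/eqP; apply: contraNT nz => ne.
  have z (X : 'M[K]_D) : block_diag_mx X -> X p q = 0.
    by move=> bX; apply/eqP; apply: contraNT ne => /bX ->.
  by rewrite (z T0) // (z T1) // subr0 mulr0 addr0.
have sB : strict_mx lexa lexb B.
  apply: strict_pencil => p q; rewrite mxE mulf_eq0 negb_or => /andP[_];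
  [exact: sN0|exact: sN1].
split.
  move=> p q; rewrite mxE mulf_eq0 negb_or => /andP[_]; move: p q.
  apply: monotone_mxM; last exact: block_diag_monotone.
  apply: monotone_mxM; last exact: strict_monotone.
  exact/block_diag_monotone/block_diag_invmx.
have [h Bh] := strict_nilpotent sB; exists h.
have -> : (\det A *: (invmx A *m B *m A)) ^+ h = (\det A) ^+ h *: (invmx A *m B ^+ h *m A).
  elim: h {Bh} => [|h IH]; first by rewrite !expr0 mulmx1 mulVmx // scale1r.
  rewrite exprSr IH -mulmxE -scalemxAl -scalemxAr scalerA -exprSr; congr (_ *: _).
  by rewrite [in RHS]exprSr -mulmxE -!mulmxA (mulmxA A) mulmxV // mul1mx.
by rewrite Bh mulmx0 mul0mx scaler0.
Qed.

Definition coord_of F : 'I_(nvars n M) -> K := @Defs.coord K n M (fun i => sub_at i F).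

Lemma meval_curve (G : 'M[{poly K}]_D) (g : {mpoly K[nvars n M]}) :
  exists P : {poly K}, forall t, P.[t] = g.@[coord_of (map_mx (horner_eval t) G)].
Proof.
have [V hV] : exists V : 'I_(nvars n M) -> {poly K}, forall t j,
    coord_of (map_mx (horner_eval t) G) j = (V j).[t].
  exists (fun j => let: i := (j %/ (D * D))%N in
    match insub (((j %% (D * D)) %/ D)%N) : option 'I_(Defs.dimv M i),
          insub ((j %% D)%N) : option 'I_(Defs.dimv M i) with
    | Some p, Some q => G (vtx p) (vtx q) | _, _ => 0 end).
  move=> t j; rewrite /coord_of /Defs.coord /entry.
  case: insubP => [p _ _|_]; last by rewrite horner0.
  case: insubP => [q _ _|_]; last by rewrite horner0.
  by rewrite /sub_at sub_mxE mxE.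
exists (\sum_(u <- msupp g) (g@_u)%:P * \prod_j V j ^+ u j) => t.
rewrite mevalE horner_sum; apply: eq_bigr => u _.
rewrite hornerM hornerC horner_prod; congr (_ * _).
by apply: eq_bigr => j _; rewrite hornerE hV.
Qed.

Definition nonvanishing (g : {mpoly K[nvars n M]}) :=
  exists F, [/\ monotone_mx F, nilpotent_mx F & g.@[coord_of F] != 0].

(** Irreducibility of the variety: on a curve through witnesses for both factors, [g1], [g2] and the
    determinant become nonzero polynomials in t with a common non-root. *)
Lemma nonvanishingM g1 g2 : nonvanishing g1 -> nonvanishing g2 -> nonvanishing (g1 * g2).
Proof.
move=> [F0 [mF0 nF0 h0]] [F1 [mF1 nF1 h1]].
have [G [d [dn0 G0 G1 hG]]] := nilpotent_curve mF0 nF0 mF1 nF1.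
have [P1 hP1] := meval_curve G g1; have [P2 hP2] := meval_curve G g2.
have nz : d * (P1 * P2) != 0.
  rewrite !mulf_neq0 //.
    by apply: contraNneq h0 => e; rewrite -G0 -hP1 e horner0.
  by apply: contraNneq h1 => e; rewrite -G1 -hP2 e horner0.
have [t] := nonroot nz; rewrite /root !hornerM !mulf_eq0 !negb_or => /and3P[dt P1t P2t].
have [mG nG] := hG t dt; exists (map_mx (horner_eval t) G); split=> //.
by rewrite mevalM mulf_neq0 // -?hP1 -?hP2.
Qed.

Lemma coord_nend (f : famT K M) F : (forall i, (1 <= i <= n)%N -> f i = sub_at i F) ->
  @Defs.coord K n M f =1 coord_of F.
Proof.
move=> fF j; rewrite /coord_of /Defs.coord.
have jn : (j %/ (D * D) <= n)%N.
  have := ltn_ord j; rewrite {2}/nvars; case: (posnP (D * D)) => [->|D0]; first by rewrite muln0.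
  by rewrite -[(_ %/ _ <= n)%N]ltnS ltn_divLR.
move: jn; set i := (j %/ (D * D))%N.
case: (posnP i) => [->|i0] jn; last by rewrite fF // i0.
(* Coordinates are also allotted to the index 0, which is not a vertex; the space there is zero, so
   they vanish. *)
have d0 : Defs.dimv M 0 = 0%N.
  apply/eqP; rewrite /Defs.dimv size_eq0 -(negbK (_ == _)) -has_filter; apply/hasPn => x.
  rewrite mem_iota add0n => /andP[_ xD].
  have := supp_bounds M_inP (Ordinal xD); rewrite /in_int /=; case=> h1 _ _ _.
  by rewrite negb_and -ltnNge h1.
have e (A : 'M[K]_(Defs.dimv M 0)) a b : entry A a b = 0.
  by rewrite /entry insubF // d0.
by rewrite !e.
Qed.

(** By irreducibility a nonempty basic open set is dense. *)
Lemma generically_sub_at (P : famT K M -> Prop) g : nonvanishing g ->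
  (forall f, is_nend n f -> g.@[@Defs.coord K n M f] != 0 -> P f) -> @generically K n M P.
Proof.
move=> ng gP; exists g; split=> // h hh f /(nend_sub_at m_n M_inP) [F [mF nF fF]].
rewrite (meval_eq _ (coord_nend fF)); apply/eqP/contraT => hF.
have [F' [mF' nF']] : nonvanishing (g * h) by apply: nonvanishingM => //; exists F.
have := hh _ (sub_at_nend m_n M_inP mF' nF').
rewrite mevalM mulf_eq0 negb_or => e /andP[/e /eqP h1 h2].
by move: h2; rewrite h1.
Qed.

(** A dense open set meets the locus where [g] does not vanish, so a generic property can be
    exploited at a point of that locus. *)
Lemma generically_meets (P : famT K M -> Prop) g (Q : bool) :
  nonvanishing g -> @generically K n M P ->
  (forall f F, monotone_mx F -> nilpotent_mx F -> (forall i, (1 <= i <= n)%N -> f i = sub_at i F) ->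
     g.@[coord_of F] != 0 -> P f -> Q) -> Q.
Proof.
move=> [F0 [mF0 nF0 gF0]] [g' [dense gP]] hQ; apply/contraT => nQ; case/negP: gF0.
apply/eqP; apply: (dense g) (sub_at_nend m_n M_inP mF0 nF0) => f fE g'f.
have [F [mF nF fF]] := nend_sub_at m_n M_inP fE.
apply/eqP/contraT => gf; case/negP: nQ; apply: (hQ f F mF nF fF) (gP f fE g'f).
by rewrite -(meval_eq _ (coord_nend fF)).
Qed.

(** Block diagonal conjugation commutes with the projections on the summands through i and preserves
    corner ranks, which reduces to strict matrices. *)
Lemma rank_nilpotent_le F i h : monotone_mx F -> nilpotent_mx F ->
  (\rank (sub_at i F ^+ h) <= gk_rank lexa lexb (through supp i) h)%N.
Proof.
move=> mF nF; rewrite (rank_sub_at i F h).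
have [T [T' [N [bT bT' [TT' T'T] sN ->]]]] := strict_conj m_n M_inP mF nF.
set S := through supp i.
have hS p q : supp p = supp q -> (p \in S) = (q \in S) by rewrite !inE => ->.
apply: leq_trans (rank_corner_le nonroot (@lexa_inj n M) (@lexb_inj n M) S h sN).
have -> : corner_pow (T' *m N *m T) S h = T' *m corner_pow N S h *m T.
  elim: h => [|h IH].
    by rewrite !corner_pow0 (block_diag_commute hS bT') -mulmxA T'T mulmx1.
  rewrite !corner_powSr IH -!mulmxA (block_diag_commute hS bT).
  by rewrite (mulmxA T T') TT' mul1mx.
exact: leq_trans (mxrankM_maxl _ _) (mxrankM_maxr _ _).
Qed.

Lemma nvars_lt i (p q : 'I_(Defs.dimv M i)) : (i <= n)%N -> (i * (D * D) + p * D + q < nvars n M)%N.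
Proof.
have dD : (Defs.dimv M i <= D)%N by rewrite /Defs.dimv /idxn size_filter (leq_trans (count_size _ _)) // size_iota.
move=> iN; have pD := leq_trans (ltn_ord p) dD; have qD := leq_trans (ltn_ord q) dD.
rewrite /nvars; apply: leq_trans (_ : i.+1 * (D * D) <= _)%N; last by rewrite leq_mul2r ltnS iN orbT.
rewrite -addnA mulSn [X in (_ <= X)%N]addnC ltn_add2l.
by apply: leq_trans (_ : p.+1 * D <= _)%N; [rewrite mulSn; lia | rewrite leq_mul2r pD orbT].
Qed.

(** The polynomial is a minor of the h-th power of the matrix of coordinate variables at vertex
    i. *)
Lemma rank_polynomial i h F1 : (1 <= i <= n)%N -> monotone_mx F1 -> nilpotent_mx F1 ->
  exists2 g, nonvanishing g & forall F, g.@[coord_of F] != 0 ->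
    (\rank (sub_at i F1 ^+ h) <= \rank (sub_at i F ^+ h))%N.
Proof.
move=> /andP[i1 iN] mF1 nF1.
have dD : (Defs.dimv M i <= D)%N by rewrite /Defs.dimv /idxn size_filter (leq_trans (count_size _ _)) // size_iota.
pose X : 'M[{mpoly K[nvars n M]}]_(Defs.dimv M i) := \matrix_(p, q) 'X_(Ordinal (nvars_lt p q iN)).
have XE F : map_mx (meval (coord_of F)) X = sub_at i F.
  apply/matrixP => p q; rewrite [LHS]mxE [X in meval _ X]mxE mevalXU /coord_of /Defs.coord /=.
  have pD := leq_trans (ltn_ord p) dD; have qD := leq_trans (ltn_ord q) dD.
  have D0 : (0 < D)%N by apply: leq_ltn_trans pD.
  have lt : (p * D + q < D * D)%N.
    by apply: leq_trans (_ : p.+1 * D <= _)%N; [rewrite mulSn; lia | rewrite leq_mul2r pD orbT].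
  rewrite -addnA divnMDl ?muln_gt0 ?D0 // (divn_small lt) addn0.
  rewrite modnMDl (modn_small lt) divnMDl // (divn_small qD) addn0.
  rewrite (_ : (i * (D * D) + (p * D + q) = (i * D + p) * D + q)%N); last by rewrite mulnDl -mulnA addnA.
  rewrite modnMDl (modn_small qD).
  by rewrite /entry !valK.
have [g gF1 hg] := rank_semicont (X ^+ h) (meval (coord_of F1)).
exists g => [|F gF]; first by exists F1.
by have := hg (meval (coord_of F)) gF; rewrite !rmorphXn /= !XE.
Qed.

Lemma generic_rank i : (1 <= i <= n)%N -> exists2 g, nonvanishing g &
  forall F h, monotone_mx F -> nilpotent_mx F -> g.@[coord_of F] != 0 ->
    \rank (sub_at i F ^+ h) = gk_rank lexa lexb (through supp i) h.
Proof.
move=> hi; set H := gk_rank _ _ _.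
have main e : exists2 g, nonvanishing g & forall F, g.@[coord_of F] != 0 ->
    forall h, (h < e)%N -> (H h <= \rank (sub_at i F ^+ h))%N.
  elim: e => [|e [g ng IH]].
    exists 1 => //; exists 0; split; first by move=> p q; rewrite mxE eqxx.
      by exists 1%N; rewrite expr1.
    by rewrite rmorph1 oner_eq0.
  have [F1 sF1 hF1] := gk_rank_attained K (@lexa_inj n M) (@lexb_inj n M) (through supp i) e.
  have [g' ng' hg'] := rank_polynomial e hi (strict_monotone sF1) (strict_nilpotent sF1).
  exists (g * g'); first exact: nonvanishingM.
  move=> F; rewrite mevalM mulf_eq0 negb_or => /andP[gF g'F] h.
  rewrite ltnS leq_eqVlt => /predU1P[->|]; last exact: IH.
  by apply: leq_trans hF1 _; rewrite -rank_sub_at hg'.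
(* From exponent [D] on both sides vanish, so finitely many polynomials suffice. *)
have [g ng hg] := main D.
exists g => // F h mF nF gF; apply/eqP; rewrite eqn_leq rank_nilpotent_le //=.
have [hD|Dh] := ltnP h D; first exact: hg.
rewrite /H /gk_rank big1 // => j _; apply/eqP; rewrite subn_eq0.
apply: leq_trans Dh; apply: leq_trans (card_le_D (through supp i)).
by apply: leq_trans (gk_le_card lexa lexb j.+1 _); rewrite gkE leq_addl.
Qed.

Lemma jtype_generic i F lam : (1 <= i <= n)%N -> 
  (forall h, \rank (sub_at i F ^+ h) = gk_rank lexa lexb (through supp i) h) ->
  jtype (sub_at i F) lam -> nth 0%N lam =1 gk_part lexa lexb (through supp i).
Proof.
move=> hi rk jt; have [plam _ _] := jt; apply: (@partition_sum_nth _ _ D) => //.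
- by move=> a b ab; apply: gk_part_noninc => //; [exact: lexa_inj | exact: lexb_inj].
- by move=> j Dj; apply: gk_part_ge_D.
by move=> h; rewrite -(jtype_rank h jt) rk.
Qed.

Lemma gen_jf_exists i : (1 <= i <= n)%N -> exists lam, gen_jf K n M i lam.
Proof.
move=> hi; have [g ng hg] := generic_rank hi.
have [F0 [mF0 nF0 gF0]] := ng.
have jf F : monotone_mx F -> nilpotent_mx F -> exists lam, jtype (sub_at i F) lam.
  by move=> mF [N FN]; apply: (@jordan_form _ _ _ N); exact: (sub_at_nilp m_n M_inP i mF FN).
have [lam jlam] := jf F0 mF0 nF0; exists lam.
apply: (generically_sub_at ng) => f fE gf.
have [F [mF nF fF]] := nend_sub_at m_n M_inP fE.
rewrite (meval_eq _ (coord_nend fF)) in gf; rewrite fF //.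
have [lam' jlam'] := jf F mF nF.
have [pl _ _] := jlam; have [pl' _ _] := jlam'.
suff -> : lam = lam' by [].
apply: partition_eq => // j.
by rewrite (jtype_generic hi _ jlam) ?(jtype_generic hi _ jlam') // => h; apply: hg.
Qed.

Lemma gen_jf_nth i lam j : (1 <= i <= n)%N -> gen_jf K n M i lam ->
  nth 0%N lam j = gk_part lexa lexb (through supp i) j.
Proof.
move=> hi gl; have [g ng hg] := generic_rank hi; apply/eqP.
apply: (generically_meets ng gl) => f F mF nF fF gF; rewrite fF // => jt.
by rewrite (jtype_generic hi _ jt) // => h; apply: hg.
Qed.

End Genericity.

Local Open Scope nat_scope.

Theorem theorem6p3 (k : closedFieldType) (n m : nat) (M : seq (nat * nat)) :
  (1 <= m <= n)%N ->
  all (inP n m) M ->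
  (exists lam : nat -> seq nat,
      forall i, (1 <= i <= n)%N -> gen_jf k n M i (lam i)) /\
  (forall lam : nat -> seq nat,
      (forall i, (1 <= i <= n)%N -> gen_jf k n M i (lam i)) ->
      forall r c, (1 <= r <= n.+1 - m)%N -> (1 <= c <= m)%N ->
        rho_cell n m lam r c = HG n m M r c).
Proof.
move=> m_n M_inP.
have nonroot (P : {poly k}) : P != 0%R -> exists t, ~~ root P t by move/closed_nonrootP.
split.
  (* The partitions are chosen over a finite type containing the vertices; at index 0 the condition
     is vacuous. *)
  have ex (i : 'I_n.+1) : exists lam, 1 <= i -> gen_jf k n M i lam.
    case: (posnP i) => [->|i0]; first by exists [::].
    have [|lam h] := @gen_jf_exists k n m M nonroot m_n M_inP i; last by exists lam.
    by rewrite i0 -ltnS ltn_ord.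
  have [lam hlam] := fin_all_exists ex.
  exists (fun i => lam (inord i)) => i /andP[i1 iN].
  by have := hlam (inord i); rewrite inordK //; apply.
move=> lam hlam r c hr hc.
rewrite (HG_filling m_n M_inP nonroot hr hc) /rho_cell /rhoP ar_piE chain_rankE; try by lia.
set i := _ - _; have hi : 1 <= i <= n by rewrite /i; lia.
rewrite (gen_jf_nth nonroot m_n M_inP _ hi (hlam i hi)) /filling /shape setIT.
by congr (gk_part _ _ (through _ _) _); rewrite /i; lia.
Qed.
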